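(* There are exactly eighteen affine map equivalence classes and exactly fifteen critical set equivalence classes of quadratic maps of the plane, and they are related as follows. If two quadratic maps $f,g:\mathbb{R}^2\to\mathbb{R}^2$ are affinely map equivalent, then they are critical set equivalent. Conversely, if $f$ and $g$ are critical set equivalent, then they are affinely map equivalent, except when $f$ and $g$ belong to the two different affine map equivalence classes of one of the following three pairs of representatives (the two maps of each pair being critical set equivalent but not affinely map equivalent): (i) $(x^2-y^2,\,y)$ and $(x^2+y^2,\,y)$; (ii) $(x^2-y^2,\,0)$ and $(x^2+y,\,0)$; (iii) $(x^2+y^2,\,0)$ and $(x^2,\,0)$. The other twelve affine map equivalence classes are in one-to-one correspondence with the remaining twelve critical set equivalence classes.
   Context: A quadratic map of the plane is a map $Q:\mathbb{R}^2\to\mathbb{R}^2$ both of whose components are real polynomials in $(x,y)$ of degree at most two, with at least one of the six degree-two coefficients nonzero. Two maps $f,g:\mathbb{R}^2\to\mathbb{R}^2$ are affinely map equivalent if there exist invertible affine maps $h,k:\mathbb{R}^2\to\mathbb{R}^2$ with $k\circ f=g\circ h$. For a quadratic map $Q$, let $J_0=\{(x,y):\det DQ(x,y)=0\}$ and $J_1=Q(J_0)$. It is known that every quadratic map falls into one of the following fifteen types: (1) $J_0$ and $J_1$ are empty; (2) $J_0$ is a point and $J_1$ is a point; (3) $J_0$ is an ellipse and $J_1$ is a closed curve with three cusp points; (4) $J_0$ is a hyperbola and $J_1$ consists of two curves, one smooth and the other smooth except for a single cusp, each being the image of one branch of the hyperbola; (5a) $J_0$ is a pair of intersecting lines and $J_1$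 is the union of two rays emanating from the same point; (5b) $J_0$ is a pair of intersecting lines and $J_1$ is the union of a ray and a parabola, with the endpoint of the ray equal to the vertex of the parabola; (6) $J_0$ is a parabola and $J_1$ is a curve with a single cusp; (7a) $J_0$ is a pair of distinct parallel lines, $J_1$ is the union of a line and a point, one line of $J_0$ mapping onto the line and the other to the point; (7b) $J_0$ is a pair of coincident lines (i.e. $\det DQ$ is a nonzero constant times the square of a nonconstant affine function) and $J_1$ is a point; (8a), (8b), (8c) $J_0$ is a single line (i.e. $\det DQ$ is a nonconstant affine function) and $J_1$ is, respectively, a point, a line, a parabola; (9a), (9b), (9c) $J_0=\mathbb{R}^2$ and $J_1$ is, respectively, a line, a ray, a parabola. Two quadratic maps are critical set equivalent if they are of the same type in this list. A ''cusp'' is an ordinary cusp in the usual sense (locally diffeomorphic to $t\mapsto(t^2,t^3)$).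
   Formalization: In type (5b), ''vertex of the parabola'' is read as the vertex in suitable affine coordinates (so any point of the parabola); with the Euclidean vertex the types are not affinely invariant and some quadratic maps, such as (x²+y, x²+y+y²), would have no type. *)

(* Defs.v *)
From HB Require Import structures.
From mathcomp Require Import all_boot all_order all_algebra.
From mathcomp Require Import all_classical all_reals all_analysis.
Import Order.TTheory GRing.Theory Num.Theory numFieldNormedType.Exports.

Set Implicit Arguments.
Unset Strict Implicit.
Unset Printing Implicit Defensive.

Local Open Scope classical_set_scope.
Local Open Scope card_scope.
Local Open Scope ring_scope.

Section Plane.
Context {R : realType}.

Definition plane := 'rV[R]_2.

Definition pt (x y : R) : plane := \row_(i < 2) (if i == 0 then x else y).

Definition xc (p : plane) : R := p 0 0.
Definition yc (p : plane) : R := p 0 1.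

Definition quadratic_map (Q : plane -> plane) : Prop :=
  exists a b c d e k : 'I_2 -> R,
    (exists i, [|| a i != 0, b i != 0 | c i != 0]) /\
    forall p i, Q p 0 i = a i * xc p ^+ 2 + b i * (xc p * yc p) + c i * yc p ^+ 2
                          + d i * xc p + e i * yc p + k i.

Definition affine_iso (h : plane -> plane) : Prop :=
  exists (A : 'M[R]_2) (b : plane), A \in unitmx /\ forall p, h p = p *m A + b.

Definition affinely_equivalent (f g : plane -> plane) : Prop :=
  exists h k, [/\ affine_iso h, affine_iso k & k \o f = g \o h].

Definition detD (Q : plane -> plane) (p : plane) : R := \det ('J Q p).

Definition J0 (Q : plane -> plane) : set plane := [set p | detD Q p = 0].

Definition J1 (Q : plane -> plane) : set plane := Q @` J0 Q.

(* Conics are the images of a standard one under invertible affine maps. *)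

Definition is_point (C : set plane) : Prop := exists p, C = [set p].

Definition is_line (C : set plane) : Prop :=
  exists p v : plane, v != 0 /\ C = [set p + t *: v | t in [set: R]].

Definition is_ray (p : plane) (C : set plane) : Prop :=
  exists v : plane, v != 0 /\ C = [set p + t *: v | t in [set t : R | 0 <= t]].

Definition circle : set plane := [set p | xc p ^+ 2 + yc p ^+ 2 = 1].

Definition is_ellipse (C : set plane) : Prop :=
  exists2 h, affine_iso h & C = h @` circle.

(* [is_hyperbola B B' C]: C is a hyperbola with branches B and B'; the two
   branches play symmetric roles, since p |-> - p exchanges those of xy = 1 *)
Definition is_hyperbola (B B' C : set plane) : Prop :=
  exists h, [/\ affine_iso h,
    B = h @` [set p | xc p * yc p = 1 /\ 0 < xc p],
    B' = h @` [set p | xc p * yc p = 1 /\ xc p < 0] &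
    C = B `|` B'].

(* [is_parabola_at v C]: C is a parabola with vertex v in suitable affine
   coordinates. The Euclidean vertex is not preserved by affine maps: the types
   of critical sets would not be affinely invariant with that notion. *)
Definition is_parabola_at (v : plane) (C : set plane) : Prop :=
  exists h, [/\ affine_iso h, h (pt 0 0) = v &
                C = h @` [set p | yc p = xc p ^+ 2]].

Definition is_parabola (C : set plane) : Prop := exists v, is_parabola_at v C.

Definition affine_fun (l : plane -> R) (a b c : R) : Prop :=
  forall p, l p = a * xc p + b * yc p + c.

Definition nonconstant_affine (l : plane -> R) : Prop :=
  exists a b c, (a != 0) || (b != 0) /\ affine_fun l a b c.

(* On an open U, f is of class C^(n+1) when all its directional derivatives
   exist and are of class C^n: in finite dimension the continuity of the
   directional derivatives implies the differentiability of f. *)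
Fixpoint Cn_on (n : nat) (U : set plane) (f : plane -> plane) : Prop :=
  if n is m.+1 then
    (forall p v, U p -> derivable f p v) /\
    (forall v, Cn_on m U (fun p => 'D_v f p))
  else forall p, U p -> {for p, continuous f}.

Definition smooth_on (U : set plane) (f : plane -> plane) : Prop :=
  forall n, Cn_on n U f.

(* [diffeo U V psi chi]: psi is a diffeomorphism from U onto V, of inverse chi *)
Definition diffeo (U V : set plane) (psi chi : plane -> plane) : Prop :=
  [/\ open U, open V, smooth_on U psi, smooth_on V chi &
      (forall p, U p -> V (psi p) /\ chi (psi p) = p) /\
      (forall q, V q -> U (chi q) /\ psi (chi q) = q)].

(* some diffeomorphism between neighborhoods of p and of the origin takes
   the part of C near p to the part of M near the origin *)
Definition locally_like (M C : set plane) (p : plane) : Prop :=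
  exists U V psi chi,
    [/\ diffeo U V psi chi, U p, psi p = pt 0 0 &
        psi @` (C `&` U) = M `&` V].

Definition smooth_point : set plane -> plane -> Prop :=
  locally_like [set pt t 0 | t in [set: R]].

Definition cusp_point : set plane -> plane -> Prop :=
  locally_like [set pt (t ^+ 2) (t ^+ 3) | t in [set: R]].

Definition is_curve (C : set plane) : Prop :=
  exists2 gamma : R -> plane, continuous gamma & C = range gamma.

Definition is_closed_curve (C : set plane) : Prop :=
  exists2 gamma : plane -> plane,
    {within circle, continuous gamma} & C = gamma @` circle.

Definition smooth_except_cusps (n : nat) (C : set plane) : Prop :=
  [set p | cusp_point C p] #= `I_n /\
  forall p, C p -> ~ cusp_point C p -> smooth_point C p.

Inductive crit_type :=
  T1 | T2 | T3 | T4 | T5a | T5b | T6 | T7a | T7b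
| T8a | T8b | T8c | T9a | T9b | T9c.

Definition intersecting_lines (C : set plane) : Prop :=
  exists L L', [/\ is_line L, is_line L', L <> L', L `&` L' !=set0 &
                   C = L `|` L'].

(* Lines of J0 are counted with multiplicity: T7b and T8a-T8c both have a line
   as zero set of det DQ, and are told apart by the form of det DQ. *)
Definition has_type (Q : plane -> plane) (T : crit_type) : Prop :=
  match T with
  | T1 => J0 Q = set0 /\ J1 Q = set0
  | T2 => is_point (J0 Q) /\ is_point (J1 Q)
  | T3 => [/\ is_ellipse (J0 Q), is_closed_curve (J1 Q) &
              smooth_except_cusps 3 (J1 Q)]
  | T4 => exists B B',
      [/\ is_hyperbola B B' (J0 Q),
          J1 Q = (Q @` B) `|` (Q @` B'),
          is_curve (Q @` B) /\ is_curve (Q @` B'),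
          (forall p, (Q @` B) p -> smooth_point (Q @` B) p) &
          smooth_except_cusps 1 (Q @` B')]
  | T5a => intersecting_lines (J0 Q) /\
      exists p r r', [/\ is_ray p r, is_ray p r', r <> r' & J1 Q = r `|` r']
  | T5b => intersecting_lines (J0 Q) /\
      exists p r P, [/\ is_ray p r, is_parabola_at p P & J1 Q = r `|` P]
  | T6 => [/\ is_parabola (J0 Q), is_curve (J1 Q) &
              smooth_except_cusps 1 (J1 Q)]
  | T7a => exists L L' M p,
      [/\ [/\ is_line L, is_line L', L `&` L' = set0 & J0 Q = L `|` L'],
          is_line M, J1 Q = M `|` [set p], Q @` L = M & Q @` L' = [set p]]
  | T7b => is_point (J1 Q) /\
      exists (c : R) (l : plane -> R),
        [/\ c != 0, nonconstant_affine l & forall p, detD Q p = c * l p ^+ 2]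
  | T8a => nonconstant_affine (detD Q) /\ is_point (J1 Q)
  | T8b => nonconstant_affine (detD Q) /\ is_line (J1 Q)
  | T8c => nonconstant_affine (detD Q) /\ is_parabola (J1 Q)
  | T9a => J0 Q = setT /\ is_line (J1 Q)
  | T9b => J0 Q = setT /\ exists p, is_ray p (J1 Q)
  | T9c => J0 Q = setT /\ is_parabola (J1 Q)
  end.

Definition critically_equivalent (f g : plane -> plane) : Prop :=
  exists T, has_type f T /\ has_type g T.

Definition polymap (u v : R -> R -> R) (p : plane) : plane :=
  pt (u (xc p) (yc p)) (v (xc p) (yc p)).

Definition exceptional_pairs : set ((plane -> plane) * (plane -> plane)) :=
  [set (polymap (fun x y => x ^+ 2 - y ^+ 2) (fun x y => y),
        polymap (fun x y => x ^+ 2 + y ^+ 2) (fun x y => y));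
       (polymap (fun x y => x ^+ 2 - y ^+ 2) (fun x y => 0),
        polymap (fun x y => x ^+ 2 + y) (fun x y => 0));
       (polymap (fun x y => x ^+ 2 + y ^+ 2) (fun x y => 0),
        polymap (fun x y => x ^+ 2) (fun x y => 0))].

Definition exceptional_maps : set (plane -> plane) :=
  [set m | exists2 ab, exceptional_pairs ab & m = ab.1 \/ m = ab.2].

End Plane.

Arguments plane R : clear implicits.

Section Classes.
Context {T : Type}.
Implicit Types (S : set T) (E : T -> T -> Prop).

Definition equivalence_on S E : Prop :=
  [/\ forall f, S f -> E f f,
      forall f g, S f -> S g -> E f g -> E g f &
      forall f g h, S f -> S g -> S h -> E f g -> E g h -> E f h].

Definition class_of S E (f : T) : set T := [set g | S g /\ E f g].

Definition classes S E : set (set T) := [set class_of S E f | f in S].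

Definition has_classes (n : nat) S E : Prop :=
  equivalence_on S E /\ classes S E #= `I_n.

End Classes.

(* Main.v *)
Require Import Defs.
From HB Require Import structures.
From mathcomp Require Import all_boot all_order all_algebra.
From mathcomp Require Import all_classical all_reals all_analysis.
From mathcomp Require Import ring lra.
Import Order.TTheory GRing.Theory Num.Theory numFieldNormedType.Exports.

(* The Jacobian determinant of the quadratic part of a map is a binary quadratic
   form, covariant under linear changes of source and target. Reducing it to
   c (x^2 + y^2), c x y, c x^2 or 0 normalizes the span of the two quadratic
   parts, and completing squares then leaves eighteen normal forms; when this
   form is x^2 + y^2 (resp. x y), scaling the remaining linear terms to a fixed
   value takes a complex (resp. real) cube root.

   The critical set type is invariant under affine equivalence, because det DQ is
   only composed with an affine map and multiplied by a constant, and it is unique,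
   because the listed shapes of J0 and J1 are separated by affine invariants: being
   bounded, centrally symmetric, conical, affinely closed, containing a line or a
   ray. Hence it is enough to find the type of each normal form, and to separate
   the three pairs of normal forms that share their type.

   For the maps with cusps, parametrize the critical conic by (c, s) with
   s^2 = +- (1 - c^2). The image (S, D) has S quadratic in v = +- 1 +- c and D^2
   equal to v^3 (or v) times a positive factor, so that solving S for v and dividing
   D by a square root straightens the image onto y^2 = x^3 (or y^2 = x). The smooth
   points of y^2 = x^3 are not cusps since a differentiable arc inside this curve
   has zero speed at the origin. *)

Set Implicit Arguments.
Unset Strict Implicit.
Unset Printing Implicit Defensive.

Local Open Scope classical_set_scope.
Local Open Scope card_scope.
Local Open Scope ring_scope.

(** * Smooth functions on the plane *)

(** The coefficients of the Jacobian form are, up to a factor, the 2 by 2 minors of the matrix of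
    quadratic coefficients, that is the Plucker coordinates of the span of the two quadratic parts;
    this is why normalizing one form normalizes the pair. When all minors vanish, a change of target
    makes one component affine, and the quadratic part of the other is reduced instead. Smoothness
    is stated with directional derivatives only, while transporting cusps through charts requires a
    chain rule; the calculus therefore rests on the fact that continuous partial derivatives give
    differentiability. Each critical image with cusps is compared with a model through an explicit
    chart whose domain contains a whole branch, or a large arc of the deltoid, so that only the
    cuspidal cubic has to be studied point by point. The rotations of order three move that arc
    around the deltoid. *)

Section PlaneCoordinates.
Context {R : realType}.
Implicit Types (p q v : plane R) (x y t : R).

Lemma ord2_ind (P : 'I_2 -> Prop) : P 0 -> P 1 -> forall i, P i.
Proof.
move=> P0 P1 [[|[|//]] i2].
  by rewrite (_ : Ordinal i2 = 0)//; apply: val_inj.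
by rewrite (_ : Ordinal i2 = 1)//; apply: val_inj.
Qed.

Lemma xc_pt x y : xc (pt x y) = x. Proof. by rewrite /xc mxE. Qed.
Lemma yc_pt x y : yc (pt x y) = y. Proof. by rewrite /yc mxE. Qed.
Lemma xcD p q : xc (p + q) = xc p + xc q. Proof. by rewrite /xc mxE. Qed.
Lemma ycD p q : yc (p + q) = yc p + yc q. Proof. by rewrite /yc mxE. Qed.
Lemma xcN p : xc (- p) = - xc p. Proof. by rewrite /xc mxE. Qed.
Lemma ycN p : yc (- p) = - yc p. Proof. by rewrite /yc mxE. Qed.
Lemma xcZ t p : xc (t *: p) = t * xc p. Proof. by rewrite /xc mxE. Qed.
Lemma ycZ t p : yc (t *: p) = t * yc p. Proof. by rewrite /yc mxE. Qed.
Lemma xc0 : xc (0 : plane R) = 0. Proof. by rewrite /xc mxE. Qed.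
Lemma yc0 : yc (0 : plane R) = 0. Proof. by rewrite /yc mxE. Qed.

Definition coordE := (xc_pt, yc_pt, xcD, ycD, xcN, ycN, xcZ, ycZ, xc0, yc0).

Lemma plane_eq p q : xc p = xc q -> yc p = yc q -> p = q.
Proof.
by move=> ex ey; apply/rowP; elim/ord2_ind; [exact: ex|exact: ey].
Qed.

Lemma pt_eta p : pt (xc p) (yc p) = p.
Proof. by apply: plane_eq; rewrite !coordE. Qed.

Lemma pt_inj x y x' y' : pt x y = pt x' y' -> x = x' /\ y = y'.
Proof.
move=> e; have /(congr1 xc) := e; have /(congr1 yc) := e.
by rewrite !coordE.
Qed.

Lemma pt_neq0 x y : (pt x y != 0) = (x != 0) || (y != 0).
Proof.
rewrite -negb_and; congr (~~ _); apply/eqP/andP => [e|[/eqP-> /eqP->]].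
  by have /(congr1 xc) := e; have /(congr1 yc) := e; rewrite !coordE => -> ->.
by apply: plane_eq; rewrite !coordE.
Qed.

Lemma xc_cont : continuous (@xc R). Proof. exact: coord_continuous. Qed.
Lemma yc_cont : continuous (@yc R). Proof. exact: coord_continuous. Qed.

Lemma plane_cont (T : topologicalType) (f : T -> plane R) (t : T) :
  {for t, continuous (fun z => xc (f z))} ->
  {for t, continuous (fun z => yc (f z))} -> {for t, continuous f}.
Proof.
move=> fx fy A /nbhs_ballP [e e0 eA]; rewrite nbhs_simpl /=.
have hx : nbhs (xc (f t)) (ball (xc (f t)) e) by exact: nbhsx_ballx.
have hy : nbhs (yc (f t)) (ball (yc (f t)) e) by exact: nbhsx_ballx.
have : nbhs t [set z | ball (xc (f t)) e (xc (f z)) /\ ball (yc (f t)) e (yc (f z))].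
  by apply: filterI; [exact: fx hx|exact: fy hy].
apply: filterS => z /= [bx by_]; apply: eA.
by split=> // i; rewrite ord1; elim/ord2_ind.
Qed.

Lemma cont_coordP (T : topologicalType) (f : T -> plane R) (t : T) :
  {for t, continuous f} <->
  {for t, continuous (fun z => xc (f z))} /\
  {for t, continuous (fun z => yc (f z))}.
Proof.
split=> [cf|[]]; last exact: plane_cont.
by split; apply: (continuous_comp cf); [exact: xc_cont|exact: yc_cont].
Qed.

Lemma normr_xc p : `|xc p| <= `|p|.
Proof.
rewrite [leRHS]/Num.Def.normr /= mx_normrE.
exact: (le_bigmax _ (fun ij => `|p ij.1 ij.2|) (0, 0)).
Qed.

Lemma normr_yc p : `|yc p| <= `|p|.
Proof.
rewrite [leRHS]/Num.Def.normr /= mx_normrE.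
exact: (le_bigmax _ (fun ij => `|p ij.1 ij.2|) (0, 1)).
Qed.

Lemma plane_norm_lt p (e : R) : 0 < e -> `|xc p| < e -> `|yc p| < e -> `|p| < e.
Proof.
move=> e0 hx hy; rewrite [ltLHS]/Num.Def.normr /= mx_normrE.
by rewrite bigmax_lt //= => -[i j] _ /=; rewrite (ord1 i); elim/ord2_ind: j.
Qed.

End PlaneCoordinates.

(** * Differentiability from continuous partial derivatives *)

Section Differentiability.
Context {R : realType}.
Implicit Types (p q v : plane R) (s t : R) (f : plane R -> R).

Lemma is_derive_line f p v t : derivable f (p + t *: v) v ->
  is_derive t 1 (fun s : R => f (p + s *: v)) ('D_v f (p + t *: v)).
Proof.
move=> /derivableP d.
have E : (fun h : R => h^-1 *: (((fun s : R => f (p + s *: v)) \o shift t)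
    (h *: (1 : R)) - f (p + t *: v))) =
   (fun h : R => h^-1 *: ((f \o shift (p + t *: v)) (h *: v) - f (p + t *: v))).
  apply/funext => h /=; congr (_ *: (f _ - _)).
  by rewrite [_%:A]mulr1 scalerDl addrCA.
by split; [rewrite /derivable E; case: d | rewrite /derive E].
Qed.

(** The intermediate point is located only by [|c| <= |t|], so that later uses need not distinguish
    the sign of [t]. *)
Lemma MVT_line f p v (t : R) :
  (forall s : R, `|s| <= `|t| -> derivable f (p + s *: v) v) ->
  exists2 c : R, `|c| <= `|t| & f (p + t *: v) - f p = t * 'D_v f (p + c *: v).
Proof.
move=> df.
pose phi (s : R) := f (p + s *: v).
have dphi (s : R) : `|s| <= `|t| -> is_derive s 1 phi ('D_v f (p + s *: v)).
  by move=> /df; exact: is_derive_line.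
have cphi (s : R) : `|s| <= `|t| -> {for s, continuous phi}.
  move=> /dphi[d _]; apply: differentiable_continuous.
  exact/derivable1_diffP.
have phi0 : phi 0 = f p by rewrite /phi scale0r addr0.
case: (leP 0 t) => t0.
  have [|||c] := @MVT_segment R phi (fun s => 'D_v f (p + s *: v)) 0 t => //.
  - move=> s; rewrite in_itv /= => /andP[s0 st]; apply: dphi.
    by rewrite !ger0_norm // ltW.
  - apply: continuous_in_subspaceT => s; rewrite inE /= in_itv /= => /andP[s0 st].
    by apply: cphi; rewrite !ger0_norm // ltW.
  rewrite in_itv /= => /andP[c0 ct] e; exists c; first by rewrite !ger0_norm.
  by rewrite -phi0 -/(phi t) e subr0 mulrC.
have [|||c] := @MVT_segment R phi (fun s => 'D_v f (p + s *: v)) t 0 => //.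
- exact: ltW.
- move=> s; rewrite in_itv /= => /andP[s0 st]; apply: dphi.
  by rewrite !ltr0_norm // lerN2 ltW.
- apply: continuous_in_subspaceT => s; rewrite inE /= in_itv /= => /andP[s0 st].
  by apply: cphi; rewrite ler0_norm ?ltr0_norm // lerN2.
rewrite in_itv /= => /andP[c0 ct] e; exists c.
  by rewrite ler0_norm ?ltr0_norm // lerN2.
by rewrite -phi0 -/(phi t) -opprB e sub0r mulrN opprK mulrC.
Qed.

(** The differential of a function with partial derivatives [a] and [b]. *)
Definition lin2 (a b : R) (h : plane R) : R := xc h * a + yc h * b.

Lemma lin2_is_linear a b : linear (lin2 a b).
Proof.
by move=> k u v; rewrite /lin2 !coordE /GRing.scale /=; ring.
Qed.

HB.instance Definition _ a b :=
  GRing.isLinear.Build R (plane R) R *:%R (lin2 a b) (lin2_is_linear a b).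

Lemma lin2_continuous a b : continuous (lin2 a b).
Proof.
move=> p; apply: (@continuousD _ _ _ (fun h => xc h * a) (fun h => yc h * b)).
  by apply: continuousM; [exact: xc_cont|exact: cst_continuous].
by apply: continuousM; [exact: yc_cont|exact: cst_continuous].
Qed.

Lemma norm_comb_le (x y A B H e : R) : `|x| <= H -> `|y| <= H ->
  `|A| < e / 2 -> `|B| < e / 2 -> `|x * A + y * B| <= e * H.
Proof.
move=> hx hy hA hB; apply: le_trans (ler_normD _ _) _; rewrite !normrM.
have -> : e * H = H * (e / 2) + H * (e / 2) by lra.
by apply: lerD; apply: ler_pM => //; exact: ltW.
Qed.

(* Continuous partial derivatives imply differentiability: apply the mean
   value theorem to each coordinate in turn. *)
Lemma C1_diff (U : set (plane R)) f p : open U -> U p ->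
  (forall q v, U q -> derivable f q v) ->
  (forall v q, U q -> {for q, continuous (fun q => 'D_v f q)}) ->
  is_diff p f (lin2 ('D_(pt 1 0) f p) ('D_(pt 0 1) f p)).
Proof.
move=> oU Up df cf.
set a := 'D_(pt 1 0) f p; set b := 'D_(pt 0 1) f p.
have expand : (f : plane R -> R^o) \o shift p =
    cst (f p) + (lin2 a b : plane R -> R^o) +o_ (0 : plane R) id.
  apply/eqaddoP => e e0.
  have nU : nbhs p U by exact: open_nbhs_nbhs.
  have na : nbhs p [set q | ball a (e / 2) ('D_(pt 1 0) f q)].
    by apply: (cf (pt 1 0) p Up); apply: nbhsx_ballx; lra.
  have nb : nbhs p [set q | ball b (e / 2) ('D_(pt 0 1) f q)].
    by apply: (cf (pt 0 1) p Up); apply: nbhsx_ballx; lra.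
  pose S := U `&` ([set q | ball a (e / 2) ('D_(pt 1 0) f q)] `&`
                   [set q | ball b (e / 2) ('D_(pt 0 1) f q)]).
  have nS : nbhs p S by exact: filterI nU (filterI na nb).
  have /nbhs_ballP[r r0 hr] := nS.
  have hr' q : `|xc q - xc p| < r -> `|yc q - yc p| < r ->
      [/\ U q, `|'D_(pt 1 0) f q - a| < e / 2 & `|'D_(pt 0 1) f q - b| < e / 2].
    move=> qx qy; have /hr[Uq [/= qa qb]] : ball p r q.
      rewrite -ball_normE /= distrC; apply: plane_norm_lt => //.
        by rewrite !coordE.
      by rewrite !coordE.
    by split=> //; rewrite distrC.
  apply/nbhs_ballP; exists r => //= h; rewrite -ball_normE /= sub0r normrN => hh.
  have hx : `|xc h| < r by apply: le_lt_trans hh; exact: normr_xc.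
  have hy : `|yc h| < r by apply: le_lt_trans hh; exact: normr_yc.
  have [|c1 c1h e1] := @MVT_line f p (pt 1 0) (xc h).
    move=> s sh; apply: df; have [] // := hr' (p + s *: pt 1 0).
      by rewrite !coordE mulr1 addrAC subrr add0r (le_lt_trans sh).
    by rewrite !coordE mulr0 addr0 subrr normr0.
  have [|c2 c2h e2] := @MVT_line f (p + xc h *: pt 1 0) (pt 0 1) (yc h).
    move=> s sh; apply: df; have [] // := hr' (p + xc h *: pt 1 0 + s *: pt 0 1).
      by rewrite !coordE mulr1 mulr0 addr0 addrAC subrr add0r.
    by rewrite !coordE mulr0 mulr1 addr0 addrAC subrr add0r (le_lt_trans sh).
  have eh : h + p = p + xc h *: pt 1 0 + yc h *: pt 0 1.
    by apply: plane_eq; rewrite !coordE; ring.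
  have [] := hr' (p + c1 *: pt 1 0).
  - by rewrite !coordE mulr1 addrAC subrr add0r (le_lt_trans c1h).
  - by rewrite !coordE mulr0 addr0 subrr normr0.
  move=> _ b1 _.
  have [] := hr' (p + xc h *: pt 1 0 + c2 *: pt 0 1).
  - by rewrite !coordE mulr1 mulr0 addr0 addrAC subrr add0r.
  - by rewrite !coordE mulr0 mulr1 addr0 addrAC subrr add0r (le_lt_trans c2h).
  move=> _ _ b2.
  rewrite !fctE /= /lin2 eh.
  set D1 := 'D_(pt 1 0) f _ in e1 b1; set D2 := 'D_(pt 0 1) f _ in e2 b2.
  (* The two mean value terms telescope, so the remainder is a combination of [D1 - a] and [D2 - b],
     both below [e / 2]. *)
  have -> : f (p + xc h *: pt 1 0 + yc h *: pt 0 1) -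
      (f p + (xc h * a + yc h * b)) = xc h * (D1 - a) + yc h * (D2 - b).
    have : f (p + xc h *: pt 1 0 + yc h *: pt 0 1) = yc h * D2 + xc h * D1 + f p.
      by rewrite -e2 -e1; ring.
    by move=> ->; ring.
  exact: norm_comb_le (normr_xc h) (normr_yc h) b1 b2.
have dE : 'd f p = lin2 a b :> (plane R -> R).
  by apply: diff_unique expand; exact: lin2_continuous.
apply: DiffDef => //; apply/diff_locallyP; rewrite dE; split=> //.
exact: lin2_continuous.
Qed.

End Differentiability.

Section DifferentiablePairs.
Context {R : realType}.

Lemma pt_lincomb (x y : R) : pt x y = x *: pt 1 0 + y *: pt 0 1.
Proof. by apply: plane_eq; rewrite !coordE; ring. Qed.

(** Decomposing the pair on the basis reduces it to sums and to scalar functions times fixed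
    vectors. *)
Lemma is_diff_pt (V : normedModType R) (g1 g2 : V -> R) (d1 d2 : V -> R) p :
  is_diff p g1 d1 -> is_diff p g2 d2 ->
  is_diff p (fun q => pt (g1 q) (g2 q)) (fun h => pt (d1 h) (d2 h)).
Proof.
move=> D1 D2.
have E1 : differentiable g1 p by [].
have E2 : differentiable g2 p by [].
have F1 : is_diff p (fun q => g1 q *: pt 1 0) (fun h => d1 h *: pt 1 0).
  apply: DiffDef; first exact: differentiableZl.
  by rewrite diffZl // diff_val.
have F2 : is_diff p (fun q => g2 q *: pt 0 1) (fun h => d2 h *: pt 0 1).
  apply: DiffDef; first exact: differentiableZl.
  by rewrite diffZl // diff_val.
have -> : (fun q => pt (g1 q) (g2 q)) =
    (fun q => g1 q *: pt 1 0) + (fun q => g2 q *: pt 0 1).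
  by apply/funext => q; rewrite pt_lincomb.
have -> : (fun h => pt (d1 h) (d2 h)) =
    (fun q => d1 q *: pt 1 0) + (fun q => d2 q *: pt 0 1).
  by apply/funext => q; rewrite pt_lincomb.
exact: is_diffD.
Qed.

End DifferentiablePairs.

(** * Calculus of scalar functions of class C^n *)

Section ScalarSmoothness.
Context {R : realType}.
Implicit Types (p q v : plane R) (U : set (plane R)) (f g : plane R -> R).

(** The scalar counterpart of [Cn_on]: products, inverses and square roots are handled here, and
    [Cn_coord] transfers the result to maps of the plane. *)
Fixpoint Cs (n : nat) U f : Prop :=
  if n is m.+1 then
    (forall p v, U p -> derivable f p v) /\ (forall v, Cs m U (fun p => 'D_v f p))
  else forall p, U p -> {for p, continuous f}.

Lemma near_open U p (P : plane R -> Prop) : open U -> U p ->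
  (forall q, U q -> P q) -> \forall q \near p, P q.
Proof.
by move=> oU Up UP; apply: filterS (open_nbhs_nbhs (conj oU Up)).
Qed.

(** Derivatives are local and [U] is open. Derivation formulas that hold only on [U] enter the
    inductions below through this lemma. *)
Lemma Cs_ext n U f g : open U -> (forall p, U p -> f p = g p) ->
  Cs n U f -> Cs n U g.
Proof.
move=> oU; elim: n f g => [|n IH] f g fg /=.
  move=> cf p Up; have := cf _ Up; rewrite /prop_for /continuous_at -(fg _ Up).
  have E : {near p, f =1 g} by exact: near_open oU Up _.
  by apply: cvg_trans; exact: (near_eq_cvg E).
move=> [df Df]; split=> [p v Up|v].
  by apply: near_eq_derivable (df p v Up); exact: near_open oU Up _.
by apply: IH (Df v) => p Up; apply: near_eq_derive; exact: near_open oU Up _.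
Qed.

(** By induction the directional derivatives are continuous, so [C1_diff] makes [f] differentiable,
    hence continuous. *)
Lemma Cs_cont n U f p : open U -> Cs n U f -> U p -> {for p, continuous f}.
Proof.
move=> oU; elim: n f p => [|n IH] f p /= => [cf|[df Df]] Up; first exact: cf.
have [] := C1_diff oU Up (fun q v => df q v) (fun v q => IH _ q (Df v)).
by move=> /differentiable_continuous.
Qed.

Lemma Cs_diff n U f p : open U -> Cs n.+1 U f -> U p ->
  is_diff p f (lin2 ('D_(pt 1 0) f p) ('D_(pt 0 1) f p)).
Proof.
move=> oU [df Df] Up; apply: (C1_diff oU Up) => [q v|v q]; first exact: df.
exact: Cs_cont (Df v).
Qed.

Lemma Cs_pred n U f : open U -> Cs n.+1 U f -> Cs n U f.
Proof.
move=> oU; elim: n f => [|n IH] f Cf; first by move=> p; apply: Cs_cont Cf.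
by case: Cf => df Df; split=> // v; apply: IH.
Qed.

Lemma Cs_cst n U (c : R) : Cs n U (fun=> c).
Proof.
elim: n c => [|n IH] c /=; first by move=> p _; exact: cst_continuous.
split=> [p v _|v]; first exact: derivable_cst.
have -> : (fun p => 'D_v (fun=> c) p) = (fun=> 0); last exact: IH.
by apply/funext => p; exact: derive_cst.
Qed.

Lemma is_diff_lin2 (a b : R) p : is_diff p (lin2 a b) (lin2 a b).
Proof.
apply: DiffDef; first exact/linear_differentiable/lin2_continuous.
by rewrite diff_lin //; exact: lin2_continuous.
Qed.

Lemma Cs_lin2 n U (a b : R) : Cs n U (lin2 a b).
Proof.
case: n => [|n] /=; first by move=> p _; exact: lin2_continuous.
split=> [p v _|v].
  by apply: diff_derivable; have [] := is_diff_lin2 a b p.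
have -> : (fun p => 'D_v (lin2 a b) p) = (fun=> lin2 a b v); last exact: Cs_cst.
apply/funext => p; have [d e] := is_diff_lin2 a b p.
by rewrite deriveE // e.
Qed.

Lemma Cs_xc n U : Cs n U (@xc R).
Proof.
have -> : @xc R = lin2 1 0; last exact: Cs_lin2.
by apply/funext => p; rewrite /lin2 mulr1 mulr0 addr0.
Qed.

Lemma Cs_yc n U : Cs n U (@yc R).
Proof.
have -> : @yc R = lin2 0 1; last exact: Cs_lin2.
by apply/funext => p; rewrite /lin2 mulr1 mulr0 add0r.
Qed.

Lemma CsD n U f g : open U -> Cs n U f -> Cs n U g -> Cs n U (fun p => f p + g p).
Proof.
move=> oU; elim: n f g => [|n IH] f g.
  by move=> cf cg p Up; apply: (@continuousD _ _ _ f g _ (cf p Up) (cg p Up)).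
move=> [df Df] [dg Dg]; split=> [p v Up|v].
  by apply: (@derivableD _ _ _ f g _ _ (df p v Up) (dg p v Up)).
apply: (@Cs_ext _ _ (fun p => 'D_v f p + 'D_v g p)) => // [p Up|]; last exact: IH (Df v) (Dg v).
by rewrite -(@deriveD _ _ _ f g p v (df p v Up) (dg p v Up)).
Qed.

Lemma CsM n U f g : open U -> Cs n U f -> Cs n U g -> Cs n U (fun p => f p * g p).
Proof.
move=> oU; elim: n f g => [|n IH] f g.
  by move=> cf cg p Up; apply: (@continuousM _ _ f g _ (cf p Up) (cg p Up)).
move=> Cf Cg; case: (Cf) => df Df; case: (Cg) => dg Dg; split=> [p v Up|v].
  by apply: (@derivableM _ _ f g _ _ (df p v Up) (dg p v Up)).
apply: (@Cs_ext _ _ (fun p => f p * 'D_v g p + g p * 'D_v f p)) => // [p Up|].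
  by rewrite (@deriveM _ _ f g p v (df p v Up) (dg p v Up)).
apply: CsD => //; first exact: IH (Cs_pred oU Cf) (Dg v).
exact: IH (Cs_pred oU Cg) (Df v).
Qed.

Lemma CsN n U f : open U -> Cs n U f -> Cs n U (fun p => - f p).
Proof.
move=> oU Cf; apply: (@Cs_ext _ _ (fun p => -1 * f p)) => // [p _|].
  by rewrite mulN1r.
by apply: CsM => //; exact: Cs_cst.
Qed.

Lemma CsB n U f g : open U -> Cs n U f -> Cs n U g -> Cs n U (fun p => f p - g p).
Proof. by move=> oU Cf Cg; apply: CsD => //; exact: CsN. Qed.

Lemma CsX n U f k : open U -> Cs n U f -> Cs n U (fun p => f p ^+ k).
Proof.
move=> oU Cf; elim: k => [|k IH]; first exact: Cs_cst.
apply: (@Cs_ext _ _ (fun p => f p * f p ^+ k)) => // [p _|]; first by rewrite exprS.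
exact: CsM.
Qed.

(** The derivative of 1/f contains 1/f again, one order lower; the induction on [n] therefore keeps
    [f] fixed. The same holds for [Cs_sqrt]. *)
Lemma CsV n U f : open U -> (forall p, U p -> f p != 0) ->
  Cs n U f -> Cs n U (fun p => (f p)^-1).
Proof.
move=> oU f0; elim: n => [|n IH].
  by move=> cf p Up; apply: (@continuousV _ _ f _ (f0 p Up) (cf p Up)).
move=> Cf; case: (Cf) => df Df; split=> [p v Up|v].
  by apply: (@derivableV _ _ f _ _ (f0 p Up) (df p v Up)).
apply: (@Cs_ext _ _ (fun p => - ((f p)^-1 ^+ 2 * 'D_v f p))) => // [p Up|].
  by rewrite (@deriveV _ _ f p v (f0 p Up) (df p v Up)) -exprVn scaleNr.
apply: CsN => //; apply: CsM => //; last exact: Df.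
by apply: CsX => //; apply/IH/Cs_pred.
Qed.

Lemma Cs_sqrt n U f : open U -> (forall p, U p -> 0 < f p) ->
  Cs n U f -> Cs n U (fun p => Num.sqrt (f p)).
Proof.
move=> oU f0; elim: n => [|n IH].
  move=> cf p Up; apply: (continuous_comp (cf p Up)).
  exact: sqrt_continuous.
move=> Cf; case: (Cf) => df Df.
have D p (v : plane R) : U p -> is_derive p v (fun p => Num.sqrt (f p))
    ((2 * Num.sqrt (f p))^-1 * 'D_v f p).
  move=> Up; have [Fd Fe] := is_derive1_sqrt (f0 p Up).
  have Df1 := Cs_diff oU Cf Up; have Ef : differentiable f p by [].
  have Es : differentiable (@Num.sqrt R) (f p) by exact/derivable1_diffP.
  have Ec : differentiable (@Num.sqrt R \o f) p by exact: differentiable_comp.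
  split; first exact: diff_derivable.
  have dl (y : R) : 'd (@Num.sqrt R) (f p) y = (2 * Num.sqrt (f p))^-1 * y.
    by rewrite deriv1E //= derive1E Fe [LHS]mulrC.
  rewrite (@deriveE _ _ _ (@Num.sqrt R \o f) _ v Ec) diff_comp //= dl.
  by rewrite (@deriveE _ _ _ _ _ v Ef).
split=> [p v Up|v]; first by have [] := D p v Up.
apply: (@Cs_ext _ _ (fun p => (2 * Num.sqrt (f p))^-1 * 'D_v f p)) => // [p Up|].
  by have [_ ->] := D p v Up.
apply: CsM => //; last exact: Df.
apply: CsV => // [p Up|].
  by rewrite mulf_neq0 ?pnatr_eq0 // gt_eqF // sqrtr_gt0 f0.
by apply: CsM; [|exact: Cs_cst|exact/IH/Cs_pred].
Qed.

(** By the chain rule a derivative of the composite is a sum of products whose factors are partial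
    derivatives of [f] composed with the same inner map, and derivatives of [g1] and [g2]. *)
Lemma Cs_comp n U V f g1 g2 : open U -> open V ->
  (forall p, U p -> V (pt (g1 p) (g2 p))) ->
  Cs n V f -> Cs n U g1 -> Cs n U g2 -> Cs n U (fun p => f (pt (g1 p) (g2 p))).
Proof.
move=> oU oV UV; elim: n f g1 g2 UV => [|n IH] f g1 g2 UV.
  move=> cf c1 c2 p Up.
  apply: (continuous_comp (f := fun p => pt (g1 p) (g2 p))); last exact/cf/UV.
  apply: plane_cont.
    have -> : (fun z => xc (pt (g1 z) (g2 z))) = g1; last exact: c1.
    by apply/funext => z; rewrite xc_pt.
  have -> : (fun z => yc (pt (g1 z) (g2 z))) = g2; last exact: c2.
  by apply/funext => z; rewrite yc_pt.
move=> Cf C1 C2.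
pose g p := pt (g1 p) (g2 p).
have D p (v : plane R) : U p -> is_derive p v (f \o g)
    ('D_(pt 1 0) f (g p) * 'D_v g1 p + 'D_(pt 0 1) f (g p) * 'D_v g2 p).
  move=> Up; have D1 := Cs_diff oU C1 Up; have D2 := Cs_diff oU C2 Up.
  have Df := Cs_diff oV Cf (UV p Up).
  have Dg := is_diff_pt D1 D2.
  have := is_diff_comp Dg Df; rewrite -/g => Dfg.
  have [Efg efg] := Dfg.
  split; first exact: diff_derivable.
  rewrite deriveE // efg /= {1}/lin2 !coordE mulrC [_ * _ in X in _ + X]mulrC.
  have E1 : differentiable g1 p by [].
  have E2 : differentiable g2 p by [].
  by rewrite !(@deriveE _ _ _ _ _ v) // !diff_val.
split=> [p v Up|v]; first by have [] := D p v Up.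
apply: (@Cs_ext _ _ (fun p => 'D_(pt 1 0) f (g p) * 'D_v g1 p +
    'D_(pt 0 1) f (g p) * 'D_v g2 p)) => // [p Up|].
  by have [_ ->] := D p v Up.
have [_ Df] := Cf; have [_ D1] := C1; have [_ D2] := C2.
apply: CsD => //; apply: CsM => //.
- exact: (IH ('D_(pt 1 0) f) g1 g2 UV (Df _) (Cs_pred oU C1) (Cs_pred oU C2)).
- exact: (D1 v).
- exact: (IH ('D_(pt 0 1) f) g1 g2 UV (Df _) (Cs_pred oU C1) (Cs_pred oU C2)).
- exact: (D2 v).
Qed.

Lemma Cn_coord n U (f : plane R -> plane R) : open U ->
  Cn_on n U f <-> Cs n U (fun p => xc (f p)) /\ Cs n U (fun p => yc (f p)).
Proof.
move=> oU; elim: n f => [|n IH] f /=.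
  split=> [cf|[cx cy] p Up].
    by split=> p /cf /cont_coordP[].
  by apply/cont_coordP; split; [exact: cx|exact: cy].
have dE : (forall p v, U p -> derivable f p v) -> forall v i p, U p ->
    'D_v f p 0 i = 'D_v (fun p => f p 0 i) p.
  by move=> df v i p Up; rewrite derive_mx ?mxE //; exact: df.
split=> [[df Df]|[[dx Dx] [dy Dy]]].
  have dc i p v : U p -> derivable (fun p => f p 0 i) p v.
    by move=> Up; move/derivable_mxP: (df p v Up).
  split; split=> [p v|v]; try exact: dc.
    apply: (@Cs_ext _ _ (fun p => xc ('D_v f p))) => //.
      by move=> p Up; exact: dE.
    by have [] := (IH _).1 (Df v).
  apply: (@Cs_ext _ _ (fun p => yc ('D_v f p))) => //.
    by move=> p Up; exact: dE.
  by have [] := (IH _).1 (Df v).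
have df p v : U p -> derivable f p v.
  move=> Up; apply/derivable_mxP => i; rewrite ord1.
  by elim/ord2_ind; [exact: dx|exact: dy].
split=> // v; apply/IH; split.
  apply: (Cs_ext oU _ (Dx v)) => p Up.
  by rewrite [RHS](dE df).
apply: (Cs_ext oU _ (Dy v)) => p Up.
by rewrite [RHS](dE df).
Qed.

End ScalarSmoothness.

(** * Diffeomorphisms and cusps *)

Section Diffeomorphisms.
Context {R : realType}.
Implicit Types (p q v : plane R) (U V C M : set (plane R)).
Implicit Types (psi chi : plane R -> plane R).

Lemma Cs_sub n U V (f : plane R -> R) : U `<=` V -> Cs n V f -> Cs n U f.
Proof.
move=> UV; elim: n f => [|n IH] f; first by move=> cf p /UV; exact: cf.
by move=> [df Df]; split=> [p v /UV|v]; [exact: df|exact: IH (Df v)].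
Qed.

Lemma smooth_coord U (f : plane R -> plane R) : open U ->
  smooth_on U f <->
  (forall n, Cs n U (fun p => xc (f p)) /\ Cs n U (fun p => yc (f p))).
Proof. by move=> oU; split=> sf n; apply/(Cn_coord n f oU). Qed.

Lemma smooth_pt U (g1 g2 : plane R -> R) : open U ->
  (forall n, Cs n U g1) -> (forall n, Cs n U g2) ->
  smooth_on U (fun p => pt (g1 p) (g2 p)).
Proof.
move=> oU C1 C2; apply/smooth_coord => // n; split.
  by apply: (Cs_ext oU _ (C1 n)) => p _; rewrite xc_pt.
by apply: (Cs_ext oU _ (C2 n)) => p _; rewrite yc_pt.
Qed.

Lemma smooth_sub U V f : open U -> open V -> U `<=` V ->
  @smooth_on R V f -> smooth_on U f.
Proof.
move=> oU oV UV /(smooth_coord _ oV) sf; apply/smooth_coord => // n.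
by have [] := sf n; split; apply: Cs_sub UV _.
Qed.

Lemma smooth_comp U V (f g : plane R -> plane R) : open U -> open V ->
  (forall p, U p -> V (g p)) -> smooth_on V f -> smooth_on U g ->
  smooth_on U (f \o g).
Proof.
move=> oU oV UV /(smooth_coord _ oV) sf /(smooth_coord _ oU) sg.
apply/smooth_coord => // n; have [fx fy] := sf n; have [gx gy] := sg n.
have gE p : pt (xc (g p)) (yc (g p)) = g p by exact: pt_eta.
have UV' p : U p -> V (pt (xc (g p)) (yc (g p))) by rewrite gE; exact: UV.
split.
  by apply: (Cs_ext oU _ (Cs_comp oU oV UV' fx gx gy)) => p _ /=; rewrite gE.
by apply: (Cs_ext oU _ (Cs_comp oU oV UV' fy gx gy)) => p _ /=; rewrite gE.
Qed.

Lemma smooth_cont U f p : open U -> @smooth_on R U f -> U p ->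
  {for p, continuous f}.
Proof.
move=> oU sf Up; have [fx fy] := (smooth_coord _ oU).1 sf 0.
by apply/cont_coordP; split; [exact: fx|exact: fy].
Qed.

Lemma smooth_diff U f p : open U -> @smooth_on R U f -> U p ->
  differentiable f p.
Proof.
move=> oU sf Up; have [fx fy] := (smooth_coord _ oU).1 sf 1.
have := is_diff_pt (Cs_diff oU fx Up) (Cs_diff oU fy Up).
rewrite (_ : (fun q => pt _ _) = f); first by case.
by apply/funext => q; rewrite pt_eta.
Qed.

Lemma open_preim U (f : plane R -> plane R) A : open U -> open A ->
  (forall p, U p -> {for p, continuous f}) -> open (U `&` f @^-1` A).
Proof.
move=> oU oA cf; rewrite openE => p [Up Ap].
by apply: filterI; [exact: open_nbhs_nbhs|apply: (cf p Up); exact: open_nbhs_nbhs].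
Qed.

Lemma diffeo_sym U V psi chi : diffeo U V psi chi -> diffeo V U chi psi.
Proof. by case=> oU oV sp sc [h1 h2]; split. Qed.

Lemma locally_likeP M C p : locally_like M C p <->
  exists U V psi chi, [/\ diffeo U V psi chi, U p, psi p = pt 0 0 &
    forall q, U q -> (C q <-> M (psi q))].
Proof.
split=> -[U [V [psi [chi [D Up p0 E]]]]]; exists U, V, psi, chi; split=> //.
  case: D => _ _ _ _ [UV VU] q Uq; split=> [Cq|Mq].
    have : (psi @` (C `&` U)) (psi q) by exists q.
    by rewrite E => -[].
  have : (M `&` V) (psi q) by split=> //; have [] := UV q Uq.
  rewrite -E => -[q' [Cq' Uq'] e].
  by have [_ <-] := UV q Uq; rewrite -e; have [_ ->] := UV q' Uq'.
case: D => _ _ _ _ [UV VU].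
apply/seteqP; split=> [_ [q [Cq Uq] <-]|r [Mr Vr]].
  by split; [exact/E|have [] := UV q Uq].
have [Ur er] := VU r Vr; exists (chi r) => //; split=> //.
by apply/E => //; rewrite er.
Qed.

Lemma locally_like_diffeo M C C' U V psi chi p : diffeo U V psi chi -> U p ->
  (forall q, U q -> (C q <-> C' (psi q))) ->
  locally_like M C' (psi p) -> locally_like M C p.
Proof.
move=> [oU oV sp sc [UV VU]] Up CC' /locally_likeP.
move=> [U1 [V1 [psi1 [chi1 [[oU1 oV1 sp1 sc1 [UV1 VU1]] Up1 p0 E]]]]].
apply/locally_likeP.
have oU2 : open (U `&` psi @^-1` U1).
  by exact: open_preim oU oU1 (fun q Uq => smooth_cont oU sp Uq).
have oV2 : open (V1 `&` chi1 @^-1` V).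
  by exact: open_preim oV1 oV (fun q Uq => smooth_cont oV1 sc1 Uq).
(* Both domains are shrunk to the points where the composites are defined and inverse to each
   other. *)
exists (U `&` psi @^-1` U1), (V1 `&` chi1 @^-1` V), (psi1 \o psi), (chi \o chi1).
split=> //.
- split=> //.
  + apply: (smooth_comp oU2 oU1) => //; first by move=> q [].
    by apply: smooth_sub sp => // q [].
  + apply: (smooth_comp oV2 oV) => //; first by move=> q [].
    by apply: smooth_sub sc1 => // q [].
  + split=> q /= [].
      move=> Uq U1q; have [V1q e1] := UV1 _ U1q; have [Vq e] := UV _ Uq.
      by rewrite e1 e.
    move=> V1q Vq; have [U1q e1] := VU1 _ V1q; have [Uq e] := VU _ Vq.
    by rewrite e e1.
- by move=> q [Uq U1q] /=; rewrite (CC' q Uq); exact: E.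
Qed.

Lemma locally_like_diffeoE M C C' U V psi chi p : diffeo U V psi chi -> U p ->
  (forall q, U q -> (C q <-> C' (psi q))) ->
  locally_like M C p <-> locally_like M C' (psi p).
Proof.
move=> D Up CC'; split; last exact: locally_like_diffeo D Up CC'.
have D' := diffeo_sym D; case: (D) => _ _ _ _ [UV VU].
have [Vp e] := UV p Up; rewrite -{1}e.
apply: (locally_like_diffeo D' Vp) => q Vq.
by have [Uq eq] := VU q Vq; rewrite CC' // eq.
Qed.

Definition cuspidal : set (plane R) := [set pt (t ^+ 2) (t ^+ 3) | t in [set: R]].
Definition xaxis : set (plane R) := [set pt t 0 | t in [set: R]].

Lemma xaxisE q : xaxis q <-> yc q = 0.
Proof.
split=> [[t _ <-]|q0]; first by rewrite yc_pt.
by exists (xc q) => //; rewrite -[RHS]pt_eta q0.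
Qed.

Lemma cuspidalE q : cuspidal q <-> yc q ^+ 2 = xc q ^+ 3.
Proof.
split=> [[t _ <-]|]; first by rewrite !coordE; ring.
rewrite -{3}(pt_eta q); move: (xc q) (yc q) => x y e.
have [x0|x0] := eqVneq x 0.
  exists 0 => //; rewrite x0 !expr0n /=; congr pt.
  by apply/esym/eqP; rewrite -sqrf_eq0 e x0 expr0n.
(* Away from the origin the parameter of the point is the slope y / x. *)
exists (y / x) => //; congr pt.
  by rewrite expr_div_n e exprS mulfK // sqrf_eq0.
by rewrite exprS expr_div_n e; field.
Qed.

Lemma cuspidal_cusp : cusp_point cuspidal (pt 0 0).
Proof.
apply/locally_likeP; exists setT, setT, id, id; split=> //.
have sid : smooth_on (R := R) setT id.
  apply/smooth_coord; first exact: openT.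
  by move=> n; split; [exact: Cs_xc|exact: Cs_yc].
by split=> //; exact: openT.
Qed.

End Diffeomorphisms.

(* Reduces the smoothness of an algebraic expression in the coordinates to the
   side conditions on its denominators and radicands. *)
Ltac smooth_tac :=
  repeat first [exact: Cs_cst | exact: Cs_xc | exact: Cs_yc
    | apply: CsN; first by [] | apply: CsX; first by []
    | apply: CsB; [by [] | | ] | apply: CsM; [by [] | | ]
    | apply: CsD; [by [] | | ]
    | apply: CsV; [by [] | | ] | apply: Cs_sqrt; [by [] | | ]].

(** * The cuspidal cubic away from its cusp *)

Section CuspidalCubic.
Context {R : realType}.
Implicit Types (p q v : plane R) (U V C M : set (plane R)).
Implicit Types (psi chi : plane R -> plane R).

Lemma open_scalar (f : plane R -> R) (A : set R) : continuous f -> open A ->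
  open (f @^-1` A).
Proof. by move=> cf oA; apply: open_comp => // p _; exact: cf. Qed.

Lemma Cs_continuous (f : plane R -> R) : Cs 0 setT f -> continuous f.
Proof. by move=> cf p; exact: cf. Qed.

(* Away from the cusp, y / x parametrizes the cuspidal cubic. *)
Lemma cuspidal_smooth p : cuspidal p -> p <> pt 0 0 -> smooth_point cuspidal p.
Proof.
move=> [a _ <-{p}] a0'.
have a0 : a != 0 by apply/eqP => e; apply: a0'; rewrite e !expr0n.
apply/(locally_likeP xaxis).
pose U : set (plane R) := [set q | xc q != 0].
pose V : set (plane R) := [set q | yc q + (xc q + a) ^+ 2 != 0].
have oU : open U.
  by apply: (open_scalar (A := [set t | t != 0])); [exact: xc_cont|exact: open_neq].
have oT : open [set: plane R] by exact: openT.
have oV : open V.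
  apply: (open_scalar (f := fun q => yc q + (xc q + a) ^+ 2)
    (A := [set t | t != 0])); last exact: open_neq.
  by apply: Cs_continuous; smooth_tac.
(* With slope m = y / x the new coordinates are m - a and x - m^2; the second vanishes exactly on
   the curve. [V] is the condition x <> 0 in these coordinates. *)
pose psi q : plane R := pt (yc q / xc q - a) (xc q - (yc q / xc q) ^+ 2).
pose chi q : plane R := pt (yc q + (xc q + a) ^+ 2)
  ((xc q + a) * (yc q + (xc q + a) ^+ 2)).
exists U, V, psi, chi; split.
- split=> //.
  + by apply: smooth_pt => // n; smooth_tac.
  + by apply: smooth_pt => // n; smooth_tac.
  + split=> q; rewrite /U /V /psi /chi /= => q0; rewrite !coordE.
      rewrite subrK subrK; split=> //; apply: plane_eq; rewrite !coordE //.
      by rewrite divfK.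
    split=> //; apply: plane_eq; rewrite !coordE mulfK //; ring.
- by rewrite /U /= xc_pt sqrf_eq0.
- rewrite /psi !coordE; congr pt; field => //.
- move=> q; rewrite /U /= => q0; rewrite cuspidalE xaxisE /psi yc_pt.
  have -> : xc q - (yc q / xc q) ^+ 2 = (xc q ^+ 3 - yc q ^+ 2) / xc q ^+ 2.
    by field.
  split=> [->|/eqP]; first by rewrite subrr mul0r.
  by rewrite mulf_eq0 invr_eq0 sqrf_eq0 (negbTE q0) orbF subr_eq0 => /eqP.
Qed.

End CuspidalCubic.

(** * A cusp is not a smooth point *)

Section CuspIsSingular.
Context {R : realType}.
Implicit Types (p q : plane R) (C : set (plane R)).

Lemma derive_quotient_cvg (x : R -> R) : derivable x 0 1 -> x 0 = 0 ->
  (fun t => t^-1 * x t) @ 0^' --> 'D_1 x 0.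
Proof.
move=> dx x0; have := @derivableP _ _ _ _ _ _ dx => -[cx _].
move: cx => /cvg_ex[l cl]; have -> : 'D_1 x 0 = l by apply/cvg_lim.
apply: cvg_trans cl; apply: near_eq_cvg; near=> t.
by rewrite /= x0 subr0 addr0 [t%:A]mulr1.
Unshelve. all: by end_near. Qed.

(* The arc lies in the half-plane x >= 0, so its speed at the cusp has no
   x-component; dividing y^2 = x^3 by t^2 kills the y-component. *)
Lemma cuspidal_arc_speed (x y : R -> R) : derivable x 0 1 -> derivable y 0 1 ->
  x 0 = 0 -> y 0 = 0 -> (\forall t \near 0, y t ^+ 2 = x t ^+ 3) ->
  'D_1 x 0 = 0 /\ 'D_1 y 0 = 0.
Proof.
move=> dx dy x0 y0 xy.
have cx := derive_quotient_cvg dx x0; have cy := derive_quotient_cvg dy y0.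
set a := 'D_1 x 0 in cx *; set b := 'D_1 y 0 in cy *.
split.
  apply/eqP/negPn/negP => a0.
  have a0' : 0 < `|a| by rewrite normr_gt0.
  have /cvgrPdist_lt /(_ _ a0') := cx.
  rewrite near_withinE => na.
  have : \forall t \near (0 : R), (t != 0 -> `|a - t^-1 * x t| < `|a|) /\
      y t ^+ 2 = x t ^+ 3 by near=> t; split; near: t.
  move=> /nbhs_ballP [e e0] he.
  (* [t] has the sign opposite to [a] while [x t] is nonnegative: the quotient x t / t is then zero
     or of sign opposite to [a], hence at distance at least [|a|] from its limit. *)
  pose t := - (e / 2) * Num.sg a.
  have nt : `|t| = e / 2.
    by rewrite normrM normrN normr_sg a0 mulr1 gtr0_norm // divr_gt0.
  have t0 : t != 0 by rewrite -normr_gt0 nt divr_gt0.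
  have [|h1 h2] := he t.
    by rewrite -ball_normE /= sub0r normrN nt ltr_pdivrMr // ltr_pMr // ltr1n.
  have {}h1 := h1 t0.
  have xt : 0 <= x t.
    rewrite leNgt; apply/negP => xt0; have : x t ^+ 3 < 0.
      by rewrite exprSr nmulr_llt0 // exprn_even_gt0 //= lt_eqF.
    by rewrite -h2 ltNge sqr_ge0.
  have ta : t * a < 0.
    rewrite /t -mulrA -normrEsg mulNr oppr_lt0 mulr_gt0 // divr_gt0 //.
  have : t^-1 * x t * a <= 0.
    rewrite -mulrA mulrCA mulr_ge0_le0 // -(@pmulr_rle0 _ (t ^+ 2)) ?exprn_even_gt0 //.
    have -> : t ^+ 2 * (t^-1 * a) = t * a by field.
    exact: ltW.
  move: h1; set r := t^-1 * x t => h1 ra.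
  have : a ^+ 2 <= `|a - r| * `|a|.
    rewrite -normrM; apply: le_trans (ler_norm _); nra.
  rewrite -real_normK ?num_real // expr2 leNgt ltr_pM2r //.
  by rewrite h1.
pose r t := t^-1 * x t.
have ct : id @ 0^' --> (0 : R) by move=> A; exact: nbhs_dnbhs.
have c2 : (fun t => (t^-1 * y t) * (t^-1 * y t)) @ 0^' --> b * b by exact: cvgM.
have c3 : (fun t => r t * (r t * r t) * t) @ 0^' --> a * (a * a) * 0.
  exact: cvgM (cvgM cx (cvgM cx cx)) ct.
have e : (fun t => r t * (r t * r t) * t) @ 0^' --> b * b.
  apply: cvg_trans c2; apply: near_eq_cvg; near=> t.
  have t0 : t != 0 by near: t; exact: nbhs_dnbhs_neq.
  have h : y t ^+ 2 = x t ^+ 3 by near: t; apply: nbhs_dnbhs.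
  have -> : t^-1 * y t * (t^-1 * y t) = t^-1 ^+ 2 * y t ^+ 2 by ring.
  by rewrite h /r; field.
apply/eqP; rewrite -sqrf_eq0; apply/eqP.
by rewrite expr2 -(mulr0 (a * (a * a))); exact: cvg_unique e c3.
Unshelve. all: by end_near. Qed.

(** The axis of the smooth chart, read in the cusp chart, is an arc [g] inside the cuspidal cubic
    and so has zero speed. Going back by the differentiable map [k] would give zero speed to t |->
    (t, 0). *)
Lemma smooth_not_cusp C p : smooth_point C p -> ~ cusp_point C p.
Proof.
move=> /(locally_likeP xaxis) [U1 [V1 [psi1 [chi1 [D1 Up1 p1 E1]]]]].
move=> /(locally_likeP cuspidal) [U2 [V2 [psi2 [chi2 [D2 Up2 p2 E2]]]]].
have [oU1 oV1 s1 t1 [UV1 VU1]] := D1; have [oU2 oV2 s2 t2 [UV2 VU2]] := D2.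
have [V1p e1] := UV1 p Up1; have [V2p e2] := UV2 p Up2.
pose l (t : R) : plane R := pt t 0.
pose g := psi2 \o chi1 \o l.
have l0 : l 0 = psi1 p by rewrite p1.
have dl (t : R) : is_diff t l (fun h => pt h 0).
  exact: is_diff_pt (is_diff_id _) (is_diff_cst _ _).
have dl0 : differentiable l 0 by [].
have dc1 : differentiable chi1 (l 0).
  by rewrite l0; exact: smooth_diff t1 V1p.
have dp2 : differentiable psi2 (chi1 (l 0)).
  by rewrite l0 e1; exact: smooth_diff s2 Up2.
have dg : differentiable g 0.
  by apply: differentiable_comp => //; exact: differentiable_comp.
have g0 : g 0 = pt 0 0 by rewrite /g /= l0 e1.
have nV1 : \forall t \near 0, V1 (l t).
  have := differentiable_continuous dl0; apply.
  by apply: open_nbhs_nbhs; split=> //; rewrite l0.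
have nU2 : \forall t \near 0, U2 (chi1 (l t)).
  have cc : {for 0, continuous (chi1 \o l)}.
    by apply: differentiable_continuous; exact: differentiable_comp.
  by apply: cc; apply: open_nbhs_nbhs; split=> //=; rewrite l0 e1.
have gK : \forall t \near 0, yc (g t) ^+ 2 = xc (g t) ^+ 3.
  near=> t; apply/cuspidalE; apply/(E2 (chi1 (l t))); first by near: t.
  have [|U1c e] := VU1 (l t); first by near: t.
  by apply/E1 => //; rewrite e; exists t.
have /derivable_mxP dgm : derivable g 0 1 by exact: diff_derivable.
have [||gx gy] := cuspidal_arc_speed (dgm 0 0) (dgm 0 1) _ _ gK.
- by rewrite -[LHS]/(xc (g 0)) g0 xc_pt.
- by rewrite -[LHS]/(yc (g 0)) g0 yc_pt.
have Dg : 'D_1 g 0 = 0.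
  rewrite derive_mx; last exact: diff_derivable.
  by apply: plane_eq; rewrite /xc /yc !mxE.
pose k := psi1 \o chi2.
have dk : differentiable k (g 0).
  rewrite g0 -p2; apply: differentiable_comp; first exact: smooth_diff t2 V2p.
  by rewrite e2; exact: smooth_diff s1 Up1.
have kg : \forall t \near 0, (k \o g) t = l t.
  near=> t; rewrite /k /g /=.
  have [|_ ->] := UV2 (chi1 (l t)); first by near: t.
  by have [|_ ->] := VU1 (l t); first by near: t.
have : 'D_1 (k \o g) 0 = 'D_1 l 0 by exact: near_eq_derive kg.
have dkg : differentiable (k \o g) 0 by exact: differentiable_comp.
have Ekg v := deriveE v dkg; have El v := deriveE v dl0; have Eg v := deriveE v dg.
have Dk : 'd (k \o g) 0 1 = 'd k (g 0) ('d g 0 1).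
  exact: (congr1 (@^~ 1) (diff_comp dg dk)).
have Dg0 : 'd g 0 1 = 0 by exact: (etrans (esym (Eg 1)) Dg).
have Dl : 'd l 0 1 = pt 1 0 by exact: (congr1 (@^~ 1) (@diff_val _ _ _ _ _ _ _ (dl 0))).
have Dk0 : 'd k (g 0) 0 = 0 by exact: raddf0.
move/(etrans (esym (Ekg 1)))/(etrans (esym Dk)); rewrite Dg0 Dk0.
move/(fun e => etrans e (etrans (El 1) Dl))/(congr1 (@xc R)).
rewrite !coordE => /eqP.
by rewrite eq_sym oner_eq0.
Unshelve. all: by end_near. Qed.

End CuspIsSingular.

(** * Affine maps *)

Section AffineMaps.
Context {R : realType}.
Implicit Types (p q v : plane R) (C B P : set (plane R)) (h k f g : plane R -> plane R).

Lemma det_mx2 (A : 'M[R]_2) : \det A = A 0 0 * A 1 1 - A 0 1 * A 1 0.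
Proof.
rewrite (expand_det_row _ 0) !big_ord_recl big_ord0 /cofactor !det_mx11 !mxE /=.
have -> : lift 0 0 = 1 :> 'I_2 by exact: val_inj.
have -> : lift 1 0 = 0 :> 'I_2 by exact: val_inj.
by rewrite /bump /= !addr0 expr0 expr1 mul1r mulN1r mulrN.
Qed.

Lemma affine_comp h k : affine_iso h -> affine_iso k -> affine_iso (h \o k).
Proof.
move=> [A [a [uA hE]]] [B [b [uB kE]]].
exists (B *m A), (b *m A + a); split; first by rewrite unitmx_mul uB.
by move=> p /=; rewrite hE kE mulmxDl mulmxA addrA.
Qed.

Lemma affine_id : affine_iso (@id (plane R)).
Proof. by exists 1%:M, 0; split=> [|p]; rewrite ?unitmx1 // mulmx1 addr0. Qed.

Lemma affine_inv h : affine_iso h ->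
  exists h', [/\ affine_iso h', cancel h h' & cancel h' h].
Proof.
move=> [A [a [uA hE]]].
exists (fun p => p *m invmx A + - (a *m invmx A)); split=> [|p|p].
- by exists (invmx A), (- (a *m invmx A)); rewrite unitmx_inv.
- by rewrite hE mulmxDl mulmxK // addrK.
- by rewrite hE mulmxDl mulNmx !mulmxKV // subrK.
Qed.

Lemma affine_inj h : affine_iso h -> injective h.
Proof. by move=> /affine_inv[h' [_ hK _]]; exact: can_inj hK. Qed.

Lemma mulmx_rV2 v (A : 'M[R]_2) : v *m A =
  pt (xc v * A 0 0 + yc v * A 1 0) (xc v * A 0 1 + yc v * A 1 1).
Proof.
apply: plane_eq; rewrite !coordE /xc /yc !mxE !big_ord_recl big_ord0 addr0;
  by rewrite (_ : lift 0 0 = 1) //; exact: val_inj.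
Qed.

Lemma affine_coord h : affine_iso h -> exists a b c d e e' : R,
  a * d - b * c != 0 /\
  forall p, h p = pt (a * xc p + b * yc p + e) (c * xc p + d * yc p + e').
Proof.
move=> [A [t [uA hE]]].
exists (A 0 0), (A 1 0), (A 0 1), (A 1 1), (xc t), (yc t); split.
  by move: uA; rewrite unitmxE unitfE det_mx2 [A 1 0 * _]mulrC.
by move=> p; rewrite hE mulmx_rV2; apply: plane_eq; rewrite !coordE; ring.
Qed.

Lemma affine_intro (a b c d e e' : R) : a * d - b * c != 0 ->
  affine_iso (fun p => pt (a * xc p + b * yc p + e) (c * xc p + d * yc p + e')).
Proof.
move=> D.
(* Points are row vectors multiplied on the right, so the rows are (a, c) and (b, d). *)
exists (\matrix_(i < 2, j < 2)
  if i == 0 then if j == 0 then a else c else if j == 0 then b else d), (pt e e').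
split; first by rewrite unitmxE unitfE det_mx2 !mxE /= [c * b]mulrC.
by move=> p; rewrite mulmx_rV2 !mxE /=; apply: plane_eq; rewrite !coordE; ring.
Qed.

Lemma affine_smooth h : affine_iso h -> smooth_on setT h.
Proof.
move=> /affine_coord[a [b [c [d [e [e' [_ hE]]]]]]].
have oT : open [set: plane R] by exact: openT.
rewrite (funext hE); apply: smooth_pt => // n; smooth_tac.
Qed.

Lemma affine_diffeo h h' : affine_iso h -> affine_iso h' -> cancel h h' ->
  cancel h' h -> diffeo setT setT h h'.
Proof.
move=> ah ah' hK h'K; split; try exact: openT; try exact: affine_smooth.
by split=> p _; rewrite ?hK ?h'K.
Qed.

Lemma affine_differentiable h p : affine_iso h -> differentiable h p.
Proof. by move=> ah; apply: smooth_diff (affine_smooth ah) _ => //; exact: openT. Qed.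

Lemma affine_continuous h : affine_iso h -> continuous h.
Proof.
by move=> ah p; apply: differentiable_continuous; exact: affine_differentiable.
Qed.

Lemma derive_affine h (A : 'M[R]_2) b p v : (forall p, h p = p *m A + b) ->
  'D_v h p = v *m A.
Proof.
move=> hE; rewrite /derive.
apply: cvg_lim => //.
have E : (fun _ => v *m A) @ (0 : R)^' --> v *m A by exact: cvg_cst.
apply: cvg_trans E; apply: near_eq_cvg; near=> t.
have t0 : t != 0 by near: t; exact: nbhs_dnbhs_neq.
rewrite /= !hE mulmxDl -scalemxAl -[_ + _ + b]addrA addrK scalerA.
by rewrite mulVf // scale1r.
Unshelve. all: by end_near. Qed.

Lemma mx_rV_ext (A B : 'M[R]_2) : (forall v : plane R, v *m A = v *m B) -> A = B.
Proof. by move=> AB; apply/row_matrixP => i; rewrite !rowE. Qed.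

Lemma jacobian_affine h (A : 'M[R]_2) b p : (forall p, h p = p *m A + b) ->
  A \in unitmx -> 'J h p = A.
Proof.
move=> hE uA; apply: mx_rV_ext => v; rewrite -deriveEjacobian.
  exact: derive_affine.
by apply: affine_differentiable; exists A, b.
Qed.

Lemma jacobian_comp f g p : differentiable f p -> differentiable g (f p) ->
  'J (g \o f) p = 'J f p *m 'J g (f p).
Proof.
move=> df dg; apply: mx_rV_ext => v.
have dgf : differentiable (g \o f) p by exact: differentiable_comp.
rewrite -(deriveEjacobian v dgf) mulmxA -(deriveEjacobian v df).
rewrite (deriveE v dgf) (deriveE v df) -(deriveEjacobian _ dg) (deriveE _ dg).
exact: (congr1 (@^~ v) (diff_comp df dg)).
Qed.

(** Determinants in the chain rule for both sides of [k \o f = g \o h]; the constant is det k / det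
    h for the linear parts. *)
Lemma detD_conj f g h k : (forall p, differentiable f p) ->
  (forall p, differentiable g p) -> affine_iso h -> affine_iso k ->
  k \o f = g \o h ->
  exists2 c : R, c != 0 & forall p, detD g (h p) = c * detD f p.
Proof.
move=> df dg ah ak E; have [A [a [uA hE]]] := ah; have [B [b [uB kE]]] := ak.
have dA : \det A != 0 by rewrite -unitfE -unitmxE.
exists (\det B / \det A); first by rewrite mulf_neq0 // ?invr_eq0 // -unitfE -unitmxE.
move=> p; have e : \det ('J (k \o f) p) = \det ('J (g \o h) p) by rewrite E.
move: e; rewrite (jacobian_comp (df p) (affine_differentiable (f p) ak)).
rewrite (jacobian_comp (affine_differentiable p ah) (dg (h p))).
rewrite (jacobian_affine (f p) kE uB) (jacobian_affine p hE uA).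
rewrite (det_mulmx ('J f p)) (det_mulmx A) => e.
rewrite mulrAC [_ * detD f p]mulrC.
have -> : detD f p * \det B = \det A * detD g (h p) by exact: e.
by rewrite mulrAC mulfV // mul1r.
Qed.

End AffineMaps.

Lemma injective_image T (h : T -> T) : injective h ->
  injective (fun A : set T => h @` A).
Proof.
move=> hi A B AB; apply/seteqP; split=> x Ax.
  by have [y By /hi <-] : (h @` B) (h x) by rewrite -AB; exists x.
by have [y By /hi <-] : (h @` A) (h x) by rewrite AB; exists x.
Qed.

Section AffineImages.
Context {R : realType}.
Variable h : plane R -> plane R.
Hypothesis ah : affine_iso h.
Implicit Types (p q v : plane R) (C B P : set (plane R)).

Lemma image_point C : is_point C -> is_point (h @` C).
Proof. by move=> [p ->]; exists (h p); rewrite image_set1. Qed.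

Lemma affine_line_image p v : v != 0 -> exists2 w, w != 0 &
  forall t : R, h (p + t *: v) = h p + t *: w.
Proof.
have [A [a [uA hE]]] := ah; move=> v0; exists (v *m A).
  apply: contraNneq v0 => e; rewrite -(mulmxK uA v) e mul0mx //.
by move=> t; rewrite !hE mulmxDl -scalemxAl addrAC.
Qed.

Lemma image_line C : is_line C -> is_line (h @` C).
Proof.
move=> [p [v [v0 ->]]]; have [w w0 hw] := affine_line_image p v0.
exists (h p), w; split=> //; rewrite image_comp.
by apply: eq_imagel => t _; exact: hw.
Qed.

Lemma image_ray p C : is_ray p C -> is_ray (h p) (h @` C).
Proof.
move=> [v [v0 ->]]; have [w w0 hw] := affine_line_image p v0.
exists w; split=> //; rewrite image_comp.
by apply: eq_imagel => t _; exact: hw.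
Qed.

Lemma image_ellipse C : is_ellipse C -> is_ellipse (h @` C).
Proof. by move=> [k ak ->]; exists (h \o k); [exact: affine_comp|rewrite image_comp]. Qed.

Lemma image_hyperbola B B' C : is_hyperbola B B' C ->
  is_hyperbola (h @` B) (h @` B') (h @` C).
Proof.
move=> [k [ak -> -> ->]]; exists (h \o k); split; first exact: affine_comp.
- by rewrite image_comp.
- by rewrite image_comp.
- by rewrite image_setU.
Qed.

Lemma image_parabola_at v C : is_parabola_at v C -> is_parabola_at (h v) (h @` C).
Proof.
move=> [k [ak kv ->]]; exists (h \o k); split; first exact: affine_comp.
- by rewrite /= kv.
- by rewrite image_comp.
Qed.

Lemma image_parabola C : is_parabola C -> is_parabola (h @` C).
Proof. by move=> [v] /image_parabola_at; exists (h v). Qed.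

Lemma image_curve C : is_curve C -> is_curve (h @` C).
Proof.
move=> [c cc ->]; exists (h \o c); last by rewrite image_comp.
by move=> t; apply: continuous_comp; [exact: cc|exact: affine_continuous].
Qed.

Lemma image_closed_curve C : is_closed_curve C -> is_closed_curve (h @` C).
Proof.
move=> [c cc ->]; exists (h \o c); last by rewrite image_comp.
by move=> t; apply: (continuous_comp (cc t)); exact: affine_continuous.
Qed.

Lemma image_intersecting C : intersecting_lines C -> intersecting_lines (h @` C).
Proof.
have hi := affine_inj ah.
move=> [L [L' [l l' LL' [p [Lp L'p]] ->]]]; exists (h @` L), (h @` L'); split.
- exact: image_line.
- exact: image_line.
- by move/(injective_image hi).
- by exists (h p); split; exists p.
- by rewrite image_setU.
Qed.

Lemma image_locally_like M C p : locally_like M (h @` C) (h p) <-> locally_like M C p.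
Proof.
have [h' [ah' hK h'K]] := affine_inv ah; apply: iff_sym.
apply: (locally_like_diffeoE M (affine_diffeo ah ah' hK h'K)) => // q _.
split=> [Cq|[q' Cq' /(affine_inj ah) <-] //].
by exists q.
Qed.

Lemma image_cusp_points C :
  [set p | cusp_point (h @` C) p] = h @` [set p | cusp_point C p].
Proof.
have [h' [ah' hK h'K]] := affine_inv ah; apply/seteqP; split=> [p|_ [p cp <-]].
  rewrite /= -{1}(h'K p) /cusp_point image_locally_like => cp.
  by exists (h' p).
exact/image_locally_like.
Qed.

Lemma image_smooth C : (forall p, C p -> smooth_point C p) ->
  forall p, (h @` C) p -> smooth_point (h @` C) p.
Proof. by move=> sC _ [p Cp <-]; apply/image_locally_like; exact: sC. Qed.

Lemma image_smooth_except_cusps n C :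
  smooth_except_cusps n C -> smooth_except_cusps n (h @` C).
Proof.
move=> [cC sC]; split.
  rewrite image_cusp_points; apply: card_eq_trans cC.
  by apply: inj_card_eq => p q _ _; exact: affine_inj.
move=> _ [p Cp <-]; rewrite /cusp_point /smooth_point !image_locally_like.
exact: sC.
Qed.

Lemma image_setT : h @` setT = setT.
Proof.
have [h' [ah' hK h'K]] := affine_inv ah.
by apply/seteqP; split=> // p _; exists (h' p).
Qed.

End AffineImages.

(** * Invariance and uniqueness of the type *)

Section TypeInvariance.
Context {R : realType}.
Implicit Types (p q v : plane R) (C L : set (plane R)) (f g h k : plane R -> plane R).

Lemma nonconstant_affine_comp (l : plane R -> R) h (c : R) : c != 0 ->
  affine_iso h -> nonconstant_affine l ->
  nonconstant_affine (fun p => c * l (h p)).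
Proof.
move=> c0 /affine_coord[a [b [a' [b' [e [e' [D hE]]]]]]] [u [w [z [uw lE]]]].
exists (c * (u * a + w * a')), (c * (u * b + w * b')), (c * (u * e + w * e' + z)).
split; last by move=> p; rewrite lE hE !coordE; ring.
rewrite !mulf_eq0 (negbTE c0) /= -negb_and; apply/negP => /andP[/eqP e1 /eqP e2].
(* Cramer's rule: the new coefficients are (u, w) times the invertible linear part of [h]. *)
have u0 : u * (a * b' - b * a') = 0.
  have -> : u * (a * b' - b * a') = b' * (u * a + w * a') - a' * (u * b + w * b').
    by ring.
  by rewrite e1 e2; ring.
have w0 : w * (a * b' - b * a') = 0.
  have -> : w * (a * b' - b * a') = a * (u * b + w * b') - b * (u * a + w * a').
    by ring.
  by rewrite e1 e2; ring.
move/eqP: u0; move/eqP: w0; rewrite !mulf_eq0 (negbTE D) !orbF => w0 u0.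
by move: uw; rewrite u0 w0.
Qed.

(** [h] carries J0 and [k] carries J1, since the two Jacobian determinants differ by a nonzero
    factor along [h]; every clause then follows from the stability of its shape under affine
    maps. *)
Lemma has_type_affine f g h k T : (forall p, differentiable f p) ->
  (forall p, differentiable g p) -> affine_iso h -> affine_iso k ->
  k \o f = g \o h -> has_type f T -> has_type g T.
Proof.
move=> df dg ah ak E.
have [c c0 cE] := detD_conj df dg ah ak E.
have [h' [ah' hK h'K]] := affine_inv ah.
have gE C : g @` (h @` C) = k @` (f @` C) by rewrite !image_comp E.
have J0E : J0 g = h @` J0 f.
  apply/seteqP; split=> [p|_ [p fp <-]].
    rewrite /J0 /= -{1}(h'K p) cE => /eqP; rewrite mulf_eq0 (negbTE c0) /= => /eqP e.
    by exists (h' p).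
  by rewrite /J0 /= cE fp mulr0.
have J1E : J1 g = k @` J1 f by rewrite /J1 J0E gE.
have dE : detD g = fun p => c * detD f (h' p).
  by apply/funext => p; rewrite -cE h'K.
have NA : nonconstant_affine (detD f) -> nonconstant_affine (detD g).
  by rewrite dE; exact: nonconstant_affine_comp.
have hi := affine_inj ah; have ki := affine_inj ak.
case: T; rewrite /has_type ?J1E ?J0E.
- by move=> [-> ->]; rewrite !image_set0.
- by move=> [? ?]; split; exact: image_point.
- move=> [? ? ?]; split; first exact: image_ellipse.
    exact: image_closed_curve.
  exact: image_smooth_except_cusps.
- move=> [B [B' [H J [c1 c2] s s']]]; exists (h @` B), (h @` B').
  rewrite !gE; split.
  + exact: image_hyperbola.
  + by rewrite J image_setU.
  + by split; exact: image_curve.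
  + exact: (image_smooth ak s).
  + exact: image_smooth_except_cusps.
- move=> [H [p [r [r' [rp r'p rr' J]]]]]; split; first exact: image_intersecting.
  exists (k p), (k @` r), (k @` r'); split; try exact: image_ray.
    by move/(injective_image ki).
  by rewrite J image_setU.
- move=> [H [p [r [P [rp Pp J]]]]]; split; first exact: image_intersecting.
  exists (k p), (k @` r), (k @` P); split; first exact: image_ray.
    exact: image_parabola_at.
  by rewrite J image_setU.
- move=> [? ? ?]; split; first exact: image_parabola.
    exact: image_curve.
  exact: image_smooth_except_cusps.
- move=> [L [L' [M [p [[lL lL' LL' J] lM J' LM L'p]]]]].
  exists (h @` L), (h @` L'), (k @` M), (k p); split.
  + split; try exact: image_line.
      apply/seteqP; split=> // _ [[q Lq <-] [q' L'q' /hi e]].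
      suff : (L `&` L') q by rewrite LL'.
      by split=> //; rewrite -e.
    by rewrite J image_setU.
  + exact: image_line.
  + by rewrite J' image_setU image_set1.
  + by rewrite gE LM.
  + by rewrite gE L'p image_set1.
- move=> [? [c' [l [c'0 nl dl]]]]; split; first exact: image_point.
  (* The factor 1 gives the function the form treated by [nonconstant_affine_comp]. *)
  exists (c * c'), (fun p => 1 * l (h' p)); split; first by rewrite mulf_neq0.
    by apply: nonconstant_affine_comp => //; exact: oner_neq0.
  by move=> p; rewrite dE /= dl mul1r mulrA.
- by move=> [/NA ? ?]; split=> //; exact: image_point.
- by move=> [/NA ? ?]; split=> //; exact: image_line.
- by move=> [/NA ? ?]; split=> //; exact: image_parabola.
- by move=> [-> ?]; split; [exact: image_setT|exact: image_line].
- move=> [-> [p rp]]; split; first exact: image_setT.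
  by exists (k p); exact: image_ray.
- by move=> [-> ?]; split; [exact: image_setT|exact: image_parabola].
Qed.

End TypeInvariance.

(** * Affine invariants of plane sets *)

Section Shapes.
Context {R : realType}.
Implicit Types (p q v : plane R) (C L : set (plane R)) (h : plane R -> plane R).

Definition two_points C := exists p q, [/\ C p, C q & p <> q].
Definition bounded2 C := exists M : R, forall p, C p -> `|xc p| <= M /\ `|yc p| <= M.
Definition has_line C := exists p v, v != 0 /\ forall t : R, C (p + t *: v).
Definition has_ray C := exists p v, v != 0 /\ forall t : R, 0 <= t -> C (p + t *: v).
Definition flat C := forall p q (t : R), C p -> C q -> C (p + t *: (q - p)).
Definition central C := exists o, forall p, C p -> C (o + (o - p)).
(** All real ratios are allowed, so a nonempty conical set is a union of lines through [o], possibly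
    reduced to [o]; ratio 0 shows that [o] belongs to it. *)
Definition conical C := exists o, forall p (t : R), C p -> C (o + t *: (p - o)).

Section Images.
Variable h : plane R -> plane R.
Hypothesis ah : affine_iso h.

Lemma affine_diffs : exists2 A : 'M[R]_2, A \in unitmx &
  forall p v (t : R), h (p + t *: v) = h p + t *: (v *m A).
Proof.
have [A [a [uA hE]]] := ah; exists A => // p v t.
by rewrite !hE mulmxDl -scalemxAl addrAC.
Qed.

Lemma image_bounded2 C : bounded2 C -> bounded2 (h @` C).
Proof.
have [a [b [c [d [e [e' [_ hE]]]]]]] := affine_coord ah; move=> [M CM].
have bd (x y z X Y : R) : `|X| <= M -> `|Y| <= M ->
    `|x * X + y * Y + z| <= `|x| * M + `|y| * M + `|z|.
  move=> hX hY; do 2 (apply: le_trans (ler_normD _ _) _; apply: lerD => //).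
    by rewrite normrM ler_wpM2l.
  by rewrite normrM ler_wpM2l.
exists ((`|a| * M + `|b| * M + `|e|) + (`|c| * M + `|d| * M + `|e'|)).
move=> _ [p /CM[px py] <-]; rewrite hE !coordE.
have h1 := bd a b e _ _ px py; have h2 := bd c d e' _ _ px py.
split; [apply: le_trans h1 _; rewrite lerDl | apply: le_trans h2 _; rewrite lerDr].
  exact: le_trans (normr_ge0 _) h2.
exact: le_trans (normr_ge0 _) h1.
Qed.

Lemma image_has_line C : has_line C -> has_line (h @` C).
Proof.
move=> [p [v [v0 Cv]]]; have [w w0 hw] := affine_line_image ah p v0.
by exists (h p), w; split=> // t; exists (p + t *: v).
Qed.

Lemma image_has_ray C : has_ray C -> has_ray (h @` C).
Proof.
move=> [p [v [v0 Cv]]]; have [w w0 hw] := affine_line_image ah p v0.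
by exists (h p), w; split=> // t t0; exists (p + t *: v) => //; exact: Cv.
Qed.

Lemma image_central C : central C -> central (h @` C).
Proof.
have [A uA hA] := affine_diffs; move=> [z Co]; exists (h z); move=> _ [p Cp <-].
exists (z + (z - p)); first exact: Co.
rewrite -[z - p]scale1r hA scale1r; congr (_ + _).
have := hA p (z - p) 1; rewrite !scale1r addrCA subrr addr0 => ->.
by rewrite addrAC subrr add0r.
Qed.

Lemma image_two_points C : two_points C -> two_points (h @` C).
Proof.
move=> [p [q [Cp Cq pq]]]; exists (h p), (h q); split; [by exists p|by exists q|].
by move/(affine_inj ah).
Qed.

End Images.

(** This turns stability under affine images into refutations: a stable property that fails for [C]
    fails for its image as well. *)
Lemma affine_preimage h C : affine_iso h ->
  exists2 h', affine_iso h' & C = h' @` (h @` C).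
Proof.
move=> /affine_inv[h' [ah' hK _]]; exists h' => //; rewrite image_comp.
apply/seteqP; split=> [p Cp|_ [p Cp <-]]; first by exists p => //=.
by rewrite /= hK.
Qed.

Lemma has_line_ray C : has_line C -> has_ray C.
Proof. by move=> [p [v [v0 Cv]]]; exists p, v. Qed.

Lemma has_line_two C : has_line C -> two_points C.
Proof.
move=> [p [v [v0 Cv]]]; exists (p + 0 *: v), (p + 1 *: v); split=> //.
by move/addrI/eqP; rewrite scale0r scale1r eq_sym (negbTE v0).
Qed.

Lemma has_line_unbounded C : has_line C -> ~ bounded2 C.
Proof.
move=> [p [v [v0 Cv]]] [M CM].
have aux (a b : R) : b != 0 -> exists t, M < `|a + t * b|.
  move=> b0; exists ((`|M| + 1 - a) / b); rewrite divfK // addrC subrK.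
  by rewrite ger0_norm ?addr_ge0 // (le_lt_trans (ler_norm M)) // ltrDl.
have [vx|vx] := eqVneq (xc v) 0.
  have vy : yc v != 0.
    apply: contraNneq v0 => vy; apply/eqP/plane_eq; rewrite ?coordE //.
  have [t Mt] := aux (yc p) _ vy; have [_] := CM _ (Cv t).
  by rewrite !coordE leNgt Mt.
have [t Mt] := aux (xc p) _ vx; have [+ _] := CM _ (Cv t).
by rewrite !coordE leNgt Mt.
Qed.

Lemma line_flat L : is_line L -> flat L.
Proof.
move=> [p [v [_ ->]]] _ _ t [a _ <-] [b _ <-]; exists (a + t * (b - a)) => //.
by apply: plane_eq; rewrite !coordE; ring.
Qed.

Lemma line_has_line L : is_line L -> has_line L.
Proof. by move=> [p [v [v0 ->]]]; exists p, v; split=> // t; exists t. Qed.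

Lemma line_eqn L : is_line L -> exists a b c : R, ((a != 0) || (b != 0)) /\
  forall p, L p -> a * xc p + b * yc p + c = 0.
Proof.
move=> [p [v [v0 ->]]].
exists (yc v), (- xc v), (xc v * yc p - yc v * xc p); split.
  rewrite oppr_eq0 orbC -negb_and; apply: contra v0 => /andP[/eqP vx /eqP vy].
  by apply/eqP/plane_eq; rewrite ?coordE.
by move=> _ [t _ <-]; rewrite !coordE; ring.
Qed.

Lemma line_not_full L : is_line L -> ~ (L = setT).
Proof.
move=> /line_eqn[a [b [c [ab Lab]]]] LT.
have L0 : L (pt 0 0) by rewrite LT.
have L1 : L (pt 1 0) by rewrite LT.
have L2 : L (pt 0 1) by rewrite LT.
move: (Lab _ L0) (Lab _ L1) (Lab _ L2); rewrite !coordE => e0 e1 e2.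
have a0 : a = 0 by lra.
have b0 : b = 0 by lra.
by move: ab; rewrite a0 b0 eqxx.
Qed.

Lemma zero_line (l : plane R -> R) : nonconstant_affine l -> is_line [set p | l p = 0].
Proof.
move=> [a [b [c [ab lE]]]].
have n0 : a ^+ 2 + b ^+ 2 != 0.
  rewrite paddr_eq0 ?sqr_ge0 // !sqrf_eq0; case/orP: ab => /negbTE -> //.
  by rewrite andbF.
pose s := a ^+ 2 + b ^+ 2.
(* The foot of the perpendicular from the origin, and the normal (a, b) turned by a right angle. *)
exists (pt (- c * a / s) (- c * b / s)), (pt (- b) a); split.
  by rewrite pt_neq0 oppr_eq0 orbC.
apply/seteqP; split=> p /=; rewrite lE.
  move=> e; exists ((a * yc p - b * xc p) / s) => //.
  have cE : c = - (a * xc p + b * yc p) by lra.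
  by apply: plane_eq; rewrite !coordE cE /s; field.
by move=> [t _ <-]; rewrite !coordE /s; field.
Qed.

Lemma mid_ext p q : q = p + 2 *: ((p + 2^-1 *: (q - p)) - p).
Proof. by apply: plane_eq; rewrite !coordE; field. Qed.

Lemma mid_ext' p q : p = q + 2 *: ((p + 2^-1 *: (q - p)) - q).
Proof. by apply: plane_eq; rewrite !coordE; field. Qed.

(* If the midpoint of two points, one on each line, lies on one of the lines,
   that line contains both points. *)
Lemma lines_midpoint L L' p q : is_line L -> is_line L' -> L p -> L' q ->
  (L `|` L') (p + 2^-1 *: (q - p)) -> L q \/ L' p.
Proof.
move=> lL lL' Lp L'q [Lm|L'm].
  by left; rewrite (mid_ext p q); exact: line_flat.
by right; rewrite (mid_ext' p q); exact: line_flat.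
Qed.

Lemma line_sub L L' : is_line L -> is_line L' -> L `<=` L' -> L = L'.
Proof.
move=> lL [p [v [v0 ->]]]; case: (lL) => q [w [w0 LE]] LL'.
have [a _ ea] : [set p + t *: v | t in [set: R]] q.
  by apply: LL'; rewrite LE; exists 0 => //; rewrite scale0r addr0.
have [b _ eb] : [set p + t *: v | t in [set: R]] (q + w).
  by apply: LL'; rewrite LE; exists 1 => //; rewrite scale1r.
have wE : w = (b - a) *: v.
  by rewrite scalerBl -(addrK q w) [w + q]addrC -eb -ea opprD addrACA subrr add0r.
have ba : b - a != 0 by apply: contraNneq w0 => e; rewrite wE e scale0r.
apply/seteqP; split=> // _ [t _ <-]; rewrite LE; exists ((t - a) / (b - a)) => //.
by rewrite wE -ea scalerA divfK //; apply: plane_eq; rewrite !coordE; ring.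
Qed.

Lemma parallel_not_flat L L' : is_line L -> is_line L' -> L `&` L' = set0 ->
  ~ flat (L `|` L').
Proof.
move=> lL lL' LL' F.
have [p [v [_ Lp]]] := line_has_line lL; have [q [w [_ L'q]]] := line_has_line lL'.
have := F _ _ 2^-1 (or_introl (Lp 0)) (or_intror (L'q 0)).
have no r : L r -> L' r -> False by move=> Lr L'r; suff : (L `&` L') r by rewrite LL'.
by move/(lines_midpoint lL lL' (Lp 0) (L'q 0)) => [/no|/(no _ (Lp 0))]; apply.
Qed.

(** Ratio 0 puts the centre on one of the lines; ratio 1/2 applied to a point of the other line
    gives a midpoint, to which [lines_midpoint] applies. *)
Lemma parallel_not_conical L L' : is_line L -> is_line L' -> L `&` L' = set0 ->
  ~ conical (L `|` L').
Proof.
move=> lL lL' LL' [z F].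
have [p [v [_ Lp]]] := line_has_line lL; have [q [w [_ L'q]]] := line_has_line lL'.
have no r : L r -> L' r -> False by move=> Lr L'r; suff : (L `&` L') r by rewrite LL'.
have : (L `|` L') z.
  by have := F _ 0 (or_introl (Lp 0)); rewrite scale0r addr0.
move=> [Lo|L'o].
  have := F _ 2^-1 (or_intror (L'q 0)).
  by move/(lines_midpoint lL lL' Lo (L'q 0)) => [/no|/(no _ Lo)]; apply.
have := F _ 2^-1 (or_introl (Lp 0)); rewrite setUC.
by move/(lines_midpoint lL' lL L'o (Lp 0)) => [/(no _ (Lp 0))|/no]; apply.
Qed.

Lemma intersecting_conical C : intersecting_lines C -> conical C.
Proof.
move=> [L [L' [lL lL' _ [z [Lo L'o]] ->]]]; exists z => p t [Lp|L'p].
  by left; exact: line_flat.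
by right; exact: line_flat.
Qed.

Lemma intersecting_has_line C : intersecting_lines C -> has_line C.
Proof.
move=> [L [L' [lL lL' _ _ ->]]]; have [p [v [v0 Lp]]] := line_has_line lL.
by exists p, v; split=> // t; left.
Qed.

Lemma intersecting_not_flat C : intersecting_lines C -> ~ flat C.
Proof.
move=> [L [L' [lL lL' LL' _ ->]]] F.
have [p Lp L'p] : exists2 p, L p & ~ L' p.
  apply: contrapT => H; apply: LL'; apply: line_sub => // p Lp.
  by apply: contrapT => L'p; apply: H; exists p.
have [q L'q Lq] : exists2 q, L' q & ~ L q.
  apply: contrapT => H; apply: LL'; apply/esym/line_sub => // q L'q.
  by apply: contrapT => Lq; apply: H; exists q.
by have [] := lines_midpoint lL lL' Lp L'q (F _ _ 2^-1 (or_introl Lp) (or_intror L'q)).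
Qed.

Lemma circle_bounded : bounded2 (@circle R).
Proof.
exists 1 => p; rewrite /circle /= => e.
have sq1 (x y : R) : x ^+ 2 + y ^+ 2 = 1 -> `|x| <= 1.
  move=> xy; rewrite -(@ler_pXn2r _ 2) ?nnegrE // real_normK ?num_real // expr1n.
  by rewrite -xy lerDl sqr_ge0.
split; first exact: sq1 e.
by apply: (sq1 _ (xc p)); rewrite addrC.
Qed.

Lemma circle_two : two_points (@circle R).
Proof.
exists (pt 1 0), (pt (-1) 0); rewrite /circle /= !coordE; split; try by ring.
move/pt_inj => [e _]; lra.
Qed.

Definition hyperbola : set (plane R) := [set p | xc p * yc p = 1].
Definition parabola : set (plane R) := [set p | yc p = xc p ^+ 2].

Lemma is_hyperbolaE B B' C : is_hyperbola B B' C ->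
  exists2 h, affine_iso h & C = h @` hyperbola.
Proof.
move=> [h [ah -> -> ->]]; exists h => //; rewrite -image_setU; congr (_ @` _).
apply/seteqP; split=> p; rewrite /hyperbola /=; first by case=> [[]|[]].
move=> e; have : xc p != 0 by apply: contra_eq_neq e => ->; rewrite mul0r eq_sym oner_neq0.
by rewrite neq_lt => /orP[] ?; [right|left].
Qed.

Lemma hyperbola_two : two_points hyperbola.
Proof.
exists (pt 1 1), (pt (-1) (-1)); rewrite /hyperbola /= !coordE; split; try by ring.
move/pt_inj => [e _]; lra.
Qed.

Lemma hyperbola_central : central hyperbola.
Proof.
exists 0 => p; rewrite /hyperbola /= => e; rewrite !coordE -e; ring.
Qed.

Lemma hyperbola_unbounded : ~ bounded2 hyperbola.
Proof.
move=> [M HM]; pose x := `|M| + 1.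
have x0 : 0 < x by rewrite ltr_wpDl.
have /HM[+ _] : hyperbola (pt x x^-1) by rewrite /hyperbola /= !coordE divff // gt_eqF.
by rewrite xc_pt gtr0_norm // leNgt (le_lt_trans (ler_norm M)) // ltrDl.
Qed.

Lemma vec_neq0 v : v != 0 -> xc v = 0 -> yc v = 0 -> False.
Proof. by move=> + vx vy; move/eqP; apply; apply: plane_eq; rewrite ?coordE. Qed.

(** Along a line x y is a quadratic polynomial in t; its values at -1, 0 and 1 force both
    nonconstant coefficients to vanish, and then the direction as well. *)
Lemma hyperbola_no_line : ~ has_line hyperbola.
Proof.
move=> [p [v [v0 H]]].
move: (H 0) (H 1) (H (-1)); rewrite /hyperbola /= !coordE => e0 e1 e2.
have cd : xc v * yc v = 0 by lra.
have s : xc p * yc v + xc v * yc p = 0 by lra.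
have x0 : xc v = 0.
  apply/eqP; rewrite -sqrf_eq0; apply/eqP.
  have -> : xc v ^+ 2 = xc v ^+ 2 * (xc p * yc p) by rewrite -(mulr1 (_ ^+ 2)); congr (_ * _); lra.
  have -> : xc v ^+ 2 * (xc p * yc p) =
    xc v * xc p * (xc p * yc v + xc v * yc p) - xc p ^+ 2 * (xc v * yc v) by ring.
  by rewrite s cd !mulr0 subrr.
apply: (vec_neq0 v0 x0).
have : yc v * (xc p * yc p) = 0.
  have -> : yc v * (xc p * yc p) = yc p * (xc p * yc v + xc v * yc p) - xc v * yc p ^+ 2 by ring.
  by rewrite s x0; ring.
have -> : xc p * yc p = 1 by lra.
by rewrite mulr1.
Qed.

Lemma parabola_two : two_points parabola.
Proof.
exists (pt 1 1), (pt (-1) 1); rewrite /parabola /= !coordE; split; try by ring.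
move/pt_inj => [e _]; lra.
Qed.

Lemma parabola_unbounded : ~ bounded2 parabola.
Proof.
move=> [M HM]; pose x := `|M| + 1.
have x0 : 0 < x by rewrite ltr_wpDl.
have /HM[+ _] : parabola (pt x (x ^+ 2)) by rewrite /parabola /= !coordE.
by rewrite xc_pt gtr0_norm // leNgt (le_lt_trans (ler_norm M)) // ltrDl.
Qed.

(** The second difference of x^2 - y at t = 0, 1, 2 is twice the square of the horizontal speed. *)
Lemma parabola_no_ray : ~ has_ray parabola.
Proof.
move=> [p [v [v0 H]]].
move: (H 0 (lexx _)) (H 1 ler01) (H 2 (ler0n _ 2)).
rewrite /parabola /= !coordE => e0 e1 e2.
have x0 : xc v = 0 by apply/eqP; rewrite -sqrf_eq0; apply/eqP; nra.
by apply: (vec_neq0 v0 x0); move: e0 e1 e2; rewrite x0; nra.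
Qed.

(** The reflections of (1, 1) and (-1, 1) force the centre onto x = 0, that of the vertex then
    forces it to be the origin, and (-1, -1) is not on the parabola. *)
Lemma parabola_not_central : ~ central parabola.
Proof.
move=> [z H].
have h0 : parabola (pt 0 0) by rewrite /parabola /= !coordE; ring.
have h1 : parabola (pt 1 1) by rewrite /parabola /= !coordE; ring.
have h2 : parabola (pt (-1) 1) by rewrite /parabola /= !coordE; ring.
by move: (H _ h0) (H _ h1) (H _ h2); rewrite /parabola /= !coordE; nra.
Qed.

Lemma is_parabolaE C : is_parabola C -> exists2 h, affine_iso h & C = h @` parabola.
Proof. by move=> [v [h [ah _ ->]]]; exists h. Qed.

Lemma is_parabola_no_ray C : is_parabola C -> ~ has_ray C.
Proof.
move=> /is_parabolaE[h ah ->]; have [h' ah' e] := affine_preimage parabola ah.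
by move/(image_has_ray ah'); rewrite -e; exact: parabola_no_ray.
Qed.

Lemma is_parabola_two C : is_parabola C -> two_points C.
Proof. by move=> /is_parabolaE[h ah ->]; apply: image_two_points => //; exact: parabola_two. Qed.

Lemma flat_has_line C : two_points C -> flat C -> has_line C.
Proof.
move=> [p [q [Cp Cq pq]]] F; exists p, (q - p); split; last by move=> t; exact: F.
by rewrite subr_eq0 eq_sym; apply/eqP.
Qed.

Lemma is_parabola_not_flat C : is_parabola C -> ~ flat C.
Proof.
move=> PC /(flat_has_line (is_parabola_two PC))/has_line_ray.
exact: is_parabola_no_ray.
Qed.

Lemma ray_has_ray p C : is_ray p C -> has_ray C.
Proof. by move=> [v [v0 ->]]; exists p, v; split=> // t t0; exists t. Qed.

Lemma ray_not_flat p C : is_ray p C -> ~ flat C.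
Proof.
move=> [v [v0 ->]] F.
have hp : [set p + t *: v | t in [set t : R | 0 <= t]] p.
  by exists 0; rewrite /= ?lexx // scale0r addr0.
have hq : [set p + t *: v | t in [set t : R | 0 <= t]] (p + v).
  by exists 1; rewrite /= ?ler01 // scale1r.
have [t t0] := F _ _ (-1) hp hq; rewrite /= in t0.
move/addrI; rewrite addrAC subrr add0r => /eqP; rewrite -subr_eq0 -scalerBl scaler_eq0.
by rewrite (negbTE v0) orbF opprK; apply/negP; rewrite gt_eqF // ltr_wpDl.
Qed.

Lemma ray_line p C : is_ray p C -> exists2 L, is_line L & C `<=` L.
Proof.
move=> [v [v0 ->]]; exists [set p + t *: v | t in [set: R]]; first by exists p, v.
by move=> _ [t _ <-]; exists t.
Qed.

(* Of five points of the parabola, three lie on the same line; but a line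
   meets the parabola at most twice. *)
Lemma parabola_not_in_lines L L' : is_line L -> is_line L' -> ~ (parabola `<=` L `|` L').
Proof.
move=> /line_eqn[a [b [c [ab Lab]]]] /line_eqn[a' [b' [c' [ab' Lab']]]] H.
have K (t : R) : a * t + b * t ^+ 2 + c = 0 \/ a' * t + b' * t ^+ 2 + c' = 0.
  have /H[/Lab|/Lab'] : parabola (pt t (t ^+ 2)) by rewrite /parabola /= !coordE.
    by rewrite !coordE; left.
  by rewrite !coordE; right.
have [] : (a = 0 /\ b = 0) \/ (a' = 0 /\ b' = 0).
  (* In each of the 32 distributions some line has three of the five parameters as roots of its
     quadratic equation. *)
  case: (K 0) (K 1) (K 2) (K 3) (K 4) => e0 [] e1 [] e2 [] e3 [] e4;
  first [left; split; lra | right; split; lra].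
- by move=> [a0 b0]; move: ab; rewrite a0 b0 eqxx.
- by move=> [a0 b0]; move: ab'; rewrite a0 b0 eqxx.
Qed.

Lemma is_parabola_not_in_rays C r r' p p' : is_parabola C -> is_ray p r ->
  is_ray p' r' -> ~ (C `<=` r `|` r').
Proof.
move=> /is_parabolaE[h ah ->] /ray_line[L lL rL] /ray_line[L' lL' rL'] H.
have [h' ah' e] := affine_preimage parabola ah.
apply: (parabola_not_in_lines (image_line ah' lL) (image_line ah' lL')).
rewrite e -image_setU; apply: image_subset => q /H[/rL|/rL']; by [left|right].
Qed.

End Shapes.

(** * Separation of the fifteen types *)

Section TypeUniqueness.
Context {R : realType}.
Implicit Types (p q v : plane R) (C L : set (plane R)) (Q : plane R -> plane R).

Inductive shape :=
  Empty | Point | Ellipse | Hyperbola | Parabola | Crossing | Parallel | Line | Whole.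

Definition shape_of (T : crit_type) : shape :=
  match T with
  | T1 => Empty | T2 => Point | T3 => Ellipse | T4 => Hyperbola
  | T5a | T5b => Crossing | T6 => Parabola | T7a => Parallel
  | T7b | T8a | T8b | T8c => Line | T9a | T9b | T9c => Whole
  end.

(** The clauses are chosen so that two different ones contradict each other by propositional
    reasoning from the few implications listed in [shape_unique]. *)
Definition has_shape (s : shape) C : Prop :=
  match s with
  | Empty => C = set0
  | Point => C !=set0 /\ ~ two_points C
  | Ellipse => [/\ C !=set0, two_points C & bounded2 C]
  | Hyperbola => [/\ C !=set0, two_points C, ~ bounded2 C, ~ has_line C & central C]
  | Parabola => [/\ C !=set0, two_points C, ~ bounded2 C, ~ has_line C & ~ central C]
  | Crossing => [/\ has_line C, ~ flat C & conical C]
  | Parallel => [/\ has_line C, ~ flat C & ~ conical C]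
  | Line => [/\ has_line C, flat C & C <> setT]
  | Whole => C = setT
  end.

Lemma two_nonempty C : two_points C -> C !=set0.
Proof. by move=> [p [q [Cp _ _]]]; exists p. Qed.

Lemma point_not_two C : is_point C -> ~ two_points C.
Proof. by move=> [p ->] [q [r [-> ->]]]. Qed.

Lemma has_line_setT : has_line [set: plane R].
Proof. by exists 0, (pt 1 0); split; rewrite ?pt_neq0 ?oner_neq0. Qed.

Lemma shape_unique s s' C : has_shape s C -> has_shape s' C -> s = s'.
Proof.
have LB := @has_line_unbounded R C; have L2 := @has_line_two R C.
have N2 := @two_nonempty C.
have E0 : C = set0 -> ~ (C !=set0) by move=> -> [].
have W1 : C = setT -> has_line C by move=> ->; exact: has_line_setT.
have W2 : C = setT -> flat C by move=> ->.
case: s; case: s' => //= H1 H2;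
  (try match type of H1 with _ = _ => fail 1 | _ => destruct H1 end);
  (try match type of H2 with _ = _ => fail 1 | _ => destruct H2 end); tauto.
Qed.

Lemma has_type_shape Q T : has_type Q T -> has_shape (shape_of T) (J0 Q).
Proof.
(* Exponent [k.+1] treats together the double line ([k] = 1) and the simple lines ([k] = 0), which
   have the same zero set. *)
have line_shape (l : plane R -> R) (c : R) k : c != 0 -> nonconstant_affine l ->
    (forall p, detD Q p = c * l p ^+ k.+1) -> has_shape Line (J0 Q).
  move=> c0 /zero_line Ll dl.
  have -> : J0 Q = [set p | l p = 0].
    apply/seteqP; split=> p; rewrite /J0 /= dl; last first.
      by move=> ->; rewrite expr0n mulr0.
    by move/eqP; rewrite mulf_eq0 (negbTE c0) expf_eq0 => /eqP.
  split; [exact: line_has_line|exact: line_flat|exact: line_not_full].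
have line_shape1 : nonconstant_affine (detD Q) -> has_shape Line (J0 Q).
  move=> nl; apply: (line_shape _ 1 0%N (oner_neq0 _) nl) => p.
  by rewrite mul1r expr1.
case: T; rewrite /has_type /=.
- by case.
- by case=> H _; split; [case: H => p ->; exists p|exact: point_not_two].
- case=> [[h ah ->] _ _]; split; first 1 last.
  + by apply: image_two_points => //; exact: circle_two.
  + by apply: image_bounded2 => //; exact: circle_bounded.
  + apply: two_nonempty; apply: image_two_points => //; exact: circle_two.
- case=> [B [B' [/is_hyperbolaE[h ah ->] _ _ _ _]]].
  have [h' ah' e] := affine_preimage hyperbola ah; split.
  + by apply: two_nonempty; apply: image_two_points => //; exact: hyperbola_two.
  + by apply: image_two_points => //; exact: hyperbola_two.
  + by move/(image_bounded2 ah'); rewrite -e; exact: hyperbola_unbounded.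
  + by move/(image_has_line ah'); rewrite -e; exact: hyperbola_no_line.
  + by apply: image_central => //; exact: hyperbola_central.
- case=> H _; split; [exact: intersecting_has_line|exact: intersecting_not_flat|].
  exact: intersecting_conical.
- case=> H _; split; [exact: intersecting_has_line|exact: intersecting_not_flat|].
  exact: intersecting_conical.
- case=> P _ _; have [h ah ->] := is_parabolaE P.
  have [h' ah' e] := affine_preimage parabola ah; split.
  + by apply: two_nonempty; apply: image_two_points => //; exact: parabola_two.
  + by apply: image_two_points => //; exact: parabola_two.
  + by move/(image_bounded2 ah'); rewrite -e; exact: parabola_unbounded.
  + by move/(image_has_line ah')/has_line_ray; rewrite -e; exact: parabola_no_ray.
  + by move/(image_central ah'); rewrite -e; exact: parabola_not_central.
- case=> [L [L' [M [p [[lL lL' LL' ->] _ _ _ _]]]]]; split.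
  + by have [q [v [v0 Lq]]] := line_has_line lL; exists q, v; split=> // t; left.
  + exact: parallel_not_flat.
  + exact: parallel_not_conical.
- by case=> _ [c [l [c0 nl dl]]]; exact: (line_shape l c 1%N).
- by case=> /line_shape1.
- by case=> /line_shape1.
- by case=> /line_shape1.
- by case.
- by case.
- by case.
Qed.

(** Second differences along the axes vanish for [l] but are 2 c a^2 and 2 c b^2 on the other
    side. *)
Lemma nonconstant_affine_not_square (l m : plane R -> R) (c : R) : c != 0 ->
  nonconstant_affine m -> nonconstant_affine l ->
  ~ (forall p, l p = c * m p ^+ 2).
Proof.
move=> c0 [a [b [d [ab mE]]]] [a' [b' [d' [_ lE]]]] H.
move: (H (pt 0 0)) (H (pt 1 0)) (H (pt (-1) 0)) (H (pt 0 1)) (H (pt 0 (-1))).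
rewrite !lE !mE !coordE => e0 e1 e2 e3 e4.
have ca : c * a ^+ 2 = 0 by lra.
have cb : c * b ^+ 2 = 0 by lra.
move/eqP: ca; move/eqP: cb; rewrite !mulf_eq0 (negbTE c0) !orbb /= => b0 a0.
by move: ab; rewrite a0 b0.
Qed.

(** Only types with the same shape of J0 are left to separate: the two crossings, the four with a
    line, the three with the whole plane. J1 does this, except that [ns] separates the double line
    from the simple ones. *)
Lemma type_unique Q T T' : has_type Q T -> has_type Q T' -> T = T'.
Proof.
move=> H H'; have := shape_unique (has_type_shape H) (has_type_shape H').
have pl C : is_point C -> is_line C -> False.
  by move=> /point_not_two P /line_has_line/has_line_two.
have pp C : is_point C -> is_parabola C -> False.
  by move=> /point_not_two P /is_parabola_two.
have lp C : is_line C -> is_parabola C -> False.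
  by move=> /line_flat F /is_parabola_not_flat.
have lr C p : is_line C -> is_ray p C -> False.
  by move=> /line_flat F /ray_not_flat.
have rp C p : is_ray p C -> is_parabola C -> False.
  by move=> /ray_has_ray F /is_parabola_no_ray.
have ns : nonconstant_affine (detD Q) -> (exists (c : R) (l : plane R -> R),
    [/\ c != 0, nonconstant_affine l & forall p, detD Q p = c * l p ^+ 2]) -> False.
  by move=> n [c [l [c0 nl dl]]]; apply: (nonconstant_affine_not_square c0 nl n dl).
have ab : (exists p r r', [/\ is_ray p r, is_ray p r', r <> r' & J1 Q = r `|` r']) ->
    (exists p r P, [/\ is_ray p r, is_parabola_at p P & J1 Q = r `|` P]) -> False.
  move=> [p [r [r' [rp1 rp2 _ ->]]]] [p' [s [P [_ PP e]]]].
  apply: (is_parabola_not_in_rays (C := P) _ rp1 rp2); first by exists p'.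
  by rewrite e; exact: subsetUr.
have mrp C : (exists p, is_ray p C) -> is_parabola C -> False by move=> [p /rp].
have mlr C : is_line C -> (exists p, is_ray p C) -> False by move=> ? [p /lr]; apply.
clear lr rp.
case: T T' H H' => -[] //= [] H1 H2 [] H3 H4 _; exfalso;
  eauto using pl, pp, lp, mrp, mlr, ns, ab.
Qed.

End TypeUniqueness.

(** * Critical sets of the normal forms *)

Section QuadraticMaps.
Context {R : realType}.
Implicit Types (p q v : plane R) (Q : plane R -> plane R) (f g : plane R -> R).

Lemma is_diff_lin2_eq f p (a b a' b' : R) : is_diff p f (lin2 a b) ->
  a = a' -> b = b' -> is_diff p f (lin2 a' b').
Proof. by move=> D <- <-. Qed.

Lemma is_diff_lin2D f g p (a b c d : R) : is_diff p f (lin2 a b) ->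
  is_diff p g (lin2 c d) -> is_diff p (fun q => f q + g q) (lin2 (a + c) (b + d)).
Proof.
move=> Df Dg; have D := is_diffD Df Dg.
apply: DiffDef; first by case: D.
rewrite (@diff_val _ _ _ _ _ _ _ D); apply/funext => h.
by rewrite fctE /lin2; ring.
Qed.

Lemma is_diff_lin2M f g p (a b c d : R) : is_diff p f (lin2 a b) ->
  is_diff p g (lin2 c d) ->
  is_diff p (fun q => f q * g q) (lin2 (f p * c + g p * a) (f p * d + g p * b)).
Proof.
move=> Df Dg; have D := is_diffM Df Dg.
apply: DiffDef; first by case: D.
rewrite (@diff_val _ _ _ _ _ _ _ D); apply/funext => h.
by rewrite !fctE /lin2 /GRing.scale /=; ring.
Qed.

Lemma is_diff_lin2_cst p (c : R) : is_diff p (fun=> c) (lin2 0 0).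
Proof.
have D := is_diff_cst c p.
apply: DiffDef; first by case: D.
rewrite (@diff_val _ _ _ _ _ _ _ D); apply/funext => h.
by rewrite /lin2 !mulr0 addr0.
Qed.

Lemma is_diff_xc p : is_diff p (@xc R) (lin2 1 0).
Proof.
have -> : @xc R = lin2 1 0 by apply/funext => q; rewrite /lin2 mulr1 mulr0 addr0.
exact: is_diff_lin2.
Qed.

Lemma is_diff_yc p : is_diff p (@yc R) (lin2 0 1).
Proof.
have -> : @yc R = lin2 0 1 by apply/funext => q; rewrite /lin2 mulr1 mulr0 add0r.
exact: is_diff_lin2.
Qed.

(** Written with products instead of powers, so that [is_diff_qf] is an assembly of sum and product
    rules. *)
Definition qf (a b c d e k x y : R) : R :=
  a * (x * x) + b * (x * y) + c * (y * y) + d * x + e * y + k.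

Lemma is_diff_qf (a b c d e k : R) p :
  is_diff p (fun q => qf a b c d e k (xc q) (yc q))
    (lin2 (2 * a * xc p + b * yc p + d) (b * xc p + 2 * c * yc p + e)).
Proof.
have X := is_diff_xc p; have Y := is_diff_yc p.
have K c' := is_diff_lin2_cst p c'.
have := is_diff_lin2D (is_diff_lin2D (is_diff_lin2D (is_diff_lin2D (is_diff_lin2D
  (is_diff_lin2M (K a) (is_diff_lin2M X X)) (is_diff_lin2M (K b) (is_diff_lin2M X Y)))
  (is_diff_lin2M (K c) (is_diff_lin2M Y Y))) (is_diff_lin2M (K d) X))
  (is_diff_lin2M (K e) Y)) (K k).
by move/is_diff_lin2_eq; apply; ring.
Qed.

Lemma detD_pt f g p (a b c d : R) : is_diff p f (lin2 a b) ->
  is_diff p g (lin2 c d) -> detD (fun q => pt (f q) (g q)) p = a * d - b * c.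
Proof.
move=> Df Dg; have D := is_diff_pt Df Dg.
set F := fun q => pt (f q) (g q).
have dF : differentiable F p by case: D.
have JE v : v *m 'J F p = pt (lin2 a b v) (lin2 c d v).
  rewrite -deriveEjacobian // deriveE //.
  exact: (congr1 (@^~ v) (@diff_val _ _ _ _ _ _ _ D)).
have := JE (pt 1 0); have := JE (pt 0 1); rewrite !mulmx_rV2 /lin2 !coordE.
move=> /pt_inj[e1 e2] /pt_inj[e3 e4]; rewrite /detD det_mx2.
by move: e1 e2 e3 e4; rewrite !mul0r !mul1r !addr0 !add0r => -> -> -> ->; ring.
Qed.

Definition quad_coeffs (u : R -> R -> R) (a b c d e k : R) :=
  forall x y, u x y = qf a b c d e k x y.

Lemma detD_polymap (u v : R -> R -> R) (a b c d e k a' b' c' d' e' k' : R) p :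
  quad_coeffs u a b c d e k -> quad_coeffs v a' b' c' d' e' k' ->
  detD (polymap u v) p =
    (2 * a * xc p + b * yc p + d) * (b' * xc p + 2 * c' * yc p + e') -
    (b * xc p + 2 * c * yc p + e) * (2 * a' * xc p + b' * yc p + d').
Proof.
move=> uE vE; have -> : polymap u v = fun q : plane R =>
    pt (qf a b c d e k (xc q) (yc q)) (qf a' b' c' d' e' k' (xc q) (yc q)).
  by apply/funext => q; rewrite /polymap uE vE.
by apply: detD_pt; exact: is_diff_qf.
Qed.

Lemma quadratic_mapP Q : quadratic_map Q <->
  exists (u v : R -> R -> R) (a b c d e k a' b' c' d' e' k' : R),
    [/\ [|| a != 0, b != 0, c != 0, a' != 0, b' != 0 | c' != 0],
        quad_coeffs u a b c d e k, quad_coeffs v a' b' c' d' e' k' &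
        Q = polymap u v].
Proof.
split=> [[a [b [c [d [e [k [[i ne] QE]]]]]]]|].
  exists (qf (a 0) (b 0) (c 0) (d 0) (e 0) (k 0)),
    (qf (a 1) (b 1) (c 1) (d 1) (e 1) (k 1)).
  exists (a 0), (b 0), (c 0), (d 0), (e 0), (k 0), (a 1), (b 1), (c 1), (d 1),
    (e 1), (k 1); split=> //.
    by elim/ord2_ind: i ne => /or3P[] ->; rewrite ?orbT.
  apply/funext => p; apply: plane_eq; rewrite /polymap !coordE.
    by rewrite [LHS]QE /qf !expr2.
  by rewrite [LHS]QE /qf !expr2.
move=> [u [v [a [b [c [d [e [k [a' [b' [c' [d' [e' [k' [ne uE vE ->]]]]]]]]]]]]]]].
pose s (x y : R) (i : 'I_2) := if i == 0 then x else y.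
exists (s a a'), (s b b'), (s c c'), (s d d'), (s e e'), (s k k'); split.
  by case/or4P: ne => [h|h|h|/or3P[]h]; [exists 0|exists 0|exists 0|exists 1..];
    rewrite /s /= h ?orbT.
move=> p i; rewrite /polymap uE vE /qf mxE /s.
by elim/ord2_ind: i => /=; ring.
Qed.

Lemma quadratic_differentiable Q p : quadratic_map Q -> differentiable Q p.
Proof.
move=> /quadratic_mapP.
move=> [u [v [a [b [c [d [e [k [a' [b' [c' [d' [e' [k' [ne uE vE ->]]]]]]]]]]]]]]].
have -> : polymap u v = fun q : plane R =>
    pt (qf a b c d e k (xc q) (yc q)) (qf a' b' c' d' e' k' (xc q) (yc q)).
  by apply/funext => q; rewrite /polymap uE vE.
by have [] := is_diff_pt (is_diff_qf a b c d e k p) (is_diff_qf a' b' c' d' e' k' p).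
Qed.

Lemma quadratic_continuous Q : quadratic_map Q -> continuous Q.
Proof.
by move=> qQ p; apply: differentiable_continuous; exact: quadratic_differentiable.
Qed.

End QuadraticMaps.

(** * The eighteen normal forms, their Jacobians, and the types without cusps *)

Section NormalForms.
Context {R : realType}.
Implicit Types (p q v : plane R).

Definition nf1 : plane R -> plane R := polymap (fun x y => x ^+ 2 + y) (fun x y => x).
Definition nf2 : plane R -> plane R :=
  polymap (fun x y => x ^+ 2 - y ^+ 2) (fun x y => x * y).
Definition nf3 : plane R -> plane R :=
  polymap (fun x y => x ^+ 2 - y ^+ 2 + 2 * x) (fun x y => 2 * x * y - 2 * y).
(** The analogue of [nf3] over the split-complex numbers x + j y with j^2 = 1: z^2 plus twice the
    conjugate of z. *)
Definition nf4 : plane R -> plane R :=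
  polymap (fun x y => x ^+ 2 + y ^+ 2 + 2 * x) (fun x y => 2 * x * y - 2 * y).
Definition nf5a : plane R -> plane R := polymap (fun x y => x ^+ 2) (fun x y => y ^+ 2).
Definition nf5b : plane R -> plane R :=
  polymap (fun x y => x ^+ 2 + y) (fun x y => y ^+ 2).
(** The constants make the critical image exactly the curve (t^2, t^3). *)
Definition nf6 : plane R -> plane R :=
  polymap (fun x y => (x ^+ 2 + y) / 3) (fun x y => x * y / 2).
Definition nf7a : plane R -> plane R :=
  polymap (fun x y => x ^+ 2 + x) (fun x y => x * y).
Definition nf7b : plane R -> plane R := polymap (fun x y => x ^+ 2) (fun x y => x * y).
Definition nf8a : plane R -> plane R := polymap (fun x y => x * y) (fun x y => y).
Definition nf8b : plane R -> plane R := polymap (fun x y => x ^+ 2) (fun x y => y).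
Definition nf9c : plane R -> plane R := polymap (fun x y => x ^+ 2) (fun x y => x).
Definition nf8c : plane R -> plane R :=
  polymap (fun x y => x ^+ 2 - y ^+ 2) (fun x y => y).
Definition nf8c' : plane R -> plane R :=
  polymap (fun x y => x ^+ 2 + y ^+ 2) (fun x y => y).
Definition nf9a : plane R -> plane R :=
  polymap (fun x y => x ^+ 2 - y ^+ 2) (fun x y => 0).
Definition nf9a' : plane R -> plane R := polymap (fun x y => x ^+ 2 + y) (fun x y => 0).
Definition nf9b : plane R -> plane R :=
  polymap (fun x y => x ^+ 2 + y ^+ 2) (fun x y => 0).
Definition nf9b' : plane R -> plane R := polymap (fun x y => x ^+ 2) (fun x y => 0).

Lemma set_eqP (T : Type) (A B : set T) : (forall x, A x <-> B x) -> A = B.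
Proof. by move=> H; apply/seteqP; split=> x /H. Qed.

Ltac det_by a b c d e k a' b' c' d' e' k' :=
  rewrite (@detD_polymap R _ _ a b c d e k a' b' c' d' e' k');
  [ring | move=> x y; rewrite /qf; ring | move=> x y; rewrite /qf; ring].

Lemma det_nf1 p : detD nf1 p = -1.
Proof. det_by (1:R) (0:R) (0:R) (0:R) (1:R) (0:R) (0:R) (0:R) (0:R) (1:R) (0:R) (0:R). Qed.
Lemma det_nf2 p : detD nf2 p = 2 * (xc p ^+ 2 + yc p ^+ 2).
Proof. det_by (1:R) (0:R) (-1:R) (0:R) (0:R) (0:R) (0:R) (1:R) (0:R) (0:R) (0:R) (0:R). Qed.
Lemma det_nf3 p : detD nf3 p = 4 * (xc p ^+ 2 + yc p ^+ 2 - 1).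
Proof. det_by (1:R) (0:R) (-1:R) (2:R) (0:R) (0:R) (0:R) (2:R) (0:R) (0:R) (-2:R) (0:R). Qed.
Lemma det_nf4 p : detD nf4 p = 4 * (xc p ^+ 2 - yc p ^+ 2 - 1).
Proof. det_by (1:R) (0:R) (1:R) (2:R) (0:R) (0:R) (0:R) (2:R) (0:R) (0:R) (-2:R) (0:R). Qed.
Lemma det_nf5a p : detD nf5a p = 4 * (xc p * yc p).
Proof. det_by (1:R) (0:R) (0:R) (0:R) (0:R) (0:R) (0:R) (0:R) (1:R) (0:R) (0:R) (0:R). Qed.
Lemma det_nf5b p : detD nf5b p = 4 * (xc p * yc p).
Proof. det_by (1:R) (0:R) (0:R) (0:R) (1:R) (0:R) (0:R) (0:R) (1:R) (0:R) (0:R) (0:R). Qed.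
Lemma det_nf6 p : detD nf6 p = (2 * xc p ^+ 2 - yc p) / 6.
Proof.
rewrite (@detD_polymap R _ _ (1/3) 0 0 0 (1/3) 0 0 (1/2) 0 0 0 0); first by field.
  by move=> x y; rewrite /qf; field.
by move=> x y; rewrite /qf; field.
Qed.
Lemma det_nf7a p : detD nf7a p = (2 * xc p + 1) * xc p.
Proof. det_by (1:R) (0:R) (0:R) (1:R) (0:R) (0:R) (0:R) (1:R) (0:R) (0:R) (0:R) (0:R). Qed.
Lemma det_nf7b p : detD nf7b p = 2 * xc p ^+ 2.
Proof. det_by (1:R) (0:R) (0:R) (0:R) (0:R) (0:R) (0:R) (1:R) (0:R) (0:R) (0:R) (0:R). Qed.
Lemma det_nf8a p : detD nf8a p = yc p.
Proof. det_by (0:R) (1:R) (0:R) (0:R) (0:R) (0:R) (0:R) (0:R) (0:R) (0:R) (1:R) (0:R). Qed.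
Lemma det_nf8b p : detD nf8b p = 2 * xc p.
Proof. det_by (1:R) (0:R) (0:R) (0:R) (0:R) (0:R) (0:R) (0:R) (0:R) (0:R) (1:R) (0:R). Qed.
Lemma det_nf8c p : detD nf8c p = 2 * xc p.
Proof. det_by (1:R) (0:R) (-1:R) (0:R) (0:R) (0:R) (0:R) (0:R) (0:R) (0:R) (1:R) (0:R). Qed.
Lemma det_nf8c' p : detD nf8c' p = 2 * xc p.
Proof. det_by (1:R) (0:R) (1:R) (0:R) (0:R) (0:R) (0:R) (0:R) (0:R) (0:R) (1:R) (0:R). Qed.
Lemma det_nf9c p : detD nf9c p = 0.
Proof. det_by (1:R) (0:R) (0:R) (0:R) (0:R) (0:R) (0:R) (0:R) (0:R) (1:R) (0:R) (0:R). Qed.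
Lemma det_nf9a p : detD nf9a p = 0.
Proof. det_by (1:R) (0:R) (-1:R) (0:R) (0:R) (0:R) (0:R) (0:R) (0:R) (0:R) (0:R) (0:R). Qed.
Lemma det_nf9a' p : detD nf9a' p = 0.
Proof. det_by (1:R) (0:R) (0:R) (0:R) (1:R) (0:R) (0:R) (0:R) (0:R) (0:R) (0:R) (0:R). Qed.
Lemma det_nf9b p : detD nf9b p = 0.
Proof. det_by (1:R) (0:R) (1:R) (0:R) (0:R) (0:R) (0:R) (0:R) (0:R) (0:R) (0:R) (0:R). Qed.
Lemma det_nf9b' p : detD nf9b' p = 0.
Proof. det_by (1:R) (0:R) (0:R) (0:R) (0:R) (0:R) (0:R) (0:R) (0:R) (0:R) (0:R) (0:R). Qed.

Lemma pt_line (a b c d : R) C : (c != 0) || (d != 0) ->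
  (forall p, C p <-> exists t, p = pt (a + t * c) (b + t * d)) -> is_line C.
Proof.
move=> cd CE; exists (pt a b), (pt c d); split; first by rewrite pt_neq0.
apply: set_eqP => p; rewrite CE; split=> [[t ->]|[t _ <-]]; exists t => //;
  by apply: plane_eq; rewrite !coordE.
Qed.

Lemma pt_ray (a b c d : R) C : (c != 0) || (d != 0) ->
  (forall p, C p <-> exists2 t, 0 <= t & p = pt (a + t * c) (b + t * d)) ->
  is_ray (pt a b) C.
Proof.
move=> cd CE; exists (pt c d); split; first by rewrite pt_neq0.
apply: set_eqP => p; rewrite CE; split=> [[t t0 ->]|[t t0 <-]]; exists t => //;
  by apply: plane_eq; rewrite !coordE.
Qed.

Lemma J1P (Q : plane R -> plane R) q : J1 Q q <-> exists2 p, detD Q p = 0 & Q p = q.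
Proof. by []. Qed.

Lemma J0_setT (Q : plane R -> plane R) : (forall p, detD Q p = 0) -> J0 Q = setT.
Proof. by move=> H; apply: set_eqP => p; split=> // _; exact: H. Qed.

Lemma nonconstant_affine_coord (l : plane R -> R) (a b c : R) :
  (a != 0) || (b != 0) -> (forall p, l p = a * xc p + b * yc p + c) ->
  nonconstant_affine l.
Proof. by move=> ab lE; exists a, b, c. Qed.

Lemma type_nf1 : has_type nf1 T1.
Proof.
have e : J0 nf1 = set0.
  by apply/seteqP; split=> // p; rewrite /J0 /= det_nf1 => /eqP; rewrite oppr_eq0 oner_eq0.
by rewrite /has_type /J1 e image_set0.
Qed.

Lemma type_nf2 : has_type nf2 T2.
Proof.
have e : J0 nf2 = [set pt 0 0].
  apply: set_eqP => p; rewrite /J0 /= det_nf2; split=> [/eqP|->]; last first.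
    by rewrite !coordE; ring.
  rewrite mulf_eq0 pnatr_eq0 /= paddr_eq0 ?sqr_ge0 // !sqrf_eq0 => /andP[/eqP x0 /eqP y0].
  by rewrite -(pt_eta p) x0 y0.
rewrite /has_type /J1 e image_set1; split; first by exists (pt 0 0).
by exists (nf2 (pt 0 0)).
Qed.

Lemma crossing_axes : intersecting_lines [set p : plane R | 4 * (xc p * yc p) = 0].
Proof.
exists [set p | yc p = 0], [set p | xc p = 0]; split.
- apply: (@pt_line 0 0 1 0); rewrite ?oner_neq0 // => p; split=> /=.
    by move=> e; exists (xc p); apply: plane_eq; rewrite !coordE ?e; ring.
  by move=> [t ->]; rewrite !coordE; ring.
- apply: (@pt_line 0 0 0 1); rewrite ?oner_neq0 ?orbT // => p; split=> /=.
    by move=> e; exists (yc p); apply: plane_eq; rewrite !coordE ?e; ring.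
  by move=> [t ->]; rewrite !coordE; ring.
- move=> e; have : [set p : plane R | yc p = 0] (pt 1 0) by rewrite /= !coordE.
  by rewrite e /= !coordE => /eqP; rewrite oner_eq0.
- by exists (pt 0 0); split; rewrite /= !coordE.
- apply: set_eqP => p; split=> [/= /eqP|].
    by rewrite !mulf_eq0 pnatr_eq0 /= => /orP[]/eqP; [right|left].
  by case=> /= ->; ring.
Qed.

Lemma axes_eq0 (x y : R) : 4 * (x * y) = 0 -> x = 0 \/ y = 0.
Proof. by move/eqP; rewrite !mulf_eq0 pnatr_eq0 /= => /orP[]/eqP; [left|right]. Qed.

Lemma type_nf5a : has_type nf5a T5a.
Proof.
split; first by rewrite /J0 (funext det_nf5a); exact: crossing_axes.
exists (pt 0 0), [set p | 0 <= xc p /\ yc p = 0], [set p | xc p = 0 /\ 0 <= yc p].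
split.
- apply: (@pt_ray 0 0 1 0); rewrite ?oner_neq0 // => p; split=> /=.
    by move=> [x0 y0]; exists (xc p) => //; apply: plane_eq; rewrite !coordE ?y0; ring.
  by move=> [t t0 ->]; rewrite !coordE; split; [lra|ring].
- apply: (@pt_ray 0 0 0 1); rewrite ?oner_neq0 ?orbT // => p; split=> /=.
    by move=> [x0 y0]; exists (yc p) => //; apply: plane_eq; rewrite !coordE ?x0; ring.
  by move=> [t t0 ->]; rewrite !coordE; split; [ring|lra].
- move=> e; have : [set p : plane R | 0 <= xc p /\ yc p = 0] (pt 1 0).
    by rewrite /= !coordE ler01.
  by rewrite e /= !coordE => -[/eqP]; rewrite oner_eq0.
- apply: set_eqP => q; rewrite J1P; split=> [[p]|].
    rewrite det_nf5a => /axes_eq0[] e <-; rewrite /nf5a /polymap e /= !coordE.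
      by right; rewrite sqr_ge0 expr0n.
    by left; rewrite sqr_ge0 expr0n.
  case=> /= -[h1 h2].
    exists (pt (Num.sqrt (xc q)) 0); first by rewrite det_nf5a !coordE; ring.
    by apply: plane_eq; rewrite /nf5a /polymap !coordE ?sqr_sqrtr // h2; ring.
  exists (pt 0 (Num.sqrt (yc q))); first by rewrite det_nf5a !coordE; ring.
  by apply: plane_eq; rewrite /nf5a /polymap !coordE ?sqr_sqrtr // h1; ring.
Qed.

(** The axis y = 0 folds onto the ray, while x = 0 is mapped to (y, y^2). *)
Lemma type_nf5b : has_type nf5b T5b.
Proof.
split; first by rewrite /J0 (funext det_nf5b); exact: crossing_axes.
exists (pt 0 0), [set p | 0 <= xc p /\ yc p = 0], parabola; split.
- apply: (@pt_ray 0 0 1 0); rewrite ?oner_neq0 // => p; split=> /=.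
    by move=> [x0 y0]; exists (xc p) => //; apply: plane_eq; rewrite !coordE ?y0; ring.
  by move=> [t t0 ->]; rewrite !coordE; split; [lra|ring].
- exists id; split=> //; first exact: affine_id.
  by rewrite image_id.
- apply: set_eqP => q; rewrite J1P; split=> [[p]|].
    rewrite det_nf5b => /axes_eq0[] e <-; rewrite /nf5b /polymap /parabola e /= !coordE.
      by right; rewrite expr0n add0r.
    by left; rewrite addr0 sqr_ge0 expr0n.
  case=> /=; rewrite /parabola /= => h1.
    exists (pt (Num.sqrt (xc q)) 0); first by rewrite det_nf5b !coordE; ring.
    by case: h1 => h1 h2; apply: plane_eq; rewrite /nf5b /polymap !coordE ?sqr_sqrtr // ?h2; ring.
  exists (pt 0 (xc q)); first by rewrite det_nf5b !coordE; ring.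
  by apply: plane_eq; rewrite /nf5b /polymap !coordE ?h1; ring.
Qed.

Lemma type_nf7a : has_type nf7a T7a.
Proof.
exists [set p | xc p = - 2^-1], [set p | xc p = 0], [set p | xc p = - 4^-1], (pt 0 0).
have ln (a : R) : is_line [set p : plane R | xc p = a].
  apply: (@pt_line a 0 0 1); rewrite ?oner_neq0 ?orbT // => p; split=> /=.
    by move=> e; exists (yc p); apply: plane_eq; rewrite !coordE ?e; ring.
  by move=> [t ->]; rewrite !coordE; ring.
have J : J0 nf7a = [set p | xc p = - 2^-1] `|` [set p | xc p = 0].
  apply: set_eqP => p; rewrite /J0 /= det_nf7a; split=> [/eqP|[] /= ->]; try by field.
  by rewrite mulf_eq0 => /orP[]/eqP; [left|right] => /=; lra.
have L1 : nf7a @` [set p | xc p = - 2^-1] = [set p | xc p = - 4^-1].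
  apply: set_eqP => q; split=> [[p /= e <-]|/= e].
    by rewrite /nf7a /polymap !coordE e; field.
  exists (pt (- 2^-1) (- 2 * yc q)); rewrite /= ?coordE //.
  by apply: plane_eq; rewrite /nf7a /polymap !coordE ?e; field.
have L2 : nf7a @` [set p | xc p = 0] = [set pt 0 0].
  apply: set_eqP => q; split=> [[p /= e <-]|/= ->].
    by apply: plane_eq; rewrite /nf7a /polymap !coordE e; ring.
  by exists (pt 0 0); rewrite /= ?coordE //; apply: plane_eq; rewrite /nf7a /polymap !coordE; ring.
split=> //.
  split=> //; apply/seteqP; split=> // p [/= -> ] /eqP.
  by rewrite oppr_eq0 invr_eq0 pnatr_eq0.
by rewrite /J1 J image_setU L1 L2.
Qed.

Lemma type_nf7b : has_type nf7b T7b.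
Proof.
split; last first.
  exists 2, (@xc R); rewrite pnatr_eq0; split=> //; last exact: det_nf7b.
  by apply: (@nonconstant_affine_coord _ 1 0 0); rewrite ?oner_neq0 // => p; ring.
exists (pt 0 0); apply: set_eqP => q; rewrite J1P; split=> [[p]|/= ->].
  rewrite det_nf7b => /eqP; rewrite mulf_eq0 pnatr_eq0 sqrf_eq0 /= => /eqP e <-.
  by apply: plane_eq; rewrite /nf7b /polymap !coordE e; ring.
exists (pt 0 0); first by rewrite det_nf7b !coordE; ring.
by apply: plane_eq; rewrite /nf7b /polymap !coordE; ring.
Qed.

Lemma double_eq0 (x : R) : 2 * x = 0 -> x = 0. Proof. lra. Qed.

Lemma nonconstant_double : nonconstant_affine (fun p : plane R => 2 * xc p).
Proof.
by apply: (@nonconstant_affine_coord _ 2 0 0); rewrite ?pnatr_eq0 // => p; ring.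
Qed.

Lemma type_nf8a : has_type nf8a T8a.
Proof.
split.
  by apply: (@nonconstant_affine_coord _ 0 1 0); rewrite ?oner_neq0 ?orbT // => p; rewrite det_nf8a; ring.
exists (pt 0 0); apply: set_eqP => q; rewrite J1P; split=> [[p]|/= ->].
  by rewrite det_nf8a => e <-; apply: plane_eq; rewrite /nf8a /polymap !coordE ?e; ring.
exists (pt 0 0); first by rewrite det_nf8a !coordE.
by apply: plane_eq; rewrite /nf8a /polymap !coordE; ring.
Qed.

Lemma type_nf8b : has_type nf8b T8b.
Proof.
split; first by rewrite (funext det_nf8b); exact: nonconstant_double.
apply: (@pt_line 0 0 0 1); rewrite ?oner_neq0 ?orbT // => q; rewrite J1P; split.
  move=> [p]; rewrite det_nf8b => /double_eq0 e <-; exists (yc p).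
  by apply: plane_eq; rewrite /nf8b /polymap !coordE ?e; ring.
move=> [t ->]; exists (pt 0 t); first by rewrite det_nf8b !coordE; ring.
by apply: plane_eq; rewrite /nf8b /polymap !coordE; ring.
Qed.

Lemma sideways_parabola (s : R) C : s != 0 ->
  (forall q, C q <-> exists t, q = pt (s * t ^+ 2) t) -> is_parabola C.
Proof.
move=> s0 CE; pose h := fun p : plane R => pt (0 * xc p + s * yc p + 0) (1 * xc p + 0 * yc p + 0).
exists (h (pt 0 0)), h; split=> //.
  by apply: affine_intro; rewrite mulr0 mulr1 sub0r oppr_eq0.
apply: set_eqP => q; rewrite CE; split=> [[t ->]|[p /= e <-]].
  exists (pt t (t ^+ 2)); rewrite /= ?coordE //.
  by apply: plane_eq; rewrite /h !coordE; ring.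
by exists (xc p); apply: plane_eq; rewrite /h !coordE ?e; ring.
Qed.

Lemma type_nf8c : has_type nf8c T8c.
Proof.
split; first by rewrite (funext det_nf8c); exact: nonconstant_double.
apply: (@sideways_parabola (-1)); first by rewrite oppr_eq0 oner_eq0.
move=> q; rewrite J1P; split.
  move=> [p]; rewrite det_nf8c => /double_eq0 e <-; exists (yc p).
  by apply: plane_eq; rewrite /nf8c /polymap !coordE ?e; ring.
move=> [t ->]; exists (pt 0 t); first by rewrite det_nf8c !coordE; ring.
by apply: plane_eq; rewrite /nf8c /polymap !coordE; ring.
Qed.

Lemma type_nf8c' : has_type nf8c' T8c.
Proof.
split; first by rewrite (funext det_nf8c'); exact: nonconstant_double.
apply: (@sideways_parabola 1); first by rewrite oner_eq0.
move=> q; rewrite J1P; split.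
  move=> [p]; rewrite det_nf8c' => /double_eq0 e <-; exists (yc p).
  by apply: plane_eq; rewrite /nf8c' /polymap !coordE ?e; ring.
move=> [t ->]; exists (pt 0 t); first by rewrite det_nf8c' !coordE; ring.
by apply: plane_eq; rewrite /nf8c' /polymap !coordE; ring.
Qed.

Lemma type_nf9c : has_type nf9c T9c.
Proof.
split; first exact/J0_setT/det_nf9c.
apply: (@sideways_parabola 1); first by rewrite oner_eq0.
move=> q; rewrite J1P; split.
  move=> [p _ <-]; exists (xc p).
  by apply: plane_eq; rewrite /nf9c /polymap !coordE; ring.
move=> [t ->]; exists (pt t 0); first exact: det_nf9c.
by apply: plane_eq; rewrite /nf9c /polymap !coordE; ring.
Qed.

Lemma type_nf9a : has_type nf9a T9a.
Proof.
split; first exact/J0_setT/det_nf9a.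
apply: (@pt_line 0 0 1 0); rewrite ?oner_neq0 // => q; rewrite J1P; split.
  move=> [p _ <-]; exists (xc p ^+ 2 - yc p ^+ 2).
  by apply: plane_eq; rewrite /nf9a /polymap !coordE; ring.
(* The squares of (t + 1) / 2 and (t - 1) / 2 differ by t. *)
move=> [t ->]; exists (pt ((t + 1) / 2) ((t - 1) / 2)); first exact: det_nf9a.
by apply: plane_eq; rewrite /nf9a /polymap !coordE; field.
Qed.

Lemma type_nf9a' : has_type nf9a' T9a.
Proof.
split; first exact/J0_setT/det_nf9a'.
apply: (@pt_line 0 0 1 0); rewrite ?oner_neq0 // => q; rewrite J1P; split.
  move=> [p _ <-]; exists (xc p ^+ 2 + yc p).
  by apply: plane_eq; rewrite /nf9a' /polymap !coordE; ring.
move=> [t ->]; exists (pt 0 t); first exact: det_nf9a'.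
by apply: plane_eq; rewrite /nf9a' /polymap !coordE; ring.
Qed.

Lemma type_nf9b : has_type nf9b T9b.
Proof.
split; first exact/J0_setT/det_nf9b.
exists (pt 0 0); apply: (@pt_ray 0 0 1 0); rewrite ?oner_neq0 // => q; rewrite J1P; split.
  move=> [p _ <-]; exists (xc p ^+ 2 + yc p ^+ 2); first by rewrite addr_ge0 ?sqr_ge0.
  by apply: plane_eq; rewrite /nf9b /polymap !coordE; ring.
move=> [t t0 ->]; exists (pt (Num.sqrt t) 0); first exact: det_nf9b.
by apply: plane_eq; rewrite /nf9b /polymap !coordE ?sqr_sqrtr //; ring.
Qed.

Lemma type_nf9b' : has_type nf9b' T9b.
Proof.
split; first exact/J0_setT/det_nf9b'.
exists (pt 0 0); apply: (@pt_ray 0 0 1 0); rewrite ?oner_neq0 // => q; rewrite J1P; split.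
  move=> [p _ <-]; exists (xc p ^+ 2); first by rewrite sqr_ge0.
  by apply: plane_eq; rewrite /nf9b' /polymap !coordE; ring.
move=> [t t0 ->]; exists (pt (Num.sqrt t) 0); first exact: det_nf9b'.
by apply: plane_eq; rewrite /nf9b' /polymap !coordE ?sqr_sqrtr //; ring.
Qed.

End NormalForms.

Lemma card_enum (T : Type) n (F : nat -> T) (A : set T) :
  (forall i j, (i < n)%N -> (j < n)%N -> F i = F j -> i = j) ->
  A = F @` `I_n -> A #= `I_n.
Proof.
move=> inj ->; apply: inj_card_eq => i j; rewrite !inE /= => i_n j_n.
exact: inj.
Qed.

(** * Counting cusps through a chart onto the cuspidal cubic *)

Section CuspCharts.
Context {R : realType}.
Implicit Types (p q v : plane R) (U V C : set (plane R)).
Implicit Types (psi chi : plane R -> plane R).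

Lemma locally_like_mem M C p : M (pt 0 0) -> locally_like M C p -> C p.
Proof.
by move=> M0 /locally_likeP[U [V [psi [chi [_ Up p0 E]]]]]; apply/E => //; rewrite p0.
Qed.

Lemma cuspidal0 : cuspidal (pt 0 0 : plane R).
Proof. by exists 0 => //; rewrite !expr0n. Qed.

Lemma cusp_point_mem C p : cusp_point C p -> C p.
Proof. exact: locally_like_mem cuspidal0. Qed.

(** One chart decides the nature of every point of [C] in [U], by transport from the model. *)
Lemma cusp_chart C U V psi chi p0 : diffeo U V psi chi -> U p0 -> psi p0 = pt 0 0 ->
  (forall q, U q -> (C q <-> cuspidal (psi q))) ->
  cusp_point C p0 /\ (forall p, U p -> C p -> p <> p0 -> smooth_point C p).
Proof.
move=> D Up0 e0 E; split.
  by apply: (locally_like_diffeo D Up0 E); rewrite e0; exact: cuspidal_cusp.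
move=> p Up Cp pp0; apply: (locally_like_diffeo D Up E); apply: cuspidal_smooth.
  exact/E.
case: (D) => _ _ _ _ [UV _]; have [_ ep] := UV p Up; have [_ ep0] := UV p0 Up0.
by rewrite -e0 => e; apply: pp0; rewrite -ep e ep0.
Qed.

Lemma smooth_except_one C U V psi chi p0 : diffeo U V psi chi -> U p0 ->
  psi p0 = pt 0 0 -> (forall q, U q -> (C q <-> cuspidal (psi q))) -> C `<=` U ->
  smooth_except_cusps 1 C.
Proof.
move=> D Up0 e0 E CU; have [c0 s0] := cusp_chart D Up0 e0 E.
have cE : [set p | cusp_point C p] = [set p0].
  apply: set_eqP => p; split=> /= [cp|-> //].
  apply: contrapT => pp0; have Cp := cusp_point_mem cp.
  exact: smooth_not_cusp (s0 p (CU p Cp) Cp pp0) cp.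
split.
  apply: (@card_enum _ 1 (fun=> p0)); first by case=> [|//] [].
  by rewrite cE II1 image_set1.
move=> p Cp np; apply: s0 => //; first exact: CU.
by move=> e; apply: np; rewrite e.
Qed.

End CuspCharts.

Section TypeT6.
Context {R : realType}.

Lemma type_nf6 : has_type (@nf6 R) T6.
Proof.
have J0E : J0 (@nf6 R) = [set p | yc p = 2 * xc p ^+ 2].
  by apply: set_eqP => p; rewrite /J0 /= det_nf6; split; lra.
have J1E : J1 (@nf6 R) = cuspidal.
  apply: set_eqP => q; rewrite /J1 J0E; split=> [[p /= e <-]|[t _ <-]].
    by exists (xc p) => //; apply: plane_eq; rewrite /nf6 /polymap !coordE e; field.
  exists (pt t (2 * t ^+ 2)); rewrite /= ?coordE //.
  by apply: plane_eq; rewrite /nf6 /polymap !coordE; field.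
have oT : open [set: plane R] by exact: openT.
rewrite /has_type J0E J1E; split.
- pose h := fun p : plane R => pt (1 * xc p + 0 * yc p + 0) (0 * xc p + 2 * yc p + 0).
  exists (h (pt 0 0)), h; split=> //.
    by apply: affine_intro; rewrite mul1r mulr0 subr0 pnatr_eq0.
  apply: set_eqP => q; split=> [/= e|[p /= e <-]]; last by rewrite /h !coordE e; ring.
  exists (pt (xc q) (xc q ^+ 2)); rewrite /= ?coordE //.
  by apply: plane_eq; rewrite /h !coordE ?e; ring.
- exists (fun t => pt (t ^+ 2) (t ^+ 3)).
    move=> t; apply: plane_cont.
      under [X in {for _, continuous X}]funext do rewrite xc_pt.
      exact: exprn_continuous.
    under [X in {for _, continuous X}]funext do rewrite yc_pt.
    exact: exprn_continuous.
  by [].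
- apply: (@smooth_except_one _ _ setT setT id id (pt 0 0)) => //.
  by apply: affine_diffeo => //; exact: affine_id.
Qed.

End TypeT6.

(** * The hyperbola: one cuspidal and one smooth image *)

Section TypeT4.
Context {R : realType}.
Implicit Types (p q v : plane R).

Lemma nf4_quad : quadratic_map (@nf4 R).
Proof.
apply/quadratic_mapP; exists (fun x y => x ^+ 2 + y ^+ 2 + 2 * x),
  (fun x y => 2 * x * y - 2 * y), 1, 0, 1, 2, 0, 0, 0, 2, 0, 0, (-2), 0.
split=> //; first by rewrite oner_neq0.
  by move=> x y; rewrite /qf; ring.
by move=> x y; rewrite /qf; ring.
Qed.

Definition right_branch : set (plane R) := [set p | xc p ^+ 2 - yc p ^+ 2 = 1 /\ 0 < xc p].
Definition left_branch : set (plane R) := [set p | xc p ^+ 2 - yc p ^+ 2 = 1 /\ xc p < 0].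

Lemma branch_abs (x y : R) : x ^+ 2 - y ^+ 2 = 1 -> 0 < x -> 1 <= x.
Proof.
move=> e x0; rewrite -(@ler_pXn2r _ 2) ?nnegrE ?(ltW x0) // expr1n.
have := sqr_ge0 y; lra.
Qed.

Lemma sqrt_sq (x y : R) : 0 <= y -> x = y ^+ 2 -> Num.sqrt x = y.
Proof. by move=> y0 ->; rewrite sqrtr_sqr ger0_norm. Qed.

Lemma cubic_ge0 (x y : R) : y ^+ 2 = x ^+ 3 -> 0 <= x.
Proof.
move=> e; rewrite leNgt; apply/negP => x0.
have : x ^+ 3 < 0 by rewrite exprSr nmulr_llt0 // exprn_even_gt0 //= lt_eqF.
by rewrite -e ltNge sqr_ge0.
Qed.

Lemma sqr0 (y : R) : y ^+ 2 = 0 -> y = 0.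
Proof. by move/eqP; rewrite sqrf_eq0 => /eqP. Qed.

(** On both branches 3 + 2 S is a perfect square in the parameter; [U] is where its square root is
    smooth. *)
Let U : set (plane R) := [set q | 0 < 3 + 2 * xc q].
Let V : set (plane R) := [set q | 0 < 2 * xc q + 3].

Let oU : open U.
Proof.
apply: (open_scalar (f := fun q => 3 + 2 * xc q) (A := [set t | 0 < t])); last exact: open_gt.
have oT : open [set: plane R] by exact: openT.
by apply: Cs_continuous; smooth_tac.
Qed.

Let oV : open V.
Proof.
apply: (open_scalar (f := fun q => 2 * xc q + 3) (A := [set t | 0 < t])); last exact: open_gt.
have oT : open [set: plane R] by exact: openT.
by apply: Cs_continuous; smooth_tac.
Qed.

(* The right branch is c = v + 1, s^2 = v (v + 2) with v >= 0; its image has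
   coordinates S = 2 v^2 + 6 v + 3 and D = 2 s v, so that D^2 = 4 v^3 (v + 2). *)
Lemma right_branch_cusp : smooth_except_cusps 1 (@nf4 R @` right_branch).
Proof.
(* Since 3 + 2 S = (2 v + 3)^2, this is v + 2, and (D / (2 sqrt w))^2 = v^3. *)
pose w (q : plane R) := (Num.sqrt (3 + 2 * xc q) + 1) / 2.
pose psi (q : plane R) := pt (w q - 2) (yc q / (2 * Num.sqrt (w q))).
pose chi (q : plane R) := pt (2 * xc q ^+ 2 + 6 * xc q + 3) (2 * yc q * Num.sqrt (xc q + 2)).
have w0 q : 0 < w q by rewrite divr_gt0 // ltr_wpDl // sqrtr_ge0.
have sw0 q : Num.sqrt (w q) != 0 by rewrite gt_eqF // sqrtr_gt0.
have wS q : U q -> xc q = 2 * (w q - 2) ^+ 2 + 6 * (w q - 2) + 3.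
  rewrite /U /= => Uq; have := sqr_sqrtr (ltW Uq).
  rewrite /w; move: (Num.sqrt _) => r e; have -> : xc q = (r ^+ 2 - 3) / 2 by lra.
  by field.
have D : diffeo U V psi chi.
  split=> //.
  - apply: smooth_pt => // n; rewrite /w; smooth_tac => p.
    + by [].
    + by move=> _; rewrite mulf_neq0 ?pnatr_eq0 // sw0.
    + by move=> _; exact: w0.
    + by [].
  - apply: smooth_pt => // n; smooth_tac => p; rewrite /V /=; lra.
  - split=> q Uq.
      have r0 : 0 < Num.sqrt (3 + 2 * xc q) by rewrite sqrtr_gt0.
      split; first by rewrite /V /psi /w /= !coordE; lra.
      apply: plane_eq; rewrite /psi /chi !coordE -?wS // subrK.
      by field; rewrite sw0.
    have wc : w (chi q) = xc q + 2.
      rewrite /w /chi !coordE (@sqrt_sq _ (2 * xc q + 3)); first by field.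
        exact: ltW.
      ring.
    split; last first.
      apply: plane_eq; rewrite /psi ?coordE ?wc ?addrK // /chi ?coordE.
      field; rewrite gt_eqF // sqrtr_gt0; move: Uq; rewrite /V /=; lra.
    rewrite /U /chi /= !coordE.
    have -> : 3 + 2 * (2 * xc q ^+ 2 + 6 * xc q + 3) = (2 * xc q + 3) ^+ 2 by ring.
    by rewrite exprn_gt0.
have RU : @nf4 R @` right_branch `<=` U.
  move=> _ [p [pe p0] <-]; rewrite /U /nf4 /polymap /= !coordE.
  have := branch_abs pe p0; move: pe; move: (xc p) (yc p) => x y; nra.
have wQ p : right_branch p -> w (nf4 p) = xc p + 1.
  move=> [pe p0]; rewrite /w /nf4 /polymap !coordE (@sqrt_sq _ (2 * xc p + 1)).
  - by field.
  - by move: p0; lra.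
  - by have -> : yc p ^+ 2 = xc p ^+ 2 - 1 by [lra]; ring.
apply: (@smooth_except_one _ _ U V psi chi (pt 3 0)) => //.
- by rewrite /U /= !coordE; lra.
- rewrite /psi /w !coordE (@sqrt_sq _ 3); [|lra|ring].
  by congr pt; [field|rewrite mul0r].
- move=> q Uq; rewrite cuspidalE /psi !coordE; split.
    move=> [p Bp pq]; have [pe p0] := Bp.
    have W0 : 0 <= xc p + 1 by lra.
    rewrite -pq (wQ p Bp) expr_div_n exprMn sqr_sqrtr // /nf4 /polymap !coordE.
    have -> : (2 * xc p * yc p - 2 * yc p) ^+ 2 = 4 * yc p ^+ 2 * (xc p - 1) ^+ 2 by ring.
    have -> : yc p ^+ 2 = xc p ^+ 2 - 1 by lra.
    by field; rewrite gt_eqF //; lra.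
  have wq := w0 q; have sq2 := sqr_sqrtr (ltW wq).
  rewrite expr_div_n exprMn sq2 => e.
  have v0 : 0 <= w q - 2.
    apply: (@cubic_ge0 _ (yc q / (2 * Num.sqrt (w q)))).
    by rewrite expr_div_n exprMn sq2.
  have {}e : yc q ^+ 2 = 4 * w q * (w q - 2) ^+ 3.
    rewrite -e; field; exact: lt0r_neq0.
  have xS := wS q Uq; set t := w q in e v0 wq xS *.
  (* At v = 0 the formula s = D / (2 v) for the preimage breaks down; the preimage is then the
     vertex (1, 0). *)
  have [t2|t2] := eqVneq t 2.
    exists (pt 1 0); first by split; rewrite !coordE; [ring|lra].
    have y0 : yc q = 0 by apply: sqr0; rewrite e t2; ring.
    by apply: plane_eq; rewrite /nf4 /polymap !coordE ?xS ?y0 ?t2; ring.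
  have t2' : t - 2 != 0 by rewrite subr_eq0.
  exists (pt (t - 1) (yc q / (2 * (t - 2)))).
    split; rewrite !coordE; last lra.
    by rewrite expr_div_n e; field.
  apply: plane_eq; rewrite /nf4 /polymap !coordE.
    by rewrite expr_div_n e xS; field.
  by field.
Qed.

(* The left branch is c = - (w + 1), s^2 = w (w + 2) with w >= 0; its image has
   coordinates S = 2 w^2 + 2 w - 1 and D = - 2 s (w + 2), so that
   D^2 = 4 w (w + 2)^3. *)
Lemma left_branch_smooth p : (@nf4 R @` left_branch) p ->
  smooth_point (@nf4 R @` left_branch) p.
Proof.
(* As 3 + 2 S is here (2 w + 1)^2 in the parameter w above, the function [w] is that parameter plus
   2; dividing D by 2 (w + 2)^(3/2) gives [y], so that the curve is [w q - 2 = y q ^+ 2]. *)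
pose w (q : plane R) := (Num.sqrt (3 + 2 * xc q) + 3) / 2.
pose y (q : plane R) := yc q / (2 * w q * Num.sqrt (w q)).
have w0 q : 0 < w q by rewrite divr_gt0 // ltr_wpDl // sqrtr_ge0.
have sw0 q : Num.sqrt (w q) != 0 by rewrite gt_eqF // sqrtr_gt0.
have wS q : U q -> xc q = 2 * (w q - 2) ^+ 2 + 2 * (w q - 2) - 1.
  rewrite /U /= => Uq; have := sqr_sqrtr (ltW Uq).
  rewrite /w; move: (Num.sqrt _) => r e; have -> : xc q = (r ^+ 2 - 3) / 2 by lra.
  by field.
have LE q : U q -> (nf4 @` left_branch) q <-> w q - 2 = y q ^+ 2.
  move=> Uq; have -> : y q ^+ 2 = yc q ^+ 2 / (4 * w q ^+ 3).
    rewrite /y expr_div_n.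
    have -> : (2 * w q * Num.sqrt (w q)) ^+ 2 = 4 * w q ^+ 2 * Num.sqrt (w q) ^+ 2.
      by ring.
    by rewrite sqr_sqrtr ?(ltW (w0 q)) // -mulrA -exprSr.
  split.
    move=> [r [re r0] rq].
    have wr : w q = 1 - xc r.
      rewrite -rq /w /nf4 /polymap !coordE (@sqrt_sq _ (- (2 * xc r) - 1)).
      - by field.
      - have : 1 <= - xc r by apply: (@branch_abs _ (yc r)); [rewrite sqrrN|lra].
        lra.
      - by have -> : yc r ^+ 2 = xc r ^+ 2 - 1 by [lra]; ring.
    have -> : yc q ^+ 2 = 4 * yc r ^+ 2 * (1 - xc r) ^+ 2.
      by rewrite -rq /nf4 /polymap !coordE; ring.
    have -> : yc r ^+ 2 = xc r ^+ 2 - 1 by lra.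
    by rewrite wr; field; rewrite gt_eqF //; lra.
  move=> e; have wq := w0 q; have xS := wS q Uq; set t := w q in e wq xS *.
  have t0 : t != 0 by rewrite gt_eqF.
  have {}e : yc q ^+ 2 = 4 * t ^+ 3 * (t - 2) by rewrite e; field.
  have t2 : 0 <= t - 2.
    have : 0 <= 4 * t ^+ 3 * (t - 2) by rewrite -e sqr_ge0.
    by rewrite pmulr_rge0 // mulr_gt0 // exprn_gt0.
  exists (pt (1 - t) (- yc q / (2 * t))).
    split; rewrite !coordE; last by lra.
    by rewrite expr_div_n sqrrN e; field.
  apply: plane_eq; rewrite /nf4 /polymap !coordE.
    by rewrite expr_div_n sqrrN e xS; field.
  by field.
have LU : @nf4 R @` left_branch `<=` U.
  move=> _ [r [re r0] <-]; rewrite /U /nf4 /polymap /= !coordE.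
  have : 1 <= - xc r by apply: (@branch_abs _ (yc r)); [rewrite sqrrN|lra].
  move: re; move: (xc r) (yc r) => a b; nra.
move=> Cp; apply/(locally_likeP xaxis).
(* The chart is recentred at [p], and its second coordinate is the equation of the curve; [W]
   recovers [w - 2] from the new coordinates. *)
pose a := y p.
pose W (q : plane R) := yc q + (xc q + a) ^+ 2.
pose V' : set (plane R) := [set q | 0 < 2 * W q + 1].
have oV' : open V'.
  apply: (open_scalar (f := fun q => 2 * W q + 1) (A := [set t | 0 < t])); last exact: open_gt.
  have oT : open [set: plane R] by exact: openT.
  by apply: Cs_continuous; smooth_tac.
pose psi (q : plane R) := pt (y q - a) (w q - 2 - y q ^+ 2).
pose chi (q : plane R) := pt (2 * W q ^+ 2 + 2 * W q - 1)
  (2 * (xc q + a) * (W q + 2) * Num.sqrt (W q + 2)).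
exists U, V', psi, chi; split.
- split=> //.
  + apply: smooth_pt => // n; rewrite /y /w; smooth_tac => q Uq //; try exact: w0;
      by rewrite !mulf_neq0 ?pnatr_eq0 // gt_eqF // w0.
  + apply: smooth_pt => // n; rewrite /W; smooth_tac => q; rewrite /V' /W /=; lra.
  + split=> q Uq.
      have Wp : W (psi q) = w q - 2 by rewrite /W /psi !coordE subrK subrK.
      have r0 : 0 < Num.sqrt (3 + 2 * xc q) by rewrite sqrtr_gt0.
      split; first by rewrite /V' /= Wp /w; lra.
      apply: plane_eq; rewrite /chi !coordE Wp -?wS // ?subrK /y.
      by field; rewrite sw0 gt_eqF.
    have W2 : 0 < W q + 2 by move: Uq; rewrite /V' /=; lra.
    have wc : w (chi q) = W q + 2.
      rewrite /w /chi !coordE (@sqrt_sq _ (2 * W q + 1)); first by field.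
        exact: ltW.
      ring.
    have yc' : y (chi q) = xc q + a.
      rewrite /y wc /chi !coordE; field.
      by rewrite !gt_eqF // sqrtr_gt0.
    split; last first.
      by apply: plane_eq; rewrite /psi !coordE ?wc yc' ?addrK // /W addrK.
    rewrite /U /chi /= !coordE.
    have -> : 3 + 2 * (2 * W q ^+ 2 + 2 * W q - 1) = (2 * W q + 1) ^+ 2 by ring.
    by rewrite exprn_gt0.
- exact: LU.
- have /(LE p (LU p Cp)) e := Cp.
  by rewrite /psi /a subrr e subrr.
- move=> q Uq; rewrite LE // xaxisE /psi yc_pt; split=> [->|/eqP].
    by rewrite subrr.
  by rewrite subr_eq0 => /eqP.
Qed.

(** The branch of sign [s] is (s cosh t, s sinh t). Conversely s (x + y) and s (x - y) have product
    1 and positive sum, so they are exp t and exp (- t). *)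
Lemma branch_param (s : R) : s ^+ 2 = 1 -> forall q,
  (exists t, q = pt (s * ((expR t + expR (- t)) / 2)) (s * ((expR t - expR (- t)) / 2)))
  <-> (xc q ^+ 2 - yc q ^+ 2 = 1 /\ 0 < s * xc q).
Proof.
move=> s2 q; split=> [[t ->]|[qe q0]].
  have tt : expR t * expR (- t) = 1 by rewrite -expRD subrr expR0.
  have := expR_gt0 t; have := expR_gt0 (- t); move: tt.
  rewrite !coordE; move: (expR t) (expR (- t)) => a b ab b0 a0; split.
    have -> : (s * ((a + b) / 2)) ^+ 2 - (s * ((a - b) / 2)) ^+ 2 = s ^+ 2 * (a * b) by field.
    by rewrite s2 ab mulr1.
  have -> : s * (s * ((a + b) / 2)) = s ^+ 2 * ((a + b) / 2) by ring.
  rewrite s2; lra.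
pose a := s * (xc q + yc q); pose b := s * (xc q - yc q).
have ab : a * b = 1.
  have -> : a * b = s ^+ 2 * (xc q ^+ 2 - yc q ^+ 2) by rewrite /a /b; ring.
  by rewrite s2 qe mulr1.
have a0 : 0 < a.
  have s0 : 0 < a + b by have -> : a + b = 2 * (s * xc q) by [rewrite /a /b; ring]; lra.
  rewrite ltNge; apply/negP => a0; have b0 : 0 < b by lra.
  have : a * b <= 0 by rewrite pmulr_lle0.
  by rewrite ab; lra.
exists (ln a); rewrite expRN lnK ?posrE //.
have -> : a^-1 = b by apply: (mulfI (lt0r_neq0 a0)); rewrite ab divff // gt_eqF.
apply: plane_eq; rewrite !coordE /a /b.
  have -> : s * ((s * (xc q + yc q) + s * (xc q - yc q)) / 2) = s ^+ 2 * xc q by field.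
  by rewrite s2 mul1r.
have -> : s * ((s * (xc q + yc q) - s * (xc q - yc q)) / 2) = s ^+ 2 * yc q by field.
by rewrite s2 mul1r.
Qed.

Lemma branch_curve (s : R) (C : set (plane R)) : s ^+ 2 = 1 ->
  (forall q, C q <-> (xc q ^+ 2 - yc q ^+ 2 = 1 /\ 0 < s * xc q)) ->
  is_curve (@nf4 R @` C).
Proof.
move=> s2 CE.
pose c t : plane R := pt (s * ((expR t + expR (- t)) / 2)) (s * ((expR t - expR (- t)) / 2)).
have cc : continuous c.
  have e1 : continuous (fun t : R => expR (- t)).
    by move=> t; apply: continuous_comp; [exact: oppr_continuous|exact: continuous_expR].
  have e2 := @continuous_expR R.
  move=> t; apply: plane_cont.
    have -> : (fun z => xc (c z)) = fun t => s * ((expR t + expR (- t)) / 2).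
      by apply/funext => z; rewrite xc_pt.
    apply: continuousM; first exact: cst_continuous.
    apply: continuousM; last exact: cst_continuous.
    by apply: continuousD; [exact: e2|exact: e1].
  have -> : (fun z => yc (c z)) = fun t => s * ((expR t - expR (- t)) / 2).
    by apply/funext => z; rewrite yc_pt.
  apply: continuousM; first exact: cst_continuous.
  apply: continuousM; last exact: cst_continuous.
  by apply: continuousB; [exact: e2|exact: e1].
exists (nf4 \o c).
  by move=> t; apply: continuous_comp; [exact: cc|exact: quadratic_continuous nf4_quad _].
apply: set_eqP => q; split=> [[p /CE/(branch_param s2)[t ->] <-]|[t _ <-]].
  by exists t.
by exists (c t) => //; apply/CE/(branch_param s2); exists t.
Qed.

Lemma type_nf4 : has_type (@nf4 R) T4.
Proof.
have JE : J0 (@nf4 R) = left_branch `|` right_branch.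
  apply: set_eqP => p; rewrite /J0 /= det_nf4; split=> [e|[] [e _]]; try by rewrite e; ring.
  have e' : xc p ^+ 2 - yc p ^+ 2 = 1 by lra.
  have : xc p != 0.
    by apply/eqP => x0; move: e'; rewrite x0; have := sqr_ge0 (yc p); lra.
  by rewrite neq_lt => /orP[] ?; [left|right].
(* The signs send the positive branch of x y = 1 to the left branch, since T4 lists the smooth image
   first. *)
pose h := fun p : plane R => pt (- 2^-1 * xc p + - 2^-1 * yc p + 0)
  (- 2^-1 * xc p + 2^-1 * yc p + 0).
have ah : affine_iso h.
  apply: affine_intro; have -> : - 2^-1 * 2^-1 - - 2^-1 * - 2^-1 = - 2^-1 :> R by field.
  by rewrite oppr_eq0 invr_eq0 pnatr_eq0.
have hP (P Q : plane R -> Prop) : (forall q, P (h q) <-> Q q) ->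
    [set p | P p] = h @` [set p | Q p].
  have [h' [_ hK h'K]] := affine_inv ah.
  move=> PQ; apply: set_eqP => p; split=> [Pp|[q Qq <-]]; last exact/PQ.
  by exists (h' p) => //; apply/PQ; rewrite h'K.
have hE q : xc (h q) ^+ 2 - yc (h q) ^+ 2 = xc q * yc q by rewrite /h !coordE; field.
(* On x y = 1 the sign of x is that of x + y, which [h] makes a coordinate. *)
have sg (a b : R) : a * b = 1 -> (0 < a) = (0 < a + b).
  move=> ab; apply/idP/idP => [a0|s0].
    have b0 : 0 < b by rewrite -(pmulr_rgt0 _ a0) ab ltr01.
    exact: addr_gt0.
  rewrite ltNge; apply/negP => a0; have b0 : 0 < b by lra.
  have : a * b <= 0 by rewrite pmulr_lle0.
  by rewrite ab; lra.
have sg' (a b : R) : a * b = 1 -> (a < 0) = (a + b < 0).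
  by move=> ab; have := sg (- a) (- b); rewrite mulrNN -opprD !oppr_gt0; apply.
exists left_branch, right_branch; split.
- exists h; split=> //.
    apply: hP => q; rewrite hE; split=> -[e]; split=> //.
      by rewrite (sg _ _ e); move: b; rewrite /h !coordE; lra.
    by move: b; rewrite (sg _ _ e) /h !coordE; lra.
  apply: hP => q; rewrite hE; split=> -[e]; split=> //.
    by rewrite (sg' _ _ e); move: b; rewrite /h !coordE; lra.
  by move: b; rewrite (sg' _ _ e) /h !coordE; lra.
- by rewrite /J1 JE image_setU.
- split; first (apply: (@branch_curve (-1)); first by ring).
    by move=> q; rewrite /left_branch /= mulN1r oppr_gt0.
  by apply: (@branch_curve 1); [ring|move=> q; rewrite mul1r].
- exact: left_branch_smooth.
- exact: right_branch_cusp.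
Qed.

End TypeT4.

(** * The ellipse and the deltoid *)

Section TypeT3.
Context {R : realType}.
Implicit Types (p q v : plane R).

Lemma nf3_quad : quadratic_map (@nf3 R).
Proof.
apply/quadratic_mapP; exists (fun x y => x ^+ 2 - y ^+ 2 + 2 * x),
  (fun x y => 2 * x * y - 2 * y), 1, 0, (-1), 2, 0, 0, 0, 2, 0, 0, (-2), 0.
split=> //; first by rewrite oner_neq0.
  by move=> x y; rewrite /qf; ring.
by move=> x y; rewrite /qf; ring.
Qed.

Definition deltoid : set (plane R) := @nf3 R @` @circle R.

Let U : set (plane R) := [set q | -1 < xc q].
Let V : set (plane R) := [set q | xc q < 1].

Let oU : open U.
Proof. by apply: (open_scalar (A := [set t | -1 < t])); [exact: xc_cont|exact: open_gt]. Qed.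

Let oV : open V.
Proof. by apply: (open_scalar (A := [set t | t < 1])); [exact: xc_cont|exact: open_lt]. Qed.

(* With v = 1 - c, s^2 = v (2 - v): the deltoid has coordinates
   S = 2 v^2 - 6 v + 3 and D = - 2 s v, so that D^2 = 4 v^3 (2 - v) where v < 1. *)
Lemma deltoid_chart : cusp_point deltoid (pt 3 0) /\
  forall p, U p -> deltoid p -> p <> pt 3 0 -> smooth_point deltoid p.
Proof.
(* Here 3 + 2 S = (3 - 2 v)^2 and v < 1 selects the positive root, so this is 2 - v. *)
pose w (q : plane R) := (Num.sqrt (3 + 2 * xc q) + 1) / 2.
pose psi (q : plane R) := pt (2 - w q) (yc q / (2 * Num.sqrt (w q))).
pose chi (q : plane R) := pt (2 * xc q ^+ 2 - 6 * xc q + 3) (2 * yc q * Num.sqrt (2 - xc q)).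
have w0 q : 0 < w q by rewrite divr_gt0 // ltr_wpDl // sqrtr_ge0.
have sw0 q : Num.sqrt (w q) != 0 by rewrite gt_eqF // sqrtr_gt0.
have U3 q : U q -> 1 < 3 + 2 * xc q by rewrite /U /=; lra.
have U0 q : U q -> 0 < 3 + 2 * xc q by move/U3; apply: lt_trans.
have wS q : U q -> xc q = 2 * (2 - w q) ^+ 2 - 6 * (2 - w q) + 3.
  move=> Uq; have := sqr_sqrtr (ltW (U0 q Uq)).
  rewrite /w; move: (Num.sqrt _) => r e; have -> : xc q = (r ^+ 2 - 3) / 2 by lra.
  by field.
have w1 q : U q -> 1 < w q.
  move=> /U3 h; have : Num.sqrt 1 < Num.sqrt (3 + 2 * xc q) by rewrite ltr_sqrt // (lt_trans ltr01).
  by rewrite sqrtr1 /w; lra.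
have D : diffeo U V psi chi.
  split=> //.
  - apply: smooth_pt => // n; rewrite /w; smooth_tac => p Up;
      first [by [] | exact: U0 | exact: w0 | by rewrite pnatr_eq0 |
        by rewrite mulf_neq0 ?pnatr_eq0 // sw0].
  - apply: smooth_pt => // n; smooth_tac => p; rewrite /V /=; lra.
  - split=> q Uq.
      split; first by have := w1 q Uq; rewrite /V /psi /= xc_pt; lra.
      have e : 2 - (2 - w q) = w q by ring.
      apply: plane_eq; rewrite /psi /chi !coordE -?wS // e.
      by field; rewrite sw0.
    have V1 : xc q < 1 by [].
    have wc : w (chi q) = 2 - xc q.
      rewrite /w /chi xc_pt (@sqrt_sq _ _ (3 - 2 * xc q)); [by field|by lra|ring].
    split; last first.
      apply: plane_eq; rewrite /psi ?xc_pt ?yc_pt wc; first by ring.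
      rewrite /chi ?yc_pt; field; rewrite gt_eqF // sqrtr_gt0; lra.
    rewrite /U /chi /= xc_pt; nra.
have wQ p : circle p -> 0 < xc p -> w (nf3 p) = xc p + 1.
  rewrite /circle /= => pe p0; rewrite /w /nf3 /polymap xc_pt (@sqrt_sq _ _ (2 * xc p + 1)).
  - by field.
  - by lra.
  - by have -> : yc p ^+ 2 = 1 - xc p ^+ 2 by [lra]; ring.
(* On the circle S + 1 = 2 c (c + 1) with c >= -1, so [U] cuts out the image of the half circle c >
   0. *)
have UQ p : circle p -> U (nf3 p) -> 0 < xc p.
  rewrite /circle /U /nf3 /polymap /= xc_pt => pe.
  have -> : yc p ^+ 2 = 1 - xc p ^+ 2 by lra.
  have x1 : -1 <= xc p.
    have [//|x1] := leP (-1) (xc p); have := sqr_ge0 (yc p); nra.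
  nra.
apply: (cusp_chart D).
- by rewrite /U /= xc_pt; lra.
- rewrite /psi /w xc_pt yc_pt (@sqrt_sq _ _ 3); [|lra|ring].
  by congr pt; [field|rewrite mul0r].
- move=> q Uq; rewrite cuspidalE /psi xc_pt yc_pt.
  have wq := w0 q; have sq2 := sqr_sqrtr (ltW wq).
  have -> : (yc q / (2 * Num.sqrt (w q))) ^+ 2 = yc q ^+ 2 / (4 * w q).
    by rewrite -{2}sq2; field; rewrite sw0.
  split.
    move=> [p pe pq]; have x0 : 0 < xc p by apply: UQ => //; rewrite pq.
    rewrite -pq (wQ p pe x0) /nf3 /polymap yc_pt.
    have -> : (2 * xc p * yc p - 2 * yc p) ^+ 2 = 4 * yc p ^+ 2 * (1 - xc p) ^+ 2 by ring.
    have -> : yc p ^+ 2 = 1 - xc p ^+ 2 by move: pe; rewrite /circle /=; lra.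
    by field; rewrite gt_eqF //; lra.
  have xS := wS q Uq; set t := w q in wq xS *.
  have tn0 : t != 0 by rewrite gt_eqF.
  move=> e; have {}e : yc q ^+ 2 = 4 * t * (2 - t) ^+ 3 by rewrite -e; field.
  have [t2|t2] := eqVneq t 2.
    exists (pt 1 0); first by rewrite /circle /= !coordE; ring.
    have y0 : yc q = 0 by apply: sqr0; rewrite e t2; ring.
    by apply: plane_eq; rewrite /nf3 /polymap !coordE ?xS ?y0 ?t2; ring.
  have t2' : 2 - t != 0 by rewrite subr_eq0 eq_sym.
  have t2'' : t - 2 != 0 by rewrite subr_eq0.
  exists (pt (t - 1) (yc q / (2 * (t - 2)))).
    by rewrite /circle /= !coordE expr_div_n e; field.
  apply: plane_eq; rewrite /nf3 /polymap !coordE.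
    by rewrite expr_div_n e xS; field.
  by field.
Qed.

(** The sine of a third of a turn, so that [rot] has order three. *)
Let k : R := Num.sqrt 3 / 2.

Let k2 : k ^+ 2 = 3 / 4.
Proof. by rewrite /k expr_div_n sqr_sqrtr ?ler0n //; field. Qed.

Definition rot p : plane R :=
  pt (- 2^-1 * xc p + - k * yc p + 0) (k * xc p + - 2^-1 * yc p + 0).

Let rot_affine : affine_iso rot.
Proof.
apply: affine_intro; have -> : - 2^-1 * - 2^-1 - - k * k = 4^-1 + k ^+ 2 by field.
by rewrite k2; apply: lt0r_neq0; lra.
Qed.

Let rot3 p : rot (rot (rot p)) = p.
Proof.
apply: plane_eq; rewrite /rot !coordE.
  transitivity ((3 * k ^+ 2 / 2 - 8^-1) * xc p + (k ^+ 3 - 3 / 4 * k) * yc p).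
    by field.
  by rewrite (exprS k 2) k2; field.
transitivity ((3 / 4 * k - k ^+ 3) * xc p + (3 * k ^+ 2 / 2 - 8^-1) * yc p).
  by field.
by rewrite (exprS k 2) k2; field.
Qed.

Let rot_circle p : circle p -> circle (rot p).
Proof.
rewrite /circle /rot /= !coordE => e.
have -> : (- 2^-1 * xc p + - k * yc p + 0) ^+ 2 + (k * xc p + - 2^-1 * yc p + 0) ^+ 2 =
  (4^-1 + k ^+ 2) * (xc p ^+ 2 + yc p ^+ 2) by field.
by rewrite e k2; field.
Qed.

(* In complex notation nf3 is z |-> z^2 + 2 \bar z. *)
Let nf3_rot p : nf3 (rot p) = rot (rot (nf3 p)).
Proof.
apply: plane_eq; rewrite /nf3 /rot /polymap !coordE; apply/eqP; rewrite -subr_eq0; apply/eqP.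
  transitivity ((k ^+ 2 - 3 / 4) * (2 * xc p)); first by field.
  by rewrite k2 subrr mul0r.
transitivity ((k ^+ 2 - 3 / 4) * (- 2 * yc p)); first by field.
by rewrite k2 subrr mul0r.
Qed.

Let deltoid_rot2 q : deltoid q -> deltoid (rot (rot q)).
Proof. by move=> [p cp <-]; exists (rot p); [exact: rot_circle|exact: nf3_rot]. Qed.

Let deltoid_rot q : deltoid q -> deltoid (rot q).
Proof. by move/deltoid_rot2/deltoid_rot2; rewrite rot3. Qed.

Let rot_deltoid : rot @` deltoid = deltoid.
Proof.
apply: set_eqP => q; split=> [[p dp <-]|dq]; first exact: deltoid_rot.
by exists (rot (rot q)); rewrite ?rot3 //; exact: deltoid_rot2.
Qed.

Let like_rot M q : locally_like M deltoid (rot q) <-> locally_like M deltoid q.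
Proof. by rewrite -{1}rot_deltoid; exact: image_locally_like. Qed.

(** The first coordinates of p, rot p and rot (rot p) add up to 0 and cannot all vanish on the
    circle, so one is positive. Rotating p once rotates its image twice, which exchanges the last
    two cases. *)
Let deltoid_cover q : deltoid q -> [\/ U q, U (rot q) | U (rot (rot q))].
Proof.
have UQ p : circle p -> 0 < xc p -> U (nf3 p).
  rewrite /circle /U /nf3 /polymap /= xc_pt => pe p0; nra.
move=> [p cp <-].
have cr := rot_circle cp; have crr := rot_circle cr.
have [x0|x0] := ltP 0 (xc p); first by constructor 1; exact: UQ.
have s3 : xc p + xc (rot p) + xc (rot (rot p)) = 0.
  rewrite /rot !coordE; transitivity ((3 / 4 - k ^+ 2) * xc p); first by field.
  by rewrite k2 subrr mul0r.
have [x1|x1] := ltP 0 (xc (rot p)).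
  by constructor 3; rewrite -nf3_rot; exact: UQ.
have [x2|x2] := ltP 0 (xc (rot (rot p))).
  constructor 2; have := UQ _ crr x2.
  by rewrite !nf3_rot rot3.
exfalso; have e0 : xc p = 0 by lra.
have e1 : xc (rot p) = 0 by lra.
have ky : k * yc p = 0 by move: e1; rewrite /rot xc_pt e0; lra.
have : k ^+ 2 * yc p ^+ 2 = 0 by rewrite -exprMn ky expr0n.
have -> : yc p ^+ 2 = 1 by move: cp; rewrite /circle /= e0 expr0n /= add0r.
rewrite k2; lra.
Qed.

Lemma deltoid_cusps : smooth_except_cusps 3 deltoid.
Proof.
have [c0 sm] := deltoid_chart; set P := pt 3 0 in c0 sm.
have uq q : U q -> cusp_point deltoid q -> q = P.
  move=> Uq cq; apply: contrapT => qP.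
  exact: smooth_not_cusp (sm q Uq (cusp_point_mem cq) qP) cq.
have alt q : deltoid q -> cusp_point deltoid q \/ smooth_point deltoid q.
  have H q' : U q' -> deltoid q' -> cusp_point deltoid q' \/ smooth_point deltoid q'.
    move=> Uq dq; have [->|/eqP qP] := eqVneq q' P; first by left.
    by right; exact: sm.
  move=> dq; have [Uq|Uq|Uq] := deltoid_cover dq; first exact: H.
    by have := H _ Uq (deltoid_rot dq); rewrite /cusp_point /smooth_point !like_rot.
  by have := H _ Uq (deltoid_rot2 dq); rewrite /cusp_point /smooth_point !like_rot.
split; last by move=> q /alt[|].
apply: (@card_enum _ 3 (fun i => iter i rot P)).
  have k0 : k != 0 by apply/eqP => e; move: k2; rewrite e; lra.
  have ne1 : P <> rot P by move=> /(congr1 (@xc R)); rewrite /P /rot !coordE; lra.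
  have ne2 : P <> rot (rot P).
    by move=> e; apply: ne1; rewrite {1}e -[in RHS](rot3 P) -e.
  have ne3 : rot P <> rot (rot P) by move/(affine_inj rot_affine).
  case=> [|[|[|//]]] [|[|[|//]]] //= _ _ e; exfalso;
    first [exact: (ne1 e) | exact: (ne2 e) | exact: (ne3 e)
      | exact: (ne1 (esym e)) | exact: (ne2 (esym e)) | exact: (ne3 (esym e))].
apply: set_eqP => q; split=> [/= cq|[i i3 <-]]; last first.
  by elim: i {i3} => //= i IH; rewrite /= /cusp_point like_rot.
have [Uq|Uq|Uq] := deltoid_cover (cusp_point_mem cq).
- by exists 0%N => //=; rewrite (uq q).
(* From rot q = P and rot^3 = id, q is rot (rot P). *)
- exists 2%N => //=; rewrite -[RHS]rot3 (uq (rot q)) //.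
  by rewrite /cusp_point like_rot.
- exists 1%N => //=; rewrite -[RHS]rot3 (uq (rot (rot q))) //.
  by rewrite /cusp_point !like_rot.
Qed.

Lemma type_nf3 : has_type (@nf3 R) T3.
Proof.
have J0E : J0 (@nf3 R) = @circle R.
  by apply: set_eqP => p; rewrite /J0 /circle /= det_nf3; split; lra.
rewrite /has_type /J1 J0E; split.
- by exists id; rewrite ?image_id //; exact: affine_id.
- exists (@nf3 R) => //; apply: continuous_subspaceT.
  exact: quadratic_continuous nf3_quad.
- exact: deltoid_cusps.
Qed.

End TypeT3.

(** * Affine classification *)

Section AffineEquivalence.
Context {R : realType}.
Implicit Types (f g : plane R -> plane R) (u v : R -> R -> R).

Lemma det1 : 1 * 1 - 0 * 0 != 0 :> R.
Proof. by rewrite !mulr0 subr0 mulr1 oner_neq0. Qed.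

Lemma aff_refl f : affinely_equivalent f f.
Proof. by exists id, id; split=> //; exact: affine_id. Qed.

Lemma aff_sym f g : affinely_equivalent f g -> affinely_equivalent g f.
Proof.
move=> [h [k [ah ak E]]].
have [h' [ah' hK h'K]] := affine_inv ah; have [k' [ak' kK k'K]] := affine_inv ak.
exists h', k'; split=> //; apply/funext => p /=.
by rewrite -{1}(h'K p) -[g (h _)]/((g \o h) _) -E /= kK.
Qed.

Lemma aff_trans f g e : affinely_equivalent f g -> affinely_equivalent g e ->
  affinely_equivalent f e.
Proof.
move=> [h [k [ah ak E]]] [h2 [k2 [ah2 ak2 E2]]].
exists (h2 \o h), (k2 \o k); split; try exact: affine_comp.
apply/funext => p /=.
by rewrite -[k (f p)]/((k \o f) p) E -[k2 _]/((k2 \o g) _) E2.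
Qed.

(** Lower case coefficients describe the source map and upper case ones the target map; an
    equivalence becomes two determinants and two polynomial identities. *)
Lemma aff_polymap u v u' v' (a b e c d e' A B E C D E' : R) :
  a * d - b * c != 0 -> A * D - B * C != 0 ->
  (forall x y, A * u x y + B * v x y + E = u' (a * x + b * y + e) (c * x + d * y + e')) ->
  (forall x y, C * u x y + D * v x y + E' = v' (a * x + b * y + e) (c * x + d * y + e')) ->
  affinely_equivalent (polymap u v) (polymap u' v').
Proof.
move=> d1 d2 h1 h2.
exists (fun p => pt (a * xc p + b * yc p + e) (c * xc p + d * yc p + e')),
  (fun p => pt (A * xc p + B * yc p + E) (C * xc p + D * yc p + E')).
split; try exact: affine_intro.
by apply/funext => p /=; rewrite /polymap !coordE h1 h2.
Qed.

Lemma aff_subst u v (p q r s : R) : p * s - q * r != 0 ->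
  affinely_equivalent (polymap u v)
    (polymap (fun x y => u (p * x + q * y) (r * x + s * y))
             (fun x y => v (p * x + q * y) (r * x + s * y))).
Proof.
move=> D; apply: aff_sym; apply: (@aff_polymap _ _ _ _ p q 0 r s 0 1 0 0 0 1 0) => //.
- by move=> x y; rewrite !addr0 mul1r mul0r addr0.
- by move=> x y; rewrite !addr0 mul1r mul0r add0r.
Qed.

Lemma aff_target u v (A B C D : R) : A * D - B * C != 0 ->
  affinely_equivalent (polymap u v)
    (polymap (fun x y => A * u x y + B * v x y) (fun x y => C * u x y + D * v x y)).
Proof.
move=> nz; apply: (@aff_polymap _ _ _ _ 1 0 0 0 1 0 A B 0 C D 0) => //.
- by move=> x y; rewrite !mul1r !mul0r !addr0 !add0r.
- by move=> x y; rewrite !mul1r !mul0r !addr0 !add0r.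
Qed.

End AffineEquivalence.

(** * Cube roots and binary quadratic forms *)

Section Roots.
Context {R : realType}.

Lemma cube_root_pos (x : R) : 0 < x -> exists2 y, 0 < y & y ^+ 3 = x.
Proof.
move=> x0; exists (x `^ 3^-1); first exact: powR_gt0.
by rewrite -powR_mulrn ?powR_ge0 // -powRrM mulVf ?pnatr_eq0 // powRr1 // ltW.
Qed.

Lemma cube_root (x : R) : x != 0 -> exists2 y, y != 0 & y ^+ 3 = x.
Proof.
rewrite neq_lt => /orP[x0|/cube_root_pos[y y0 <-]]; last by exists y; rewrite ?gt_eqF.
have [|y y0 e] := @cube_root_pos (- x); first by rewrite oppr_gt0.
by exists (- y); rewrite ?oppr_eq0 ?gt_eqF // exprNn e; ring.
Qed.

(** The equations say (a + i b)^3 = p + i q. They are solved in polar form by the triple angle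
    formulas. *)
Lemma complex_cube_root (p q : R) : (p != 0) || (q != 0) ->
  exists a b, a ^+ 3 - 3 * a * b ^+ 2 = p /\ 3 * a ^+ 2 * b - b ^+ 3 = q.
Proof.
move=> pq.
have n0 : 0 < p ^+ 2 + q ^+ 2.
  rewrite lt0r addr_ge0 ?sqr_ge0 // andbT paddr_eq0 ?sqr_ge0 // !sqrf_eq0.
  by rewrite negb_and.
pose rho := Num.sqrt (p ^+ 2 + q ^+ 2).
have r0 : 0 < rho by rewrite sqrtr_gt0.
have rho2 : rho ^+ 2 = p ^+ 2 + q ^+ 2 by rewrite sqr_sqrtr // ltW.
have pr : -1 <= p / rho <= 1.
  rewrite ler_pdivlMr // ler_pdivrMr // mulN1r mul1r -ler_norml.
  rewrite -(@ler_pXn2r _ 2) ?nnegrE ?(ltW r0) // real_normK ?num_real // rho2.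
  by rewrite lerDl sqr_ge0.
have [r rp rE] := cube_root_pos r0.
(* [acos] only sees the upper half plane; [s] restores the sign of [q]. *)
pose t := acos (p / rho) / 3; pose s := if q < 0 then -1 else 1 : R.
have s2 : s ^+ 2 = 1 by rewrite /s; case: ifP => _; ring.
have t3 : acos (p / rho) = t + (t + t) by rewrite /t; field.
have c3 : cos t ^+ 3 - 3 * cos t * sin t ^+ 2 = p / rho.
  by rewrite -[RHS](@acosK R) ?in_itv //= t3 !cosD !sinD; ring.
have s3 : s * (3 * cos t ^+ 2 * sin t - sin t ^+ 3) = q / rho.
  have -> : 3 * cos t ^+ 2 * sin t - sin t ^+ 3 = sin (acos (p / rho)).
    by rewrite t3 !sinD !cosD; ring.
  rewrite sin_acos //.
  have -> : 1 - (p / rho) ^+ 2 = (q / rho) ^+ 2.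
    rewrite !expr_div_n rho2; field; exact: lt0r_neq0.
  rewrite sqrtr_sqr normrM normfV (gtr0_norm r0) mulrA; congr (_ / _).
  rewrite /s; case: ltP => q0; first by rewrite ltr0_norm // mulN1r opprK.
  by rewrite ger0_norm // mul1r.
have rn0 : rho != 0 by rewrite gt_eqF.
exists (r * cos t), (r * (s * sin t)); split.
  transitivity (r ^+ 3 * (cos t ^+ 3 - 3 * cos t * (s ^+ 2 * sin t ^+ 2))).
    by ring.
  by rewrite s2 mul1r c3 rE mulrC divfK.
transitivity (r ^+ 3 * (s * (3 * cos t ^+ 2 * sin t - s ^+ 2 * sin t ^+ 3))).
  by ring.
by rewrite s2 mul1r s3 rE mulrC divfK.
Qed.

(* The coefficients m, n, l of a binary form m x^2 + n x y + l y^2 after the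
   substitution x <- p x + q y, y <- r x + s y. *)
Lemma binary_form (m n l : R) : [|| m != 0, n != 0 | l != 0] ->
  exists p q r s, p * s - q * r != 0 /\
  let m' := m * p ^+ 2 + n * p * r + l * r ^+ 2 in
  let n' := 2 * m * p * q + n * (p * s + q * r) + 2 * l * r * s in
  let l' := m * q ^+ 2 + n * q * s + l * s ^+ 2 in
  [\/ [/\ m' = l', n' = 0 & m' != 0],
      [/\ m' = 0, l' = 0 & n' != 0] |
      [/\ n' = 0, l' = 0 & m' != 0]].
Proof.
have main (a b c : R) : a != 0 -> exists p q r s, p * s - q * r != 0 /\
  let m' := a * p ^+ 2 + b * p * r + c * r ^+ 2 in
  let n' := 2 * a * p * q + b * (p * s + q * r) + 2 * c * r * s in
  let l' := a * q ^+ 2 + b * q * s + c * s ^+ 2 in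
  [\/ [/\ m' = l', n' = 0 & m' != 0], [/\ m' = 0, l' = 0 & n' != 0] |
      [/\ n' = 0, l' = 0 & m' != 0]].
  move=> a0; pose D := b ^+ 2 - 4 * a * c.
  have [D0|D0|D0] := ltgtP D 0.
  - pose z := Num.sqrt (- D).
    have z0 : 0 < z by rewrite sqrtr_gt0 oppr_gt0.
    have z2 : z ^+ 2 = 4 * a * c - b ^+ 2.
      by rewrite sqr_sqrtr ?oppr_ge0 ?(ltW D0) // /D opprB.
    have zn0 : z != 0 by rewrite gt_eqF.
    have cE : c = (z ^+ 2 + b ^+ 2) / (4 * a) by rewrite z2; field.
    (* The second column is orthogonal to (1, 0) for the form, scaled so that the form takes the
       same value on both. *)
    exists 1, (- b / z), 0, (2 * a / z); split.
      by rewrite mulr0 subr0 mul1r !mulf_neq0 ?invr_eq0 ?pnatr_eq0.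
    move=> m' n' l'; constructor 1; rewrite /m' /n' /l'; split.
    + by rewrite cE; field; rewrite zn0.
    + by field.
    + by rewrite expr1n mulr1 mulr0 expr0n mulr0 !addr0.
  - pose z := Num.sqrt D.
    have z0 : 0 < z by rewrite sqrtr_gt0.
    have z2 : z ^+ 2 = b ^+ 2 - 4 * a * c by rewrite sqr_sqrtr // ltW.
    have zn0 : z != 0 by rewrite gt_eqF.
    have cE : c = (b ^+ 2 - z ^+ 2) / (4 * a) by rewrite z2; field.
    (* The columns span the two isotropic lines of the form. *)
    exists ((- b + z) / (2 * a)), ((b + z) / (2 * a)), 1, (-1); split.
      have -> : (- b + z) / (2 * a) * -1 - (b + z) / (2 * a) * 1 = - z / a by field.
      by rewrite mulf_neq0 ?oppr_eq0 ?invr_eq0.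
    move=> m' n' l'; constructor 2; rewrite /m' /n' /l'; split.
    + by rewrite cE; field.
    + by rewrite cE; field.
    + have -> : 2 * a * ((- b + z) / (2 * a)) * ((b + z) / (2 * a)) +
        b * ((- b + z) / (2 * a) * -1 + (b + z) / (2 * a) * 1) + 2 * c * 1 * -1 = z ^+ 2 / a.
        by rewrite cE; field.
      by rewrite mulf_neq0 ?invr_eq0 // expf_neq0.
  - have cE : c = b ^+ 2 / (4 * a).
      have -> : b ^+ 2 = 4 * a * c by move: D0; rewrite /D; lra.
      by field.
    exists 1, (- b / (2 * a)), 0, 1; split; first by rewrite mulr0 subr0 mulr1 oner_neq0.
    move=> m' n' l'; constructor 3; rewrite /m' /n' /l'; split.
    + by field.
    + by rewrite cE; field.
    + by rewrite expr1n mulr1 mulr0 expr0n mulr0 !addr0.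
have [m0|m0 _] := eqVneq m 0; last exact: main.
have [l0|l0 _] := eqVneq l 0.
  move=> nl; have n0 : n != 0 by move: nl; rewrite /= orbF.
  exists 1, 0, 0, 1; split; first by rewrite mulr0 subr0 mulr1 oner_neq0.
  move=> m' n' l'; constructor 2; rewrite /m' /n' /l' m0 l0; split; try by ring.
  have -> : 2 * 0 * 1 * 0 + n * (1 * 1 + 0 * 0) + 2 * 0 * 0 * 1 = n by ring.
  exact: n0.
(* When the x^2 coefficient vanishes and the y^2 one does not, the variables are exchanged. *)
have [p [q [r [s [D H]]]]] := main l n m l0.
exists r, s, p, q; split.
  have -> : r * q - s * p = - (p * s - q * r) by ring.
  by rewrite oppr_eq0.
move: H => /=.
have -> : l * p ^+ 2 + n * p * r + m * r ^+ 2 = m * r ^+ 2 + n * r * p + l * p ^+ 2 by ring.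
have -> : 2 * l * p * q + n * (p * s + q * r) + 2 * m * r * s =
  2 * m * r * s + n * (r * q + s * p) + 2 * l * p * q by ring.
by have -> : l * q ^+ 2 + n * q * s + m * s ^+ 2 = m * s ^+ 2 + n * s * q + l * q ^+ 2 by ring.
Qed.

End Roots.

(** * Reduction to the eighteen normal forms *)

Section Classification.
Context {R : realType}.
Implicit Types (f g : plane R -> plane R) (u v : R -> R -> R).

(* The last six are the members of the exceptional pairs. *)
Definition nf (i : nat) : plane R -> plane R :=
  nth (fun=> 0) [:: nf1; nf2; nf3; nf4; nf5a; nf5b; nf6; nf7a; nf7b; nf8a; nf8b; nf9c;
    nf8c; nf8c'; nf9a; nf9a'; nf9b; nf9b'] i.

Definition classified f := exists2 i, (i < 18)%N & affinely_equivalent f (nf i).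

Lemma classified_aff f g : affinely_equivalent f g -> classified g -> classified f.
Proof. by move=> fg [i i18 gi]; exists i => //; exact: aff_trans gi. Qed.

Lemma sum_sqr_neq0 (p q : R) : (p != 0) || (q != 0) -> p ^+ 2 + q ^+ 2 != 0.
Proof. by rewrite paddr_eq0 ?sqr_ge0 // !sqrf_eq0 negb_and. Qed.

Lemma detd (a b : R) : a != 0 -> b != 0 -> a * b - 0 * 0 != 0.
Proof. by move=> a0 b0; rewrite mulr0 subr0 mulf_neq0. Qed.

(* The next three lemmas are named after the Jacobian form of the pencil:
   x^2 + y^2, x y and x^2 up to a constant. *)
Lemma classified_definite u v (d e k d' e' k' : R) :
  (forall x y, u x y = x ^+ 2 - y ^+ 2 + d * x + e * y + k) ->
  (forall x y, v x y = x * y + d' * x + e' * y + k') ->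
  classified (polymap u v).
Proof.
move=> uE vE; pose p := d - 2 * e'; pose q := e + 2 * d'.
have s1 : affinely_equivalent (polymap u v)
    (polymap (fun x y => x ^+ 2 - y ^+ 2 + p * x + q * y) (fun x y => x * y)).
  apply: (@aff_polymap _ _ _ _ _ 1 0 e' 0 1 d' 1 0
     (e' ^+ 2 - d' ^+ 2 + p * e' + q * d' - k) 0 1 (e' * d' - k'));
    rewrite ?det1 // => x y; rewrite ?uE ?vE /p /q; ring.
apply: classified_aff s1 _.
have [/andP[/eqP p0 /eqP q0]|] := boolP ((p == 0) && (q == 0)).
  exists 1%N => //; apply: (@aff_polymap _ _ _ _ _ 1 0 0 0 1 0 1 0 0 0 1 0);
    rewrite ?det1 // => x y; rewrite ?p0 ?q0; ring.
rewrite negb_and => pq; exists 2%N => //.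
have [|a [b [pE qE]]] := @complex_cube_root _ p (- q); first by rewrite oppr_eq0.
have {}qE : q = b ^+ 3 - 3 * a ^+ 2 * b by rewrite -[LHS]opprK -qE; ring.
have ab0 : a ^+ 2 + b ^+ 2 != 0.
  apply: sum_sqr_neq0; rewrite -negb_and; apply: contraL pq => /andP[/eqP a0 /eqP b0].
  by rewrite qE -pE a0 b0; apply/negP; rewrite -negb_and; apply/negP; rewrite negbK;
    apply/andP; split; apply/eqP; ring.
pose n := a ^+ 2 + b ^+ 2.
(* Translating z = x + i y by (p - i q) / 4 turns u + 2 i v into z^2 + mu conj z, up to a constant,
   with mu = (p + i q) / 2. Scaling z by alpha = r (a + i b) should give z^2 + 2 conj z, so alpha^2
   mu = 2 conj alpha; with (a + i b)^3 = p - i q this is r = 4 / n^2. [m1], [m2] are the scaled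
   translation, and [Re], [Im] the parts of alpha^2. *)
pose r := 4 / n ^+ 2; pose A := r * a; pose B := r * b.
pose m1 := (A * p + B * q) / 4; pose m2 := (B * p - A * q) / 4.
pose Re := A ^+ 2 - B ^+ 2; pose Im := 2 * A * B.
apply: (@aff_polymap _ _ _ _ _ A (- B) m1 B A m2 Re (- 2 * Im)
  (m1 ^+ 2 - m2 ^+ 2 + 2 * m1) Im (2 * Re) (2 * m1 * m2 - 2 * m2)).
- have -> : A * A - - B * B = r ^+ 2 * n by rewrite /A /B /n; ring.
  by rewrite mulf_neq0 // expf_neq0 // mulf_neq0 ?pnatr_eq0 ?invr_eq0 ?expf_neq0.
- have -> : Re * (2 * Re) - - 2 * Im * Im = 2 * (r ^+ 2 * n) ^+ 2.
    by rewrite /Re /Im /A /B /n; ring.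
  rewrite mulf_neq0 ?pnatr_eq0 // expf_neq0 // mulf_neq0 //.
  by rewrite expf_neq0 // mulf_neq0 ?pnatr_eq0 ?invr_eq0 ?expf_neq0.
- move=> x y; rewrite /m1 /m2 /Re /Im /A /B /r /n qE -pE; field; exact: ab0.
- move=> x y; rewrite /m1 /m2 /Re /Im /A /B /r /n qE -pE; field; exact: ab0.
Qed.

Lemma classified_indefinite u v (d e k d' e' k' : R) :
  (forall x y, u x y = x ^+ 2 + d * x + e * y + k) ->
  (forall x y, v x y = y ^+ 2 + d' * x + e' * y + k') ->
  classified (polymap u v).
Proof.
move=> uE vE.
pose s := d / 2; pose t := e' / 2.
have s1 : affinely_equivalent (polymap u v)
    (polymap (fun x y => x ^+ 2 + e * y) (fun x y => y ^+ 2 + d' * x)).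
  apply: (@aff_polymap _ _ _ _ _ 1 0 s 0 1 t 1 0 (s ^+ 2 + e * t - k)
    0 1 (t ^+ 2 + d' * s - k'));
    rewrite ?det1 // => x y; rewrite ?uE ?vE /s /t; by field.
apply: classified_aff s1 _.
have [e0|e0] := eqVneq e 0; have [d0|d0] := eqVneq d' 0.
- exists 4%N => //; apply: (@aff_polymap _ _ _ _ _ 1 0 0 0 1 0 1 0 0 0 1 0);
    rewrite ?det1 // => x y; rewrite ?e0 ?d0; ring.
- exists 5%N => //; apply: (@aff_polymap _ _ _ _ _ 0 1 0 d' 0 0 0 1 0 (d' ^+ 2) 0 0).
  + by rewrite mulr0 sub0r oppr_eq0 mul1r.
  + by rewrite mulr0 sub0r oppr_eq0 mul1r expf_neq0.
  + by move=> x y; ring.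
  + by move=> x y; rewrite e0; ring.
- exists 5%N => //; apply: (@aff_polymap _ _ _ _ _ 1 0 0 0 e 0 1 0 0 0 (e ^+ 2) 0).
  + by apply: detd; rewrite ?oner_neq0.
  + by apply: detd; rewrite ?oner_neq0 ?expf_neq0.
  + by move=> x y; ring.
  + by move=> x y; rewrite d0; ring.
(* With X = a x and Y = b y the target is X^2 + 2 Y, Y^2 + 2 X: this asks a^2 e = 2 b and b^2 d' = 2
   a, hence a^3 = 8 / (e^2 d'). *)
have [|a a0 aE] := @cube_root _ (8 / (e ^+ 2 * d')).
  by rewrite mulf_neq0 ?pnatr_eq0 ?invr_eq0 // mulf_neq0 // expf_neq0.
pose b := a ^+ 2 * e / 2.
have b0 : b != 0 by rewrite !mulf_neq0 ?invr_eq0 ?pnatr_eq0 // expf_neq0.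
have aE2 : 2 * a = b ^+ 2 * d'.
  have -> : b ^+ 2 * d' = a * a ^+ 3 * (e ^+ 2 * d') / 4 by rewrite /b; field.
  by rewrite aE; field; rewrite d0 e0.
have bE2 : 2 * b = a ^+ 2 * e by rewrite /b; field.
exists 3%N => //.
(* [nf4] at ((X + Y) / 2, (X - Y) / 2) has as components the half sum and the half difference of X^2
   + 2 Y and Y^2 + 2 X. *)
apply: (@aff_polymap _ _ _ _ _ (a / 2) (b / 2) 0 (a / 2) (- b / 2) 0
  (a ^+ 2 / 2) (b ^+ 2 / 2) 0 (a ^+ 2 / 2) (- b ^+ 2 / 2) 0).
- have -> : a / 2 * (- b / 2) - b / 2 * (a / 2) = - (a * b) / 2 by field.
  by rewrite mulf_neq0 ?invr_eq0 ?pnatr_eq0 // oppr_eq0 mulf_neq0.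
- have -> : a ^+ 2 / 2 * (- b ^+ 2 / 2) - b ^+ 2 / 2 * (a ^+ 2 / 2) = - (a * b) ^+ 2 / 2 by field.
  by rewrite mulf_neq0 ?invr_eq0 ?pnatr_eq0 // oppr_eq0 expf_neq0 // mulf_neq0.
- move=> x y; transitivity (a ^+ 2 * x ^+ 2 / 2 + (a ^+ 2 * e) * y / 2 +
    b ^+ 2 * y ^+ 2 / 2 + (b ^+ 2 * d') * x / 2); first by field.
  by rewrite -bE2 -aE2; field.
- move=> x y; transitivity (a ^+ 2 * x ^+ 2 / 2 + (a ^+ 2 * e) * y / 2 -
    b ^+ 2 * y ^+ 2 / 2 - (b ^+ 2 * d') * x / 2); first by field.
  by rewrite -bE2 -aE2; field.
Qed.

Lemma classified_degenerate u v (d e k d' e' k' : R) :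
  (forall x y, u x y = x ^+ 2 + d * x + e * y + k) ->
  (forall x y, v x y = x * y + d' * x + e' * y + k') ->
  classified (polymap u v).
Proof.
move=> uE vE.
pose a := d - 2 * e'.
have s1 : affinely_equivalent (polymap u v)
    (polymap (fun x y => x ^+ 2 + a * x + e * y) (fun x y => x * y)).
  apply: (@aff_polymap _ _ _ _ _ 1 0 e' 0 1 d' 1 0 (e' ^+ 2 + a * e' + e * d' - k)
    0 1 (e' * d' - k'));
    rewrite ?det1 // => x y; rewrite ?uE ?vE /a; ring.
apply: classified_aff s1 _.
have [e0|e0] := eqVneq e 0.
  have [a0|a0] := eqVneq a 0.
    exists 8%N => //; apply: (@aff_polymap _ _ _ _ _ 1 0 0 0 1 0 1 0 0 0 1 0);
      rewrite ?det1 // => x y; rewrite ?e0 ?a0; ring.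
  exists 7%N => //.
  apply: (@aff_polymap _ _ _ _ _ a^-1 0 0 0 1 0 (a^-1 ^+ 2) 0 0 0 a^-1 0).
  - by apply: detd; rewrite ?invr_eq0 ?oner_neq0.
  - by apply: detd; rewrite ?expf_neq0 ?invr_eq0.
  - by move=> x y; rewrite e0; field.
  - by move=> x y; field.
exists 6%N => //.
(* With X = x + s and Y = s x + e y + 2 s^2, the sum X^2 + Y is u + 3 s^2 exactly when 3 s = a, and
   then X Y = s u + e v + 2 s^3. *)
pose s := a / 3.
apply: (@aff_polymap _ _ _ _ _ 1 0 s s e (2 * s ^+ 2) (1/3) 0 (s ^+ 2)
  (s / 2) (e / 2) (s ^+ 3)).
- by rewrite mul0r subr0 mul1r.
- by rewrite mul0r subr0 !mulf_neq0 ?invr_eq0 ?pnatr_eq0 ?oner_neq0.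
- by move=> x y; rewrite /s; field.
- by move=> x y; rewrite /s; field.
Qed.

Lemma classified_rank1_definite u v (d e k d' e' k' : R) :
  (forall x y, u x y = x ^+ 2 + y ^+ 2 + d * x + e * y + k) ->
  (forall x y, v x y = d' * x + e' * y + k') ->
  classified (polymap u v).
Proof.
move=> uE vE; have [/andP[/eqP d0 /eqP e0]|] := boolP ((d' == 0) && (e' == 0)).
  exists 16%N => //; apply: (@aff_polymap _ _ _ _ _ 1 0 (d / 2) 0 1 (e / 2)
    1 0 ((d / 2) ^+ 2 + (e / 2) ^+ 2 - k) 0 1 (- k'));
    rewrite ?det1 // => x y; rewrite ?uE ?vE ?d0 ?e0; by field.
rewrite negb_and => /sum_sqr_neq0 n0; exists 13%N => //.
pose n := d' ^+ 2 + e' ^+ 2.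
pose s := (e' * d - d' * e) / 2; pose t := (d' * d + e' * e) / 2.
(* A similarity that makes the linear part of [v] a coordinate and multiplies x^2 + y^2 by [n]; [s]
   and [t] complete the squares. *)
apply: (@aff_polymap _ _ _ _ _ e' (- d') s d' e' t n 0 (s ^+ 2 + t ^+ 2 - n * k) 0 1 (t - k')).
- by have -> : e' * e' - - d' * d' = n by rewrite /n; ring.
- by rewrite mulr0 subr0 mulr1.
- by move=> x y; rewrite uE vE /s /t /n; field.
- by move=> x y; rewrite uE vE; ring.
Qed.

Lemma classified_rank1_indefinite u v (d e k d' e' k' : R) :
  (forall x y, u x y = x * y + d * x + e * y + k) ->
  (forall x y, v x y = d' * x + e' * y + k') ->
  classified (polymap u v).
Proof.
move=> uE vE.
have s1 : affinely_equivalent (polymap u v)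
    (polymap (fun x y => x * y) (fun x y => d' * x + e' * y)).
  apply: (@aff_polymap _ _ _ _ _ 1 0 e 0 1 d 1 0 (d * e - k) 0 1 (d' * e + e' * d - k'));
    rewrite ?det1 // => x y; rewrite ?uE ?vE; ring.
apply: classified_aff s1 _.
have [d0|d0] := eqVneq d' 0; have [e0|e0] := eqVneq e' 0.
- exists 14%N => //; apply: (@aff_polymap _ _ _ _ _ (1/2) (1/2) 0 (1/2) (-1/2) 0 1 0 0 0 1 0).
  + have -> : 1 / 2 * (-1 / 2) - 1 / 2 * (1 / 2) = - 2^-1 :> R by field.
    by rewrite oppr_eq0 invr_eq0 pnatr_eq0.
  + exact: det1.
  + by move=> x y; field.
  + by move=> x y; rewrite d0 e0; ring.
- exists 9%N => //; apply: (@aff_polymap _ _ _ _ _ 1 0 0 0 e' 0 e' 0 0 0 1 0).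
  + by rewrite mulr0 subr0 mul1r.
  + by rewrite mulr0 subr0 mulr1.
  + by move=> x y; ring.
  + by move=> x y; rewrite d0; ring.
- exists 9%N => //; apply: (@aff_polymap _ _ _ _ _ 0 1 0 d' 0 0 d' 0 0 0 1 0).
  + by rewrite mul1r mul0r sub0r oppr_eq0.
  + by rewrite mulr0 subr0 mulr1.
  + by move=> x y; ring.
  + by move=> x y; rewrite e0; ring.
- exists 12%N => //.
  (* For X = d' x - e' y and Y = d' x + e' y, X^2 - Y^2 is - 4 d' e' x y. *)
  apply: (@aff_polymap _ _ _ _ _ d' (- e') 0 d' e' 0 (- 4 * d' * e') 0 0 0 1 0).
  + have -> : d' * e' - - e' * d' = 2 * (d' * e') by ring.
    by rewrite !mulf_neq0 ?pnatr_eq0.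
  + by rewrite mulr0 subr0 mulr1 !mulf_neq0 ?oppr_eq0 ?pnatr_eq0.
  + by move=> x y; ring.
  + by move=> x y; ring.
Qed.

Lemma classified_rank1_degenerate u v (d e k d' e' k' : R) :
  (forall x y, u x y = x ^+ 2 + d * x + e * y + k) ->
  (forall x y, v x y = d' * x + e' * y + k') ->
  classified (polymap u v).
Proof.
move=> uE vE.
have [e0|e0] := eqVneq e' 0; last first.
  (* Subtracting (e / e') v removes y from [u]; [s] then completes the square in x. *)
  pose s := (d - e * d' / e') / 2.
  exists 10%N => //; apply: (@aff_polymap _ _ _ _ _ 1 0 s d' e' 0
    1 (- e / e') (s ^+ 2 - k + e / e' * k') 0 1 (- k')).
  + by rewrite mul0r subr0 mul1r.
  + by rewrite mulr0 subr0 mulr1 oner_neq0.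
  + by move=> x y; rewrite uE vE /s; field.
  + by move=> x y; rewrite uE vE; ring.
have [d0|d0] := eqVneq d' 0; have [e1|e1] := eqVneq e 0.
- exists 17%N => //; apply: (@aff_polymap _ _ _ _ _ 1 0 (d / 2) 0 1 0
    1 0 ((d / 2) ^+ 2 - k) 0 1 (- k'));
    rewrite ?det1 // => x y; rewrite ?uE ?vE ?d0 ?e0 ?e1; by field.
- exists 15%N => //; apply: (@aff_polymap _ _ _ _ _ 1 0 0 d e 0 1 0 (- k) 0 1 (- k')).
  + by rewrite mul0r subr0 mul1r.
  + exact: det1.
  + by move=> x y; rewrite uE vE; ring.
  + by move=> x y; rewrite uE vE d0 e0; ring.
- exists 11%N => //; apply: (@aff_polymap _ _ _ _ _ 1 0 (d / 2) 0 1 0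
    1 0 ((d / 2) ^+ 2 - k) 0 (1 / d') (d / 2 - k' / d')).
  + exact: det1.
  + by rewrite mulr0 subr0 mul1r mulf_neq0 ?oner_neq0 ?invr_eq0.
  + by move=> x y; rewrite uE vE e1; field.
  + by move=> x y; rewrite uE vE e0; field.
- exists 0%N => //; apply: (@aff_polymap _ _ _ _ _ 1 0 0 d e 0 1 0 (- k) 0 (1 / d') (- k' / d')).
  + by rewrite mul0r subr0 mul1r.
  + by rewrite mulr0 subr0 mul1r mulf_neq0 ?oner_neq0 ?invr_eq0.
  + by move=> x y; rewrite uE vE; ring.
  + by move=> x y; rewrite uE vE e0; field.
Qed.

Lemma classified_rank1 u v (a b c d e k d' e' k' : R) :
  [|| a != 0, b != 0 | c != 0] ->
  quad_coeffs u a b c d e k -> quad_coeffs v 0 0 0 d' e' k' ->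
  classified (polymap u v).
Proof.
move=> /binary_form[p [q [r [s [D H]]]]] uE vE.
apply: classified_aff (aff_subst u v D) _; move: H.
set a1 := (_ + _ + _); set b1 := (_ + _ + _); set c1 := (_ + _ + _) => /= H.
have uE' x y : u (p * x + q * y) (r * x + s * y) =
    a1 * x ^+ 2 + b1 * (x * y) + c1 * y ^+ 2 + (d * p + e * r) * x + (d * q + e * s) * y + k.
  by rewrite uE /qf /a1 /b1 /c1; ring.
have vE' x y : v (p * x + q * y) (r * x + s * y) =
    (d' * p + e' * r) * x + (d' * q + e' * s) * y + k'.
  by rewrite vE /qf; ring.
have tg (z : R) : z != 0 -> z^-1 * 1 - 0 * 0 != 0.
  by move=> z0; rewrite mulr0 subr0 mulr1 invr_eq0.
case: H => -[h1 h2 nz]; apply: classified_aff (aff_target _ _ (tg _ nz)) _.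
- apply: (@classified_rank1_definite _ _ ((d * p + e * r) / a1) ((d * q + e * s) / a1)
    (k / a1) (d' * p + e' * r) (d' * q + e' * s) k') => x y; last by rewrite vE'; ring.
  by rewrite uE' vE' h2 -h1; field.
- apply: (@classified_rank1_indefinite _ _ ((d * p + e * r) / b1) ((d * q + e * s) / b1)
    (k / b1) (d' * p + e' * r) (d' * q + e' * s) k') => x y; last by rewrite vE'; ring.
  by rewrite uE' vE' h1 h2; field.
- apply: (@classified_rank1_degenerate _ _ ((d * p + e * r) / a1) ((d * q + e * s) / a1)
    (k / a1) (d' * p + e' * r) (d' * q + e' * s) k') => x y; last by rewrite vE'; ring.
  by rewrite uE' vE' h1 h2; field.
Qed.

(** The last hypothesis lists the coefficients of half the Jacobian form of the quadratic parts.
    Once it is normalized, its minors give linear relations between the coefficients of each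
    component, and an inverse 2 by 2 matrix in the target yields the standard basis of the span. *)
Lemma classified_rank2 u v (a b c d e k a' b' c' d' e' k' : R) :
  quad_coeffs u a b c d e k -> quad_coeffs v a' b' c' d' e' k' ->
  [|| a * b' - a' * b != 0, 2 * (a * c' - a' * c) != 0 | b * c' - b' * c != 0] ->
  classified (polymap u v).
Proof.
move=> uE vE /binary_form[p [q [r [s [D H]]]]].
apply: classified_aff (aff_subst u v D) _.
pose A := a * p ^+ 2 + b * p * r + c * r ^+ 2.
pose B := 2 * a * p * q + b * (p * s + q * r) + 2 * c * r * s.
pose C := a * q ^+ 2 + b * q * s + c * s ^+ 2.
pose A' := a' * p ^+ 2 + b' * p * r + c' * r ^+ 2.
pose B' := 2 * a' * p * q + b' * (p * s + q * r) + 2 * c' * r * s.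
pose C' := a' * q ^+ 2 + b' * q * s + c' * s ^+ 2.
pose G := d * p + e * r; pose E := d * q + e * s.
pose G' := d' * p + e' * r; pose E' := d' * q + e' * s.
have uE' x y : u (p * x + q * y) (r * x + s * y) =
    A * x ^+ 2 + B * (x * y) + C * y ^+ 2 + G * x + E * y + k.
  by rewrite uE /qf /A /B /C /G /E; ring.
have vE' x y : v (p * x + q * y) (r * x + s * y) =
    A' * x ^+ 2 + B' * (x * y) + C' * y ^+ 2 + G' * x + E' * y + k'.
  by rewrite vE /qf /A' /B' /C' /G' /E'; ring.
move: H; set m := (_ + _ + _); set n := (_ + _ + _); set l := (_ + _ + _) => /= H.
pose W := p * s - q * r.
(* Covariance: the minors after the substitution are those of the substituted Jacobian form times
   its determinant [W]. *)
have mE : A * B' - A' * B = W * m by rewrite /A /B /A' /B' /W /m; ring.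
have nE : 2 * (A * C' - A' * C) = W * n by rewrite /A /C /A' /C' /W /n; ring.
have lE : B * C' - B' * C = W * l by rewrite /B /C /B' /C' /W /l; ring.
have W0 : W != 0 by [].
have cr0 (z t : R) : t != 0 -> z * t = 0 -> z = 0.
  by move=> t0 /eqP; rewrite mulf_eq0 (negbTE t0) orbF => /eqP.
have inv (x1 x2 y1 y2 t : R) : t = x1 * y2 - y1 * x2 -> t != 0 ->
    y2 / t * (x1 / t) - (- x2 / t) * (- y1 / t) != 0.
  move=> tE t0; have -> : y2 / t * (x1 / t) - (- x2 / t) * (- y1 / t) = t^-1.
    transitivity ((x1 * y2 - y1 * x2) / t ^+ 2); first by field.
    by rewrite -tE; field.
  by rewrite invr_eq0.
have [[h1 h2 nz]|[h1 h2 nz]|[h1 h2 nz]] := H.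
- have AB : A * B' - A' * B != 0 by rewrite mE mulf_neq0.
  have AC : A * C' - A' * C = 0.
    by apply: (cr0 _ 2); rewrite ?pnatr_eq0 // mulrC nE h2 mulr0.
  have BC : B * C' - B' * C = A * B' - A' * B by rewrite lE mE h1.
  (* Here and in the next cases the identity is a 3 by 3 determinant with a repeated row: A (BC' -
     B'C) - B (AC' - A'C) + C (AB' - A'B) = 0, and its primed version. *)
  have C0 : C = - A.
    apply/eqP; rewrite -addr_eq0; apply/eqP; apply: (cr0 _ _ AB).
    transitivity (A * ((A * B' - A' * B) - (B * C' - B' * C)) + B * (A * C' - A' * C)).
      by ring.
    by rewrite BC AC subrr !mulr0 addr0.
  have C0' : C' = - A'.
    apply/eqP; rewrite -addr_eq0; apply/eqP; apply: (cr0 _ _ AB).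
    transitivity (A' * ((A * B' - A' * B) - (B * C' - B' * C)) + B' * (A * C' - A' * C)).
      by ring.
    by rewrite BC AC subrr !mulr0 addr0.
  pose t := A * B' - A' * B.
  apply: classified_aff (aff_target _ _ (inv A B A' B' t erefl AB)) _.
  apply: (@classified_definite _ _ (B' / t * G + (- B / t) * G')
    (B' / t * E + (- B / t) * E') (B' / t * k + (- B / t) * k')
    (- A' / t * G + A / t * G') (- A' / t * E + A / t * E') (- A' / t * k + A / t * k'))
    => x y; rewrite uE' vE' C0 C0' /t; field; exact: AB.
- have AC : A * C' - A' * C != 0.
    apply: contra_neq nz => AC0; apply: (cr0 _ _ W0).
    by rewrite mulrC -nE AC0 mulr0.
  have AB : A * B' - A' * B = 0 by rewrite mE h1 mulr0.
  have BC : B * C' - B' * C = 0 by rewrite lE h2 mulr0.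
  have B0 : B = 0.
    apply: (cr0 _ _ AC); transitivity (A * (B * C' - B' * C) + C * (A * B' - A' * B)).
      by ring.
    by rewrite AB BC !mulr0 addr0.
  have B0' : B' = 0.
    apply: (cr0 _ _ AC); transitivity (A' * (B * C' - B' * C) + C' * (A * B' - A' * B)).
      by ring.
    by rewrite AB BC !mulr0 addr0.
  pose t := A * C' - A' * C.
  apply: classified_aff (aff_target _ _ (inv A C A' C' t erefl AC)) _.
  apply: (@classified_indefinite _ _ (C' / t * G + (- C / t) * G')
    (C' / t * E + (- C / t) * E') (C' / t * k + (- C / t) * k')
    (- A' / t * G + A / t * G') (- A' / t * E + A / t * E') (- A' / t * k + A / t * k'))
    => x y; rewrite uE' vE' B0 B0' /t; field; exact: AC.
- have AB : A * B' - A' * B != 0 by rewrite mE mulf_neq0.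
  have AC : A * C' - A' * C = 0.
    by apply: (cr0 _ 2); rewrite ?pnatr_eq0 // mulrC nE h1 mulr0.
  have BC : B * C' - B' * C = 0 by rewrite lE h2 mulr0.
  have C0 : C = 0.
    apply: (cr0 _ _ AB).
    transitivity (- A * (B * C' - B' * C) + B * (A * C' - A' * C)); first by ring.
    by rewrite BC AC !mulr0 addr0.
  have C0' : C' = 0.
    apply: (cr0 _ _ AB).
    transitivity (- A' * (B * C' - B' * C) + B' * (A * C' - A' * C)); first by ring.
    by rewrite BC AC !mulr0 addr0.
  pose t := A * B' - A' * B.
  apply: classified_aff (aff_target _ _ (inv A B A' B' t erefl AB)) _.
  apply: (@classified_degenerate _ _ (B' / t * G + (- B / t) * G')
    (B' / t * E + (- B / t) * E') (B' / t * k + (- B / t) * k')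
    (- A' / t * G + A / t * G') (- A' / t * E + A / t * E') (- A' / t * k + A / t * k'))
    => x y; rewrite uE' vE' C0 C0' /t; field; exact: AB.
Qed.

Lemma classified_proportional u v (a b c d e k a' b' c' d' e' k' : R) :
  quad_coeffs u a b c d e k -> quad_coeffs v a' b' c' d' e' k' ->
  [|| a != 0, b != 0 | c != 0] ->
  a * b' = a' * b -> a * c' = a' * c -> b * c' = b' * c ->
  classified (polymap u v).
Proof.
move=> uE vE ne ab ac bc.
have [z [za zb zc]] : exists z, [/\ a' = z * a, b' = z * b & c' = z * c].
  case/or3P: ne => n0; [exists (a' / a)|exists (b' / b)|exists (c' / c)]; split;
    apply: (mulfI n0); rewrite mulrA [_ * (_ / _)]mulrC divfK //; lra.
have D : 1 * 1 - 0 * (- z) != 0 by rewrite mul0r subr0 mul1r oner_neq0.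
apply: classified_aff (aff_target _ _ D) _.
apply: (@classified_rank1 _ _ a b c d e k (d' - z * d) (e' - z * e) (k' - z * k) ne) => x y.
  by rewrite uE; ring.
by rewrite uE vE /qf za zb zc; ring.
Qed.

Theorem classification f : quadratic_map f -> classified f.
Proof.
move=> /quadratic_mapP.
move=> [u [v [a [b [c [d [e [k [a' [b' [c' [d' [e' [k' [ne uE vE ->]]]]]]]]]]]]]]].
have [rk|] := boolP [|| a * b' - a' * b != 0, 2 * (a * c' - a' * c) != 0
  | b * c' - b' * c != 0]; first exact: classified_rank2 uE vE rk.
rewrite !negb_or !negbK mulf_eq0 pnatr_eq0 /= !subr_eq0.
case/and3P => /eqP ab /eqP ac /eqP bc.
have [n1|] := boolP [|| a != 0, b != 0 | c != 0].
  exact: classified_proportional uE vE n1 ab ac bc.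
rewrite !negb_or !negbK => /and3P[/eqP a0 /eqP b0 /eqP c0].
have n2 : [|| a' != 0, b' != 0 | c' != 0] by move: ne; rewrite a0 b0 c0 eqxx.
(* If the first component is affine, the components are exchanged. *)
have D : 0 * 0 - 1 * 1 != 0 :> R by rewrite mul0r mul1r sub0r oppr_eq0 oner_neq0.
apply: classified_aff (aff_target u v D) _.
by apply: (@classified_proportional _ _ a' b' c' d' e' k' 0 0 0 d e k _ _ n2) => [x y|x y|||];
  rewrite ?uE ?vE /qf ?a0 ?b0 ?c0; ring.
Qed.

End Classification.

(** * Counting classes *)

Section Representatives.
Context {R : realType}.
Implicit Types (f g : plane R -> plane R).

Definition nf_type (i : nat) : crit_type :=
  nth T1 [:: T1; T2; T3; T4; T5a; T5b; T6; T7a; T7b; T8a; T8b; T9c;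
    T8c; T8c; T9a; T9a; T9b; T9b] i.

Lemma polymap_quadratic (u v : R -> R -> R) (a b c d e k a' b' c' d' e' k' : R) :
  [|| a != 0, b != 0, c != 0, a' != 0, b' != 0 | c' != 0] ->
  quad_coeffs u a b c d e k -> quad_coeffs v a' b' c' d' e' k' ->
  quadratic_map (polymap u v).
Proof.
by move=> ne uE vE; apply/quadratic_mapP;
  exists u, v, a, b, c, d, e, k, a', b', c', d', e', k'.
Qed.

Ltac quad_by a b c d e k a' b' c' d' e' k' :=
  apply: (@polymap_quadratic _ _ a b c d e k a' b' c' d' e' k');
  [by rewrite ?oner_neq0 ?orbT | by move=> x y; rewrite /qf; field
    | by move=> x y; rewrite /qf; field].

Lemma nf_quadratic i : (i < 18)%N -> quadratic_map (@nf R i).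
Proof.
case: i => [_|i]; first by quad_by (1:R) (0:R) (0:R) (0:R) (1:R) (0:R) (0:R) (0:R) (0:R) (1:R) (0:R) (0:R).
case: i => [_|i]; first by quad_by (1:R) (0:R) (-1:R) (0:R) (0:R) (0:R) (0:R) (1:R) (0:R) (0:R) (0:R) (0:R).
case: i => [_|i]; first by exact: nf3_quad.
case: i => [_|i]; first by exact: nf4_quad.
case: i => [_|i]; first by quad_by (1:R) (0:R) (0:R) (0:R) (0:R) (0:R) (0:R) (0:R) (1:R) (0:R) (0:R) (0:R).
case: i => [_|i]; first by quad_by (1:R) (0:R) (0:R) (0:R) (1:R) (0:R) (0:R) (0:R) (1:R) (0:R) (0:R) (0:R).
case: i => [_|i].
  apply: (@polymap_quadratic _ _ (1/3) 0 0 0 (1/3) 0 0 (1/2) 0 0 0 0).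
  - by rewrite mulf_neq0 ?oner_neq0 ?invr_eq0 ?pnatr_eq0.
  - by move=> x y; rewrite /qf; field.
  - by move=> x y; rewrite /qf; field.
case: i => [_|i]; first by quad_by (1:R) (0:R) (0:R) (1:R) (0:R) (0:R) (0:R) (1:R) (0:R) (0:R) (0:R) (0:R).
case: i => [_|i]; first by quad_by (1:R) (0:R) (0:R) (0:R) (0:R) (0:R) (0:R) (1:R) (0:R) (0:R) (0:R) (0:R).
case: i => [_|i]; first by quad_by (0:R) (1:R) (0:R) (0:R) (0:R) (0:R) (0:R) (0:R) (0:R) (0:R) (1:R) (0:R).
case: i => [_|i]; first by quad_by (1:R) (0:R) (0:R) (0:R) (0:R) (0:R) (0:R) (0:R) (0:R) (0:R) (1:R) (0:R).
case: i => [_|i]; first by quad_by (1:R) (0:R) (0:R) (0:R) (0:R) (0:R) (0:R) (0:R) (0:R) (1:R) (0:R) (0:R).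
case: i => [_|i]; first by quad_by (1:R) (0:R) (-1:R) (0:R) (0:R) (0:R) (0:R) (0:R) (0:R) (0:R) (1:R) (0:R).
case: i => [_|i]; first by quad_by (1:R) (0:R) (1:R) (0:R) (0:R) (0:R) (0:R) (0:R) (0:R) (0:R) (1:R) (0:R).
case: i => [_|i]; first by quad_by (1:R) (0:R) (-1:R) (0:R) (0:R) (0:R) (0:R) (0:R) (0:R) (0:R) (0:R) (0:R).
case: i => [_|i]; first by quad_by (1:R) (0:R) (0:R) (0:R) (1:R) (0:R) (0:R) (0:R) (0:R) (0:R) (0:R) (0:R).
case: i => [_|i]; first by quad_by (1:R) (0:R) (1:R) (0:R) (0:R) (0:R) (0:R) (0:R) (0:R) (0:R) (0:R) (0:R).
case: i => [_|i]; first by quad_by (1:R) (0:R) (0:R) (0:R) (0:R) (0:R) (0:R) (0:R) (0:R) (0:R) (0:R) (0:R).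
by [].
Qed.

Lemma has_nf_type i : (i < 18)%N -> has_type (@nf R i) (nf_type i).
Proof.
case: i => [_|i]; first by exact: type_nf1.
case: i => [_|i]; first by exact: type_nf2.
case: i => [_|i]; first by exact: type_nf3.
case: i => [_|i]; first by exact: type_nf4.
case: i => [_|i]; first by exact: type_nf5a.
case: i => [_|i]; first by exact: type_nf5b.
case: i => [_|i]; first by exact: type_nf6.
case: i => [_|i]; first by exact: type_nf7a.
case: i => [_|i]; first by exact: type_nf7b.
case: i => [_|i]; first by exact: type_nf8a.
case: i => [_|i]; first by exact: type_nf8b.
case: i => [_|i]; first by exact: type_nf9c.
case: i => [_|i]; first by exact: type_nf8c.
case: i => [_|i]; first by exact: type_nf8c'.
case: i => [_|i]; first by exact: type_nf9a.
case: i => [_|i]; first by exact: type_nf9a'.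
case: i => [_|i]; first by exact: type_nf9b.
case: i => [_|i]; first by exact: type_nf9b'.
by [].
Qed.

Lemma has_type_aff f g T : quadratic_map f -> quadratic_map g ->
  affinely_equivalent f g -> has_type f T -> has_type g T.
Proof.
move=> qf qg [h [k [ah ak E]]].
by apply: has_type_affine ah ak E => p; exact: quadratic_differentiable.
Qed.

Lemma has_type_ex f : quadratic_map f -> exists T, has_type f T.
Proof.
move=> qf; have [i i18 /aff_sym fi] := classification qf.
by exists (nf_type i); exact: has_type_aff (nf_quadratic i18) qf fi (has_nf_type i18).
Qed.

Lemma aff_crit f g : quadratic_map f -> quadratic_map g ->
  affinely_equivalent f g -> critically_equivalent f g.
Proof.
move=> qf qg fg; have [T fT] := has_type_ex qf.
by exists T; split=> //; exact: has_type_aff fT.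
Qed.

Lemma crit_sym f g : critically_equivalent f g -> critically_equivalent g f.
Proof. by move=> [T [fT gT]]; exists T. Qed.

(** Transitivity rests on the uniqueness of the type of the middle map. *)
Lemma crit_trans f g e : critically_equivalent f g -> critically_equivalent g e ->
  critically_equivalent f e.
Proof.
move=> [T [fT gT]] [T' [gT' eT']]; exists T; split=> //.
by rewrite (type_unique gT gT').
Qed.

Lemma crit_nf i j : (i < 18)%N -> (j < 18)%N ->
  critically_equivalent (@nf R i) (nf j) -> nf_type i = nf_type j.
Proof.
move=> i18 j18 [T [iT jT]].
by rewrite (type_unique (has_nf_type i18) iT) (type_unique (has_nf_type j18) jT).
Qed.

Lemma nf_crit i j : (i < 18)%N -> (j < 18)%N -> nf_type i = nf_type j ->
  critically_equivalent (@nf R i) (nf j).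
Proof.
by move=> i18 j18 e; exists (nf_type i); split; [|rewrite e]; exact: has_nf_type.
Qed.

(** Equivalences carry fibres to fibres: the diagonal lies in a fibre of x^2 - y^2, but the fibres
    of x^2 + y are parabolas. Three points of the line suffice. *)
Lemma aff_quad_sum_diff : ~ affinely_equivalent (@nf9a R) nf9a'.
Proof.
move=> [h [k [ah ak E]]].
have [w w0 hw] := @affine_line_image R h ah (pt 0 0) (pt 1 1)
  ltac:(by rewrite pt_neq0 oner_neq0).
have kE t : nf9a' (h (pt 0 0) + t *: w) = k (pt 0 0).
  rewrite -hw -[LHS]/((nf9a' \o h) _) -E /=; congr k.
  by apply: plane_eq; rewrite /nf9a /polymap !coordE; ring.
move: (kE 0) (kE 1) (kE (-1)) => /(congr1 (@xc R)) + /(congr1 (@xc R)) + /(congr1 (@xc R)).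
rewrite /nf9a' /polymap !coordE => e0 e1 e2.
have x0 : xc w = 0 by apply/eqP; rewrite -sqrf_eq0; apply/eqP; lra.
by apply: (vec_neq0 w0 x0); move: e0 e1; rewrite x0; lra.
Qed.

(** The fibre of the origin is a single point for x^2 + y^2, while fibres of x^2 are unions of
    vertical lines. *)
Lemma aff_ray : ~ affinely_equivalent (@nf9b R) nf9b'.
Proof.
move=> [h [k [ah ak E]]]; have [h' [ah' hK h'K]] := affine_inv ah.
pose p := h' (h (pt 0 0) + pt 0 1).
have e : nf9b p = nf9b (pt 0 0).
  apply: (affine_inj ak); rewrite -[LHS]/((k \o nf9b) p) -[RHS]/((k \o nf9b) (pt 0 0)) E /= h'K.
  by apply: plane_eq; rewrite /nf9b' /polymap !coordE // addr0.
have p0 : p = pt 0 0.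
  move/(congr1 (@xc R)): e; rewrite /nf9b /polymap !coordE expr0n /= addr0.
  move/eqP; rewrite paddr_eq0 ?sqr_ge0 // !sqrf_eq0 => /andP[/eqP x0 /eqP y0].
  by rewrite -(pt_eta p) x0 y0.
have := h'K (h (pt 0 0) + pt 0 1); rewrite -/p p0 => /(congr1 (@yc R)).
rewrite !coordE; lra.
Qed.

(* The image of (x^2 - y^2, y) contains a line, that of (x^2 + y^2, y) does not. *)
Lemma aff_fold : ~ affinely_equivalent (@nf8c R) nf8c'.
Proof.
move=> [h [k [ah ak E]]].
have [w w0 kw] := @affine_line_image R k ak (pt 0 0) (pt 0 1)
  ltac:(by rewrite pt_neq0 oner_neq0 orbT).
set p := k (pt 0 0) in kw.
have pos (t : R) : (yc p + t * yc w) ^+ 2 <= xc p + t * xc w.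
  have e : nf8c' (h (pt t t)) = p + t *: w.
    rewrite -kw -[LHS]/((nf8c' \o h) _) -E /=; congr k.
    by apply: plane_eq; rewrite /nf8c /polymap !coordE; ring.
  have ex := congr1 (@xc R) e; have ey := congr1 (@yc R) e.
  move: ex ey; rewrite /nf8c' /polymap !coordE => <- <-.
  by rewrite lerDr sqr_ge0.
have y0 : yc w = 0.
  apply/eqP/negPn/negP => wn0.
  have [C CE] : exists C, C = xc p - yc p ^+ 2 by eexists.
  have C0 : 0 <= C by have := pos 0; rewrite !mul0r !addr0 CE; lra.
  (* Adding the inequalities at opposite parameters cancels the linear terms and leaves (C + 1)^2 <=
     C, impossible for C >= 0. *)
  have := pos ((C + 1) / yc w); have := pos (- ((C + 1) / yc w)); rewrite !mulNr.
  have -> : (C + 1) / yc w * yc w = C + 1 by rewrite divfK.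
  move=> h1 h2; have : (C + 1) ^+ 2 <= xc p - yc p ^+ 2 by nra.
  by rewrite -CE; nra.
apply: (vec_neq0 w0 _ y0); apply/eqP/negPn/negP => wn0.
(* This parameter makes the right-hand side [yc p ^+ 2 - 1]. *)
have := pos ((yc p ^+ 2 - xc p - 1) / xc w).
by rewrite y0 mulr0 addr0 divfK //; lra.
Qed.

Lemma exceptional_pairsP (ab : (plane R -> plane R) * (plane R -> plane R)) :
  exceptional_pairs ab <->
  [\/ ab = (nf 12, nf 13), ab = (nf 14, nf 15) | ab = (nf 16, nf 17)].
Proof.
by split=> [[[]|]|[]] e; [constructor 1|constructor 2|constructor 3|left; left|left; right|right].
Qed.

Lemma exceptional_not_aff ab : exceptional_pairs ab ->
  ~ @affinely_equivalent R ab.1 ab.2.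
Proof.
by move=> /exceptional_pairsP[] ->; [exact: aff_fold|exact: aff_quad_sum_diff|exact: aff_ray].
Qed.

Lemma exceptional_mapsP f : exceptional_maps f <->
  exists2 i, (12 <= i < 18)%N & f = @nf R i.
Proof.
split=> [[ab /exceptional_pairsP[] -> /= [] ->]|[i]].
- by exists 12%N.
- by exists 13%N.
- by exists 14%N.
- by exists 15%N.
- by exists 16%N.
- by exists 17%N.
do 12 (case: i => [//|i]).
have e1 := iffRL (exceptional_pairsP (nf 12, nf 13)) (Or31 _ _ erefl).
have e2 := iffRL (exceptional_pairsP (nf 14, nf 15)) (Or32 _ _ erefl).
have e3 := iffRL (exceptional_pairsP (nf 16, nf 17)) (Or33 _ _ erefl).
case: i => [|[|[|[|[|[|//]]]]]] _ ->.
- by exists (nf 12, nf 13) => //; left.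
- by exists (nf 12, nf 13) => //; right.
- by exists (nf 14, nf 15) => //; left.
- by exists (nf 14, nf 15) => //; right.
- by exists (nf 16, nf 17) => //; left.
- by exists (nf 16, nf 17) => //; right.
Qed.

Lemma nf_type_eq i j : (i < 18)%N -> (j < 18)%N -> nf_type i = nf_type j ->
  [\/ i = j, @exceptional_pairs R (nf i, nf j) | @exceptional_pairs R (nf j, nf i)].
Proof.
have e1 := iffRL (exceptional_pairsP (nf 12, nf 13)) (Or31 _ _ erefl).
have e2 := iffRL (exceptional_pairsP (nf 14, nf 15)) (Or32 _ _ erefl).
have e3 := iffRL (exceptional_pairsP (nf 16, nf 17)) (Or33 _ _ erefl).
do 18 (case: i => [|i]; first by move=> _; do 18 (case: j => [|j]; first by
  move=> _ //= _; first [by constructor 1 | by constructor 2 | by constructor 3])).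
by [].
Qed.

(** Equivalent normal forms share their type, so distinct ones would form an exceptional pair. *)
Lemma nf_aff_inj i j : (i < 18)%N -> (j < 18)%N ->
  affinely_equivalent (@nf R i) (nf j) -> i = j.
Proof.
move=> i18 j18 ij.
have cij := aff_crit (nf_quadratic i18) (nf_quadratic j18) ij.
have [//|/exceptional_not_aff|/exceptional_not_aff] := nf_type_eq i18 j18 (crit_nf i18 j18 cij).
  by case.
by case; exact: aff_sym.
Qed.

End Representatives.

(** * Classes indexed by representatives *)

Section CountingClasses.
Context {T : Type}.
Implicit Types (S : set T) (E : T -> T -> Prop).

Lemma class_of_eq S E f g : equivalence_on S E -> S f -> S g ->
  class_of S E f = class_of S E g <-> E f g.
Proof.
move=> [rf sy tr] Sf Sg; split=> [e|fg].
  by have [] : class_of S E f g by rewrite e; split=> //; exact: rf.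
apply: set_eqP => h; split=> -[Sh]; split=> //.
  by apply: tr b => //; exact: sy.
exact: tr b.
Qed.

Lemma classes_image S E n (r : nat -> T) : equivalence_on S E ->
  (forall i, (i < n)%N -> S (r i)) ->
  (forall f, S f -> exists2 i, (i < n)%N & E f (r i)) ->
  classes S E = (fun i => class_of S E (r i)) @` `I_n.
Proof.
move=> eqv Sr ex; apply: set_eqP => C; split=> [[f Sf <-]|[i i_n <-]]; last first.
  by exists (r i) => //; exact: Sr.
have [i i_n fi] := ex f Sf; exists i => //.
by apply/esym/class_of_eq => //; exact: Sr.
Qed.

Lemma setD_image_enum (U : Type) (F : nat -> U) m n : (m <= n)%N ->
  (forall i j, (i < n)%N -> (j < n)%N -> F i = F j -> i = j) ->
  F @` `I_n `\` F @` [set i | (m <= i < n)%N] = F @` `I_m.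
Proof.
move=> mn inj; apply: set_eqP => x; split=> [[[i i_n <-] H]|[i i_m <-]].
  exists i => //=; rewrite ltnNge; apply/negP => mi; apply: H.
  by exists i => //=; rewrite mi.
split; first by exists i => //=; exact: leq_trans i_m mn.
move=> [j /andP[mj jn] e]; have ij : j = i by apply: inj => //; exact: leq_trans i_m mn.
by move: mj; rewrite ij leqNgt i_m.
Qed.

End CountingClasses.

Theorem mainTheorem2 (R : realType) :
  let quad : set (plane R -> plane R) := [set Q | quadratic_map Q] in
  let aff := @affinely_equivalent R in
  let crit := @critically_equivalent R in
  let exc_aff := [set class_of quad aff m | m in exceptional_maps] in
  let exc_crit := [set class_of quad crit m | m in exceptional_maps] in
  has_classes 18 quad aff /\
  has_classes 15 quad crit /\
  (forall f g, quad f -> quad g -> aff f g -> crit f g) /\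
  (forall f g, quad f -> quad g -> crit f g ->
     (aff f g <->
      ~ exists2 ab, exceptional_pairs ab &
          (aff f ab.1 /\ aff g ab.2) \/ (aff f ab.2 /\ aff g ab.1))) /\
  (forall ab, exceptional_pairs ab ->
     [/\ quad ab.1, quad ab.2, crit ab.1 ab.2 & ~ aff ab.1 ab.2]) /\
  (* twelve classes remain on each side; the bijection sends an affine class to
     the critical set class of its members *)
  classes quad aff `\` exc_aff #= `I_12 /\
  classes quad crit `\` exc_crit #= `I_12 /\
  set_bij (classes quad aff `\` exc_aff) (classes quad crit `\` exc_crit)
    (fun A => [set g | quad g /\ exists2 f, A f & crit f g]).
Proof.
move=> quad aff crit exc_aff exc_crit.
have eqA : equivalence_on quad aff.
  split=> [f _|f g _ _|f g e _ _ _]; [exact: aff_refl|exact: aff_sym|exact: aff_trans].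
have eqC : equivalence_on quad crit.
  split=> [f qf|f g _ _|f g e _ _ _]; last exact: crit_trans; last exact: crit_sym.
  exact: aff_crit (aff_refl f).
pose cA i := class_of quad aff (nf i); pose cC i := class_of quad crit (nf i).
have qnf i : (i < 18)%N -> quad (nf i) by exact: nf_quadratic.
have exA f : quad f -> exists2 i, (i < 18)%N & aff f (nf i) by exact: classification.
have clA : classes quad aff = cA @` `I_18 by exact: classes_image.
have injA i j : (i < 18)%N -> (j < 18)%N -> cA i = cA j -> i = j.
  move=> i18 j18 /(class_of_eq eqA (qnf _ i18) (qnf _ j18)); exact: nf_aff_inj.
have excA : exc_aff = cA @` [set i | (12 <= i < 18)%N].
  apply: set_eqP => C; split=> [[m /exceptional_mapsP[i i18 ->] <-]|[i i18 <-]].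
    by exists i.
  by exists (nf i) => //; apply/exceptional_mapsP; exists i.
(* one normal form of each type *)
pose rc i := nth 0%N [:: 0; 1; 2; 3; 4; 5; 6; 7; 8; 9; 10; 11; 12; 14; 16]%N i.
have rc18 i : (i < 15)%N -> (rc i < 18)%N.
  by do 15 (case: i => [|i] //).
have rc_id i : (i < 12)%N -> rc i = i by do 12 (case: i => [|i] //).
have rc_inj i j : (i < 15)%N -> (j < 15)%N -> nf_type (rc i) = nf_type (rc j) -> i = j.
  by do 15 (case: i => [|i]; first by move=> _; do 15 (case: j => [|j] //)).
(* The last clause says that both numberings put the exceptional classes from index 12 on. *)
have rc_surj i : (i < 18)%N -> exists j, [/\ (j < 15)%N, nf_type i = nf_type (rc j) &
    (12 <= i)%N = (12 <= j)%N].
  move=> i18; exists (nth 0%N [:: 0; 1; 2; 3; 4; 5; 6; 7; 8; 9; 10; 11; 12; 12; 13; 13; 14; 14]%N i).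
  by move: i18; do 18 (case: i => [|i] //).
have exC f : quad f -> exists2 i, (i < 15)%N & crit f (nf (rc i)).
  move=> qf; have [i i18 fi] := exA f qf; have [j [j15 ij _]] := rc_surj i i18.
  exists j => //; apply: crit_trans (aff_crit qf (qnf _ i18) fi) _.
  by apply: nf_crit => //; exact: rc18.
have clC : classes quad crit = (cC \o rc) @` `I_15.
  by apply: (@classes_image _ _ _ 15 (fun i => nf (rc i))) => // i i15; exact/qnf/rc18.
have injC i j : (i < 15)%N -> (j < 15)%N -> (cC \o rc) i = (cC \o rc) j -> i = j.
  move=> i15 j15 /(class_of_eq eqC (qnf _ (rc18 _ i15)) (qnf _ (rc18 _ j15))).
  by move/(crit_nf (rc18 _ i15) (rc18 _ j15)); exact: rc_inj.
have cCE i j : (i < 18)%N -> (j < 18)%N -> nf_type i = nf_type j -> cC i = cC j.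
  by move=> i18 j18 e; apply/(class_of_eq eqC) => //; [exact: qnf|exact: qnf|exact: nf_crit].
have excC : exc_crit = (cC \o rc) @` [set i | (12 <= i < 15)%N].
  apply: set_eqP => C; split=> [[m /exceptional_mapsP[i /andP[i12 i18] ->] <-]|[i /andP[i12 i15] <-]].
    have [j [j15 ij e]] := rc_surj i i18; exists j; first by rewrite /= -e i12.
    by apply: cCE => //; exact: rc18.
  exists (nf (rc i)) => //; apply/exceptional_mapsP; exists (rc i) => //.
  by move: i12 i15; do 15 (case: i => [|i] //).
have DA : classes quad aff `\` exc_aff = cA @` `I_12.
  by rewrite clA excA; apply: setD_image_enum.
have DC : classes quad crit `\` exc_crit = cC @` `I_12.
  rewrite clC excC setD_image_enum //; apply: set_eqP => C.
  by split=> -[i i12 <-]; exists i; rewrite //= rc_id.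
have injC12 i j : (i < 12)%N -> (j < 12)%N -> cC i = cC j -> i = j.
  move=> i12 j12 e; apply: injC; rewrite /= ?rc_id //.
    exact: leq_trans i12 _.
  exact: leq_trans j12 _.
have injA12 i j : (i < 12)%N -> (j < 12)%N -> cA i = cA j -> i = j.
  by move=> i12 j12; apply: injA; [exact: leq_trans i12 _|exact: leq_trans j12 _].
pose F (A : set (plane R -> plane R)) := [set g | quad g /\ exists2 f, A f & crit f g].
have FE i : (i < 18)%N -> F (cA i) = cC i.
  (* The critical class of any member of an affine class is that of its normal form, so on the first
     twelve indices the map of the theorem is just [cA i] to [cC i]. *)
  move=> i18; apply: set_eqP => g; split=> [[qg [f [qf fi] fg]]|[qg ig]]; split=> //.
    by apply: crit_trans fg; apply: aff_crit => //; exact: qnf.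
  by exists (nf i) => //; split; [exact: qnf|exact: aff_refl].
split; first by split=> //; exact: card_enum injA clA.
split; first by split=> //; exact: card_enum injC clC.
split; first by move=> f g; exact: aff_crit.
split.
  move=> f g qf qg fg; split=> [afg [ab /exceptional_not_aff nab]|H].
    case=> -[f1 g2]; apply: nab.
      exact: aff_trans (aff_sym f1) (aff_trans afg g2).
    exact: aff_trans (aff_sym g2) (aff_trans (aff_sym afg) f1).
  have [i i18 fi] := exA f qf; have [j j18 gj] := exA g qg.
  have cij : crit (nf i) (nf j).
    apply: crit_trans (crit_sym (aff_crit qf (qnf _ i18) fi)) _.
    exact: crit_trans fg (aff_crit qg (qnf _ j18) gj).
  have [ij|eij|eij] := @nf_type_eq R _ _ i18 j18 (crit_nf i18 j18 cij).
  - by rewrite -ij in gj; apply: aff_trans fi _; exact: aff_sym.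
  - by exfalso; apply: H; exists (nf i, nf j) => //; left.
  - by exfalso; apply: H; exists (nf j, nf i) => //; right.
split.
  move=> ab eab; have nab := exceptional_not_aff eab.
  move/exceptional_pairsP: eab nab => [] -> nab; split=> //; try exact: qnf;
    exact: nf_crit.
split; first exact: card_enum injA12 DA.
split; first exact: card_enum injC12 DC.
rewrite -/F DA DC; split.
- by move=> _ [i i12 <-]; exists i => //; rewrite FE //; exact: leq_trans i12 _.
- move=> A B; rewrite !inE => -[i i12 <-] [j j12 <-].
  rewrite !FE; [|exact: leq_trans j12 _|exact: leq_trans i12 _].
  by move/injC12 => -> //.
- move=> _ [i i12 <-]; exists (cA i); first by exists i.
  by rewrite FE //; exact: leq_trans i12 _.
Qed.
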